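(* Let $A$ be the automaton over $X=\{0,1\}$ with kneading sequence $11(0)^{\omega}$, i.e. the automaton with states $a,b,t,id$ described in the context. Then the group $G(A)$ has subexponential growth. Moreover, $G(A)$ is the iterated monodromy group of a complex post-critically finite quadratic polynomial.
   Context: Let $X=\{0,1\}$ and let $X^{*}$ be the free monoid on $X$, viewed as a rooted binary tree (the children of $w$ are $w0$ and $w1$). The automaton $A$ with kneading sequence $11(0)^{\omega}$ has states $a,b,t,id$, which act as automorphisms of $X^{*}$ fixing the empty word and given recursively by: $id$ is the identity; $t(0w)=1w$, $t(1w)=0w$; $a(0w)=0w$, $a(1w)=1\,t(w)$; $b(0w)=0\,b(w)$, $b(1w)=1\,a(w)$, for all $w\in X^{*}$. $G(A)$ is the subgroup of $\mathrm{Aut}(X^{*})$ generated by $a,b,t$. A finitely generated group has subexponential growth if $\lim_{n\to\infty}|B(n)|^{1/n}=1$, where $B(n)$ is the ball of radius $n$ in the word metric of some (equivalently any) finite generating set. A complex polynomial $p$ is post-critically finite if, for each critical point $c$ of $p$ (i.e. $p'(c)=0$), the set of forward iterates $\{p^{n}(c): n\ge 1\}$ is finite. Let $P$ be the (finite) union of these sets. For a base point $z_0\in\mathbb{C}\setminus P$, the set $\bigsqcup_{n\ge 0}p^{-n}(z_0)$ is a rooted $\deg(p)$-ary tree ($y\in p^{-n}(z_0)$ is joined to $p(y)\in p^{-(n-1)}(z_0)$), on which $\pi_1(\mathbb{C}\setminus P,z_0)$ acts by monodromy (lifting loops through $p^{n}$). The iterated monodromy group $\mathrm{IMG}(p)$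 is the quotient of $\pi_1(\mathbb{C}\setminus P,z_0)$ by the kernel of this action; it is a group of automorphisms of this rooted tree. A group $G\le\mathrm{Aut}(X^{*})$ ''is the iterated monodromy group of $p$'' if some isomorphism of rooted trees from $X^{*}$ to this tree of preimages conjugates $G$ to $\mathrm{IMG}(p)$. *)

(* Defs.v *)
From HB Require Import structures.
From mathcomp Require Import all_boot all_order all_algebra.
From mathcomp Require Import complex finmap.
From mathcomp Require Import all_classical all_reals all_analysis.

Set Implicit Arguments.
Unset Strict Implicit.
Unset Printing Implicit Defensive.

Import Order.TTheory GRing.Theory Num.Theory.
Import numFieldNormedType.Exports.

Local Open Scope classical_set_scope.
Local Open Scope ring_scope.
Local Open Scope complex_scope.

(* Only the data of a rooted tree: [child u v] says that v is a child of u.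
   The two instances below, words and iterated preimages, are trees. *)
Record rootedTree := RootedTree {
  vertex :> Type;
  root_vertex : vertex;
  child : vertex -> vertex -> Prop
}.
Arguments root_vertex : clear implicits.

Record treeIso (T U : rootedTree) := TreeIso {
  iso_fun :> T -> U;
  iso_inv : U -> T;
  iso_funK : cancel iso_fun iso_inv;
  iso_invK : cancel iso_inv iso_fun;
  iso_root : iso_fun (root_vertex T) = root_vertex U;
  iso_child : forall u v : T, child u v <-> child (iso_fun u) (iso_fun v)
}.

Lemma treeIso_eq (T U : rootedTree) (f g : treeIso T U) : f =1 g -> f = g.
Proof.
case: f g => [f f' fK f'K fr fc] [g g' gK g'K gr gc] /= /funext fg.
subst g.
have f'g' : f' = g' by apply/funext => u; rewrite -[u in LHS]g'K fK.
subst g'.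
by congr TreeIso; apply: Prop_irrelevance.
Qed.

Lemma treeIso_id_child (T : rootedTree) (u v : T) : child u v <-> child u v.
Proof. by []. Qed.

Definition treeIso_id (T : rootedTree) : treeIso T T :=
  @TreeIso T T id id (fun=> erefl) (fun=> erefl) erefl
    (@treeIso_id_child T).

Section comp.
Variables (T U V : rootedTree) (g : treeIso U V) (f : treeIso T U).

Lemma treeIso_comp_root : g (f (root_vertex T)) = root_vertex V.
Proof. by rewrite !iso_root. Qed.

Lemma treeIso_comp_child (u v : T) :
  child u v <-> child (g (f u)) (g (f v)).
Proof. exact: iff_trans (iso_child f u v) (iso_child g (f u) (f v)). Qed.

Definition treeIso_comp : treeIso T V :=
  @TreeIso T V (g \o f) (iso_inv f \o iso_inv g)
    (can_comp (iso_funK g) (iso_funK f)) (can_comp (iso_invK f) (iso_invK g))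
    treeIso_comp_root treeIso_comp_child.

Lemma treeIso_inv_root : iso_inv f (root_vertex U) = root_vertex T.
Proof. by rewrite -(iso_root f) iso_funK. Qed.

Lemma treeIso_inv_child (u v : U) :
  child u v <-> child (iso_inv f u) (iso_inv f v).
Proof.
have := iso_child f (iso_inv f u) (iso_inv f v).
by rewrite !iso_invK => -[? ?]; split.
Qed.

Definition treeIso_inv : treeIso U T :=
  @TreeIso U T (iso_inv f) f (iso_invK f) (iso_funK f)
    treeIso_inv_root treeIso_inv_child.
End comp.

Definition treeAut (T : rootedTree) := treeIso T T.

HB.instance Definition _ (T : rootedTree) := gen_eqMixin (treeAut T).
HB.instance Definition _ (T : rootedTree) := gen_choiceMixin (treeAut T).

Section treeAut_group.
Variable T : rootedTree.
Implicit Types f g h : treeAut T.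

Lemma treeAut_mulA : associative (fun f g : treeAut T => treeIso_comp f g).
Proof. by move=> f g h; exact: treeIso_eq. Qed.

Lemma treeAut_mul1 : left_id (treeIso_id T) (fun f g => treeIso_comp f g).
Proof. by move=> f; exact: treeIso_eq. Qed.

Lemma treeAut_mulr1 : right_id (treeIso_id T) (fun f g => treeIso_comp f g).
Proof. by move=> f; exact: treeIso_eq. Qed.

Lemma treeAut_mulV :
  left_inverse (treeIso_id T) (@treeIso_inv T T)
    (fun f g : treeAut T => treeIso_comp f g).
Proof. by move=> f; apply: treeIso_eq => u /=; rewrite iso_funK. Qed.

Lemma treeAut_mulrV :
  right_inverse (treeIso_id T) (@treeIso_inv T T)
    (fun f g : treeAut T => treeIso_comp f g).
Proof. by move=> f; apply: treeIso_eq => u /=; rewrite iso_invK. Qed.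

HB.instance Definition _ := isGroup.Build (treeAut T)
  treeAut_mulA treeAut_mul1 treeAut_mulr1 treeAut_mulV treeAut_mulrV.
End treeAut_group.

Section growth.
Variable gT : groupType.

Definition is_subgroup (H : set gT) : Prop :=
  [/\ H 1%g, (forall x y, H x -> H y -> H (x * y)%g)
    & (forall x, H x -> H x^-1%g)].

Definition generated (S : set gT) : set gT := smallest is_subgroup S.

Definition word_ball (S : seq gT) (n : nat) : set gT :=
  [set (\prod_(s <- w) s)%g | w in
    [set w : seq gT | (size w <= n)%N /\
       {subset w <= S ++ [seq s^-1%g | s <- S]}]].

(* The term n = 0 of the sequence is irrelevant to the limit. *)
Definition subexponential_growth (R : realType) (H : set gT) : Prop :=
  exists S : seq gT,
    generated [set` S] = H /\
    ((#|` fset_set (word_ball S n)|%:R : R) `^ (n%:R)^-1)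
      @[n --> \oo] --> (1 : R).
End growth.

(* The letters 0 and 1 are false and true; the first letter of a word is the
   head of the list, so that the children of w are [rcons w x]. *)
Definition binary_tree : rootedTree :=
  @RootedTree (seq bool) [::] (fun u v => exists x, v = rcons u x).

Inductive state := st_a | st_b | st_t | st_id.

Definition output (q : state) (x : bool) : bool :=
  if q is st_t then ~~ x else x.

Definition transition (q : state) (x : bool) : state :=
  match q, x with
  | st_a, false => st_id
  | st_a, true => st_t
  | st_b, false => st_b
  | st_b, true => st_a
  | st_t, _ => st_id
  | st_id, _ => st_id
  end.

Fixpoint state_act (q : state) (w : seq bool) : seq bool :=
  if w is x :: w' then output q x :: state_act (transition q x) w' else [::].

Lemma state_actK (q : state) : involutive (state_act q).
Proof.
move=> w; elim: w q => [//|x w IHw] q /=.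
by case: q x => -[] /=; rewrite IHw.
Qed.

Lemma state_act_rcons (q : state) (w : seq bool) (x : bool) :
  exists y, state_act q (rcons w x) = rcons (state_act q w) y.
Proof.
elim: w q => [|z w IHw] q /=; first by exists (output q x).
by have [y ->] := IHw (transition q z); exists y.
Qed.

Lemma state_act_child (q : state) (u v : binary_tree) :
  child u v <-> @child binary_tree (state_act q u) (state_act q v).
Proof.
split=> -[x /= vE]; first by rewrite vE; exact: state_act_rcons.
have [y] := state_act_rcons q (state_act q u) x.
by rewrite -vE !state_actK => ->; exists y.
Qed.

Definition state_aut (q : state) : treeAut binary_tree :=
  @TreeIso binary_tree binary_tree (state_act q) (state_act q)
    (state_actK q) (state_actK q) erefl (@state_act_child q).

Definition GA : set (treeAut binary_tree) :=
  generated [set state_aut st_a; state_aut st_b; state_aut st_t].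

(* [R[i]^o] is R[i] with the topology of its norm. *)
Section fundamental_group.
Variable R : realType.
Local Notation C := (R[i]^o).
Local Notation I := (`[0%R : R, 1%R]%classic).

Definition is_loop (D : set C) (z0 : C) (gamma : R -> C) : Prop :=
  [/\ {within I, continuous gamma}, gamma @` I `<=` D,
      gamma 0 = z0 & gamma 1 = z0].

Definition loop_homotopic (D : set C) (z0 : C) (gamma delta : R -> C) : Prop :=
  exists H : R * R -> C,
    [/\ {within I `*` I, continuous H}, H @` (I `*` I) `<=` D,
        (forall s, I s -> H (s, 0) = gamma s),
        (forall s, I s -> H (s, 1) = delta s)
      & (forall r, I r -> H (0, r) = z0 /\ H (1, r) = z0)].

(* The underlying set of the fundamental group of D at z0: an element is a
   homotopy class, represented by the set of all loops in it. *)
Definition pi1 (D : set C) (z0 : C) : set (set (R -> C)) :=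
  [set [set delta | is_loop D z0 delta /\ loop_homotopic D z0 gamma delta]
  | gamma in [set gamma | is_loop D z0 gamma]].
End fundamental_group.

Section img.
Variable R : realType.
Local Notation C := (R[i]^o).
Local Notation I := (`[0%R : R, 1%R]%classic).
Variable p : {poly R[i]}.

Definition iterate (n : nat) (z : C) : C := iter n (horner p) z.

Definition critical : set C := [set c | root p^`() c].

Definition forward_orbit (c : C) : set C :=
  [set iterate n c | n in [set n | (1 <= n)%N]].

Definition post_critically_finite : Prop :=
  forall c, critical c -> finite_set (forward_orbit c).

Definition post_critical : set C := \bigcup_(c in critical) forward_orbit c.

Definition preimage_vertex (z0 : C) : Type :=
  {v : nat * C | iterate v.1 v.2 = z0}.

Definition preimage_tree (z0 : C) : rootedTree :=
  @RootedTree (preimage_vertex z0) (exist _ (0%N, z0) erefl)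
    (fun u v => (sval v).1 = (sval u).1.+1 /\ p.[(sval v).2] = (sval u).2).

(* gamma moves each vertex y of level n to the end point of the lift of gamma
   through the n-th iterate of p that starts at y. *)
Definition monodromy (z0 : C) (gamma : R -> C)
    (tau : treeAut (preimage_tree z0)) : Prop :=
  forall v : preimage_tree z0, exists lift : R -> C,
    [/\ {within I, continuous lift},
        (forall s, I s -> iterate (sval v).1 (lift s) = gamma s),
        lift 0 = (sval v).2
      & sval (tau v) = ((sval v).1, lift 1)].

(* The quotient of the fundamental group by the kernel of the monodromy
   action, realized as the image of that action. *)
Definition IMG (z0 : C) : set (treeAut (preimage_tree z0)) :=
  [set tau | exists2 K, pi1 (~` post_critical) z0 K
                      & forall gamma, K gamma -> monodromy gamma tau].

Arguments IMG : clear implicits.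

Definition is_IMG_of (G : set (treeAut binary_tree)) : Prop :=
  forall z0 : C, ~ post_critical z0 ->
    exists phi : treeIso binary_tree (preimage_tree z0),
      [set (treeIso_comp phi (treeIso_comp g (treeIso_inv phi))
            : treeAut (preimage_tree z0)) | g in G] = IMG z0.
End img.

(* Main.v *)
(* Growth.  The subgroup <a, t> of G(A) is dihedral of order 8, so an element of
   G(A) is given by a word [x0 b x1 b ... b xn] with the xi in <a, t>.  For a
   suitable cost, the total cost of the sections at level three is at most the
   cost of the word, with a loss for each of a set of disjoint windows of five
   letters; a window without loss has its third letter forced by the first two.
   A long word therefore either loses a fixed proportion of its cost in its
   sections, or is almost determined by a few of its letters.  Hence, if the
   number of elements of cost at most n is O(theta^((j + 1) n)), it is also
   O(theta^(j n)), as long as j is above a threshold; choosing theta close to 1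
   gives subexponential growth.

   Monodromy.  Let [a] be a nonreal root of X^3 = X^2 + X + 1.  The polynomial
   z^2 + a - a^2 fixes [a], and its critical orbit is
   [0 -> a - a^2 -> a - 1 -> 1 - a], the last point being fixed.  Cut the plane
   along the rays from the three post-critical points that point away from [a].
   The complement is star-shaped, so the preimage tree is labelled there by
   continuous branches, self-similarly at [a].  Crossing one of the three cuts
   changes the labelling by a generator of G(A): by induction on the level, this
   follows from the fact that the two lifts of a loop around a cut cross the
   cuts prescribed by the automaton, which is checked on explicit polygons with
   vertices in Z + Z a. *)

(* The cost charges 4 for each [b] and the word length in [a], [t] for each interior letter. An
   interior letter 1 or [a] is the only one that can raise the total cost on passing to sections, by
   1, but it leaves a letter 1 in a section. Such letters are not lost at deeper levels, and each
   saves 4 when the words [b 1 b] are cancelled at the end. After k levels a surplus 4 - k remains,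
   and three is the last level where it is positive. Words are cancelled only at that last level, so
   that sections of subwords are subwords of sections and the losses of disjoint windows add up.

   For the monodromy no generators of the fundamental group are needed. The plane without the
   post-critical points is covered by the slit plane and three half-planes, one around the open part
   of each cut. The spokes from [a] make obtuse angles with each other, so a half-plane meets only
   its own cut. On overlaps the labellings differ by elements of G(A), hence a lifted path keeps its
   labelling in one G(A)-orbit. Conversely, each element of G(A) is realised by composing explicit
   paths. *)
From Stdlib Require Import ZArith.
Require Import Defs.
From mathcomp Require Import all_boot all_order all_algebra.
From mathcomp Require Import complex finmap.
From mathcomp Require Import all_classical all_reals all_analysis.
From mathcomp Require Import zify ring lra ssrZ.

Set Implicit Arguments.
Unset Strict Implicit.
Unset Printing Implicit Defensive.

Import Order.TTheory GRing.Theory Num.Theory.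
Import numFieldNormedType.Exports.

(** * Growth *)

(* [(e, s0, s1)] acts on words of length two by [c c' |-> (c + e) (c' + s_c)], so
   that [dih] encodes the group <a, t>. *)
Definition dih : Type := (bool * bool * bool)%type.

Definition dih_one : dih := (false, false, false).
Definition dih_a : dih := (false, false, true).
Definition dih_flip (s : bool) : dih := (s, false, false).
Definition dih_sec (x : dih) (c : bool) : bool := if c then x.2 else x.1.2.
Definition dih_mul (x y : dih) : dih :=
  (x.1.1 (+) y.1.1, x.1.2 (+) dih_sec y x.1.1, x.2 (+) dih_sec y (~~ x.1.1)).

Definition dih_act (x : dih) (w : seq bool) : seq bool :=
  if w is c :: w' then
    (c (+) x.1.1) :: (if dih_sec x c then state_act st_t w' else w')
  else [::].

(** The word length with respect to [a] and [t]. Among the elements that fix the first letter, [s0]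
    holds only for [tat] and [atat], of lengths 3 and 4. *)
Definition dih_len (x : dih) : nat :=
  if x.1.1 then (1 + x.1.2 + x.2)%N else (3 * x.1.2 + x.2)%N.

Lemma state_act_id (w : seq bool) : state_act st_id w = w.
Proof. by elim: w => //= c w ->. Qed.

Lemma dih_act_mul (x y : dih) (w : seq bool) :
  dih_act (dih_mul x y) w = dih_act y (dih_act x w).
Proof.
case: w => [//|c w]; case: x => [[e s0] s1]; case: y => [[f u0] u1].
have tt v : state_act st_t (state_act st_t v) = v by apply: state_actK.
by case: c e s0 s1 f u0 u1 => [] [] [] [] [] [] [] //=; rewrite -/(state_act st_t) tt.
Qed.

Lemma dih_act_one (w : seq bool) : dih_act dih_one w = w.
Proof. by case: w => [//|[] w]. Qed.

Lemma dih_act_a (w : seq bool) : dih_act dih_a w = state_act st_a w.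
Proof. by case: w => [//|[] w] //=; rewrite state_act_id. Qed.

Lemma dih_act_flip (s : bool) (w : seq bool) :
  dih_act (dih_flip s) w = if s then state_act st_t w else w.
Proof. by case: w s => [|[] w] [] //=; rewrite state_act_id. Qed.

Lemma dih_len_mul (x y : dih) : (dih_len (dih_mul x y) <= dih_len x + dih_len y)%N.
Proof. by case: x => [[[] []] []]; case: y => [[[] []] []]. Qed.

Lemma dih_mul1 (x : dih) : dih_mul dih_one x = x.
Proof. by case: x => [[[] []] []]. Qed.

Lemma dih_mulA (x y z : dih) : dih_mul x (dih_mul y z) = dih_mul (dih_mul x y) z.
Proof. by case: x => [[[] []] []]; case: y => [[[] []] []]; case: z => [[[] []] []]. Qed.

(* [(x0, [:: x1; ...; xn])] stands for [x0 b x1 b ... b xn], the leftmost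
   factor acting first. *)
Definition nword : Type := (dih * seq dih)%type.

Fixpoint run (s : seq dih) (w : seq bool) : seq bool :=
  if s is x :: s' then run s' (dih_act x (state_act st_b w)) else w.

Definition nact (W : nword) (w : seq bool) : seq bool := run W.2 (dih_act W.1 w).

(* Sums over the letters with a [b] on both sides. *)
Fixpoint isum (f : dih -> nat) (s : seq dih) : nat :=
  if s is x :: s' then (if s' is [::] then 0 else f x + isum f s')%N else 0%N.

Lemma isum_cons1 (f : dih -> nat) (x : dih) : isum f [:: x] = 0%N.
Proof. by []. Qed.

Lemma isum_cons2 (f : dih -> nat) (x y : dih) (s : seq dih) :
  isum f [:: x, y & s] = (f x + isum f (y :: s))%N.
Proof. by []. Qed.

Definition cost (W : nword) : nat := (4 * size W.2 + isum dih_len W.2)%N.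

(** Here [c] is the letter that the next [b] meets, and [p] the product gathered since the last [b]
    of the section. Meeting [true], this [b] contributes its section [a] to [p]; meeting [false], it
    remains a [b] and closes [p]. *)
Fixpoint sec (c : bool) (p : dih) (s : seq dih) : nword :=
  if s is x :: s' then
    let c' := c (+) x.1.1 in
    if c then sec c' (dih_mul (dih_mul p dih_a) (dih_flip x.2)) s'
    else let: (q, r) := sec c' (dih_flip x.1.2) s' in (p, q :: r)
  else (p, [::]).

Definition section (c : bool) (W : nword) : nword :=
  sec (c (+) W.1.1.1) (dih_flip (dih_sec W.1 c)) W.2.

Fixpoint parity (s : seq dih) : bool :=
  if s is x :: s' then x.1.1 (+) parity s' else false.

Lemma run_cons (x : dih) (s : seq dih) (c : bool) (v : seq bool) :
  run (x :: s) (c :: v) =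
  run s ((c (+) x.1.1) ::
           dih_act (dih_flip (dih_sec x c)) (state_act (transition st_b c) v)).
Proof. by rewrite dih_act_flip. Qed.

Lemma run_sec (s : seq dih) (c : bool) (p : dih) (w : seq bool) :
  run s (c :: dih_act p w) = (c (+) parity s) :: nact (sec c p s) w.
Proof.
elim: s c p w => [|x s IHs] c p w; first by rewrite /= addbF.
rewrite run_cons [parity _]/= addbA.
case: c.
  by rewrite [transition _ _]/= -dih_act_a -!dih_act_mul IHs dih_mulA.
by rewrite IHs [sec false _ _]/=; case: (sec _ _ s) => q r.
Qed.

Lemma nact_section (W : nword) (c : bool) (w : seq bool) :
  nact W (c :: w) = (c (+) (W.1.1.1 (+) parity W.2)) :: nact (section c W) w.
Proof. by rewrite /nact [dih_act _ _]/= -dih_act_flip run_sec addbA. Qed.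

Lemma nact_nil (W : nword) : nact W [::] = [::].
Proof. by case: W => x s; rewrite /nact /=; elim: s. Qed.

(** * Cancellation of [b 1 b] *)

Definition pushl (x : dih) (W : nword) : nword :=
  let: (q, r) := W in
  if r is y :: r' then (if q == dih_one then (dih_mul x y, r') else (x, q :: r))
  else (x, [:: q]).

(** A letter becomes interior only when another one is put in front of it, so one test per step is
    enough. A product that becomes 1 is an end letter at first and is tested at the next step. *)
Fixpoint red (x : dih) (s : seq dih) : nword :=
  if s is y :: s' then pushl x (red y s') else (x, [::]).

Lemma nact_red (x : dih) (s : seq dih) (w : seq bool) : nact (red x s) w = nact (x, s) w.
Proof.
elim: s x w => [//|y s IHs] x w.
have {IHs} := IHs y (state_act st_b (dih_act x w)); rewrite /nact /= => <-.
case: (red y s) => q [//|z r] /=; case: eqP => [->|//] /=.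
by rewrite dih_act_one dih_act_mul state_actK.
Qed.

Definition is_one (x : dih) : nat := (x == dih_one).
Definition is_one_or_a (x : dih) : nat := ((x == dih_one) || (x == dih_a)).
Definition is_tat_or_atat (x : dih) : nat := (~~ x.1.1 && x.1.2).

(** A cancellation [x b 1 b y = xy] removes two [b], worth 8, and lowers the number of letters 1 by
    at most two, as in [b 1 b 1 b = b]; hence a saving of 4 per letter 1. The third clause counts
    the first letter as interior, which it becomes at the next step of the induction. *)
Lemma red_cost (x : dih) (s : seq dih) :
  [/\ isum is_one (red x s).2 = 0,
      (cost (red x s) + 4 * isum is_one s <= cost (x, s))%N
    & (4 * size (red x s).2 + isum dih_len ((red x s).1 :: (red x s).2)
         + 4 * isum is_one (x :: s) <=
       4 * size s + isum dih_len (x :: s)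
         + 4 * isum is_one ((red x s).1 :: (red x s).2))%N].
Proof.
elim: s x => [//|y s IHs] x; have {IHs} := IHs y.
rewrite /cost /fst /snd !isum_cons2 [red x _]/= [size (y :: s)]/=.
move: (size s) => m.
move: (isum is_one (y :: s)) (isum dih_len (y :: s)) => O L.
have one01 : (is_one x <= 1)%N by rewrite /is_one; case: (_ == _).
case: (red y s) => q [|z r]; rewrite /pushl.
  by rewrite /fst /snd ?isum_cons2 ?isum_cons1 /= => -[_ _ H]; split; lia.
have len1 := dih_len_mul x z.
case: eqP => [->|/eqP qN1]; rewrite /fst /snd !isum_cons2 ?[size (_ :: _)]/=.
  have -> : is_one dih_one = 1%N by [].
  have -> : dih_len dih_one = 0%N by [].
  case: r => [|u r]; first by rewrite ?isum_cons1 /= => -[_ _ H]; split; lia.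
  rewrite !isum_cons2; move: (isum _ (u :: r)) (isum _ (u :: r)) (size _) => A B C.
  by move=> [H1 H2 H3]; split; lia.
have -> : is_one q = 0%N by rewrite /is_one (negbTE qN1).
move: (isum is_one (z :: r)) (isum dih_len (z :: r)) (size r) => A B C.
by move=> [H1 H2 H3]; split; lia.
Qed.

(** * Cost of the sections at one level *)

Definition letters (W : nword) : seq dih := W.1 :: W.2.

Lemma letters_pair (x : dih) (s : seq dih) : letters (x, s) = x :: s.
Proof. by []. Qed.

Lemma isum_letters (f : dih -> nat) (x : dih) (W : nword) :
  isum f (x :: letters W) = (f x + isum f (letters W))%N.
Proof. by []. Qed.

(** What a [b] followed by [x] hands to the letters of the two sections together: one [a] from the
    [b], and a [t] for each of the two flips of [x] that is present. *)
Definition dih_spread (x : dih) : nat := (1 + x.1.2 + x.2)%N.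

Lemma isum_add (f g f' g' : dih -> nat) (s : seq dih) :
  (forall x, f x + g x <= f' x + g' x)%N ->
  (isum f s + isum g s <= isum f' s + isum g' s)%N.
Proof.
move=> fg; elim: s => [//|x [//|y s] IHs].
by rewrite !isum_cons2; have := fg x; lia.
Qed.

Lemma isum_behead (f : dih -> nat) (x : dih) (s : seq dih) :
  (isum f s <= isum f (x :: s))%N.
Proof. by case: s => [//|y s]; rewrite isum_cons2; lia. Qed.

(** In fact an equality for all eight elements: 1 and [a] get longer by one in the sections, [tat]
    and [atat] shorter by one. *)
Lemma dih_spread_len (x : dih) :
  (dih_spread x + is_tat_or_atat x <= dih_len x + is_one_or_a x)%N.
Proof. by case: x => [[[] []] []]. Qed.

Lemma sec_nil (c : bool) (p : dih) : sec c p [::] = (p, [::]).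
Proof. by []. Qed.

Lemma sec_true (p x : dih) (s : seq dih) :
  sec true p (x :: s) =
  sec (~~ x.1.1) (dih_mul (dih_mul p dih_a) (dih_flip x.2)) s.
Proof. by []. Qed.

Lemma sec_false (p x : dih) (s : seq dih) :
  sec false p (x :: s) = (p, letters (sec x.1.1 (dih_flip x.1.2) s)).
Proof. by rewrite /=; case: (sec _ _ s). Qed.

Lemma dih_len_flip (b : bool) : dih_len (dih_flip b) = b.
Proof. by case: b. Qed.

Lemma dih_len_acc (p : dih) (b : bool) :
  (dih_len (dih_mul (dih_mul p dih_a) (dih_flip b)) <= dih_len p + 1 + b)%N.
Proof.
have h1 := dih_len_mul (dih_mul p dih_a) (dih_flip b).
have h2 := dih_len_mul p dih_a.
by rewrite dih_len_flip in h1; have : dih_len dih_a = 1%N by []; lia.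
Qed.

(** The two paths meet opposite letters at every step, so that each [b] stays a [b] in exactly one
    section and becomes an [a] in the other. *)
Lemma size_sec (s : seq dih) (c : bool) (p q : dih) :
  (size (sec c p s).2 + size (sec (~~ c) q s).2)%N = size s.
Proof.
elim: s c p q => [//|x s IHs] c p q.
case: c; rewrite [~~ _]/= !sec_true !sec_false [(_, _).2]/= [size (letters _)]/=.
- have := IHs (~~ x.1.1) (dih_mul (dih_mul p dih_a) (dih_flip x.2)) (dih_flip x.1.2).
  by rewrite negbK [size (x :: s)]/=; lia.
- have := IHs x.1.1 (dih_flip x.1.2) (dih_mul (dih_mul q dih_a) (dih_flip x.2)).
  by rewrite [size (x :: s)]/=; lia.
Qed.

Lemma len_sec (s : seq dih) (c : bool) (p q : dih) :
  (isum dih_len (letters (sec c p s)) + isum dih_len (letters (sec (~~ c) q s)) <=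
   dih_len p + dih_len q + isum dih_spread s)%N.
Proof.
elim: s c p q => [//|x s IHs] c p q.
have spread : dih_spread x = (1 + x.1.2 + x.2)%N by [].
case: c; rewrite [~~ _]/= !sec_true !sec_false.
- have := IHs (~~ x.1.1) (dih_mul (dih_mul p dih_a) (dih_flip x.2)) (dih_flip x.1.2).
  have := dih_len_acc p x.2; rewrite negbK dih_len_flip.
  case: s {IHs} => [|y s]; first by rewrite !sec_nil /=; lia.
  by rewrite letters_pair isum_letters isum_cons2; lia.
- have := IHs x.1.1 (dih_flip x.1.2) (dih_mul (dih_mul q dih_a) (dih_flip x.2)).
  have := dih_len_acc q x.2; rewrite dih_len_flip.
  case: s {IHs} => [|y s]; first by rewrite !sec_nil /=; lia.
  by rewrite letters_pair isum_letters isum_cons2; lia.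
Qed.

(** The variant of [len_sec] in which the second section starts here: its first letter, to which [q]
    contributes, is an end letter and free of cost. *)
Lemma len_sec_free (s : seq dih) (c : bool) (p q : dih) :
  (isum dih_len (letters (sec c p s)) + isum dih_len (sec (~~ c) q s).2 <=
   dih_len p + isum dih_spread s)%N.
Proof.
elim: s c p q => [//|x s IHs] c p q.
have spread : dih_spread x = (1 + x.1.2 + x.2)%N by [].
case: c; rewrite [~~ _]/= !sec_true !sec_false ?[(_, letters _).2]/=.
- have := len_sec s (~~ x.1.1) (dih_mul (dih_mul p dih_a) (dih_flip x.2)) (dih_flip x.1.2).
  have := dih_len_acc p x.2; rewrite negbK dih_len_flip.
  case: s {IHs} => [|y s]; first by rewrite !sec_nil /=; lia.
  by rewrite isum_cons2; lia.
- have := IHs x.1.1 (dih_flip x.1.2) (dih_mul (dih_mul q dih_a) (dih_flip x.2)).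
  rewrite dih_len_flip.
  case: s {IHs} => [|y s]; first by rewrite !sec_nil /=; lia.
  by rewrite letters_pair isum_letters isum_cons2; lia.
Qed.

(** The letters 1 and [a] are those that fix a leading 0 and act trivially below it. On the path
    that meets 0, the word [b x b] with such an [x] therefore has the section [b 1 b]. *)
Lemma ones_sec (s : seq dih) (c : bool) (p q : dih) :
  (isum is_one_or_a s <=
   isum is_one (sec c p s).2 + isum is_one (sec (~~ c) q s).2)%N.
Proof.
(* The term [r == [::]] accounts for a last letter [x], which is not interior. *)
have step x r : (is_one_or_a x + isum is_one (sec x.1.1 (dih_flip x.1.2) r).2 <=
    isum is_one (letters (sec x.1.1 (dih_flip x.1.2) r)) + (r == [::]))%N.
  case: x => [[e s0] s1]; rewrite /is_one_or_a.
  have [|_] := boolP (_ || _); last first.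
    rewrite add0n (leq_trans (isum_behead _ (sec e (dih_flip s0) r).1 _)) //.
    exact: leq_addr.
  case: r => [|y r]; first by rewrite !sec_nil /=.
  have sE : sec false (dih_flip false) (y :: r) =
      (dih_one, letters (sec y.1.1 (dih_flip y.1.2) r)) by rewrite sec_false.
  by case: e s0 s1 => [] [] [] // _; rewrite sE !letters_pair isum_letters addn0.
elim: s c p q => [//|x s IHs] c p q.
case: c; rewrite [~~ _]/= !sec_true !sec_false [(_, _).2]/=.
- have := IHs (~~ x.1.1) (dih_mul (dih_mul p dih_a) (dih_flip x.2)) (dih_flip x.1.2).
  rewrite negbK; have := step x s.
  by case: s {IHs step} => [|y s]; rewrite ?isum_cons1 ?isum_cons2 //=; lia.
- have := IHs x.1.1 (dih_flip x.1.2) (dih_mul (dih_mul q dih_a) (dih_flip x.2)).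
  have := step x s.
  by case: s {IHs step} => [|y s]; rewrite ?isum_cons1 ?isum_cons2 //=; lia.
Qed.

Lemma ones_section (W : nword) :
  (isum is_one_or_a W.2 <=
   isum is_one (section false W).2 + isum is_one (section true W).2)%N.
Proof. by rewrite /section addFb addTb; exact: ones_sec. Qed.

Lemma cost_section (W : nword) :
  (cost (section false W) + cost (section true W) + isum is_tat_or_atat W.2 <=
   cost W + isum is_one_or_a W.2)%N.
Proof.
case: W => x s; rewrite /section addFb addTb [(x, s).1]/= [(x, s).2]/=.
have := isum_add s dih_spread_len.
have := size_sec s x.1.1 (dih_flip (dih_sec x false)) (dih_flip (dih_sec x true)).
rewrite /cost [(x, s).2]/=.
suff : (isum dih_len (sec x.1.1 (dih_flip (dih_sec x false)) s).2 +
        isum dih_len (sec (~~ x.1.1) (dih_flip (dih_sec x true)) s).2 <=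
        isum dih_spread s)%N by lia.
move: (dih_flip _) (dih_flip _) => p q; case: s => [//|y s].
have spread : dih_spread y = (1 + y.1.2 + y.2)%N by [].
case: x.1.1; rewrite [~~ _]/= sec_true sec_false [(_, _).2]/=.
- have := len_sec_free s y.1.1 (dih_flip y.1.2) (dih_mul (dih_mul q dih_a) (dih_flip y.2)).
  rewrite dih_len_flip; case: s => [|z s]; first by rewrite !sec_nil /=.
  by rewrite isum_cons2; lia.
- have := len_sec_free s y.1.1 (dih_flip y.1.2) (dih_mul (dih_mul p dih_a) (dih_flip y.2)).
  rewrite dih_len_flip; case: s => [|z s]; first by rewrite !sec_nil /=.
  by rewrite isum_cons2; lia.
Qed.

(** * Cost at level three *)

Fixpoint total_cost (k : nat) (W : nword) : nat :=
  if k is k'.+1 then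
    (total_cost k' (section false W) + total_cost k' (section true W))%N
  else cost (red W.1 W.2).

Fixpoint ones_at (k : nat) (W : nword) : nat :=
  if k is k'.+1 then (ones_at k' (section false W) + ones_at k' (section true W))%N
  else isum is_one W.2.

Fixpoint tats_below (k : nat) (W : nword) : nat :=
  if k is k'.+1 then
    (isum is_tat_or_atat W.2 +
       (tats_below k' (section false W) + tats_below k' (section true W)))%N
  else 0%N.

Definition gain (k : nat) (W : nword) : nat := (ones_at k W + tats_below k W)%N.

Lemma ones_at_ge (k : nat) (W : nword) : (isum is_one W.2 <= ones_at k W)%N.
Proof.
elim: k W => [//|k IHk] W /=.
have := ones_section W; have := IHk (section false W); have := IHk (section true W).
suff : (isum is_one W.2 <= isum is_one_or_a W.2)%N by lia.
have := @isum_add is_one is_one is_one_or_a is_one_or_a W.2.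
suff le x : (is_one x <= is_one_or_a x)%N by move=> /(_ _); move=> H; have := H (fun x => leq_add (le x) (le x)); lia.
by rewrite /is_one /is_one_or_a; case: (_ == _).
Qed.

(** The increase due to interior letters 1 and [a] is at most the number of letters 1 in the
    sections, hence at most their number at the last level. There each of them gives up one unit of
    its saving per level passed, starting from the 4 of [red_cost]. *)
Lemma total_cost_le (k : nat) (W : nword) : (k <= 4)%N ->
  (total_cost k W + (4 - k) * ones_at k W + tats_below k W <= cost W)%N.
Proof.
elim: k W => [|k IHk] W k4 /=.
  by have [_ + _] := red_cost W.1 W.2; rewrite -surjective_pairing; lia.
have := cost_section W; have := ones_section W.
have := IHk (section false W) (ltnW k4); have := IHk (section true W) (ltnW k4).
have := ones_at_ge k (section false W); have := ones_at_ge k (section true W).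
have -> : (4 - k = (4 - k.+1).+1)%N by lia.
by move: (4 - k.+1)%N => m; nia.
Qed.

Lemma total_cost_gain (W : nword) : (total_cost 3 W + gain 3 W <= cost W)%N.
Proof. by have := @total_cost_le 3 W erefl; rewrite /gain; lia. Qed.

(** * Concatenation, and windows with a gain *)

Definition lmul (p : dih) (W : nword) : nword := (dih_mul p W.1, W.2).
Definition consw (p : dih) (W : nword) : nword := (p, letters W).

Fixpoint nmul (x : dih) (s : seq dih) (V : nword) : nword :=
  if s is y :: s' then consw x (nmul y s' V) else lmul x V.

Lemma sec_lmul (p q : dih) (s : seq dih) (c : bool) :
  sec c (dih_mul p q) s = lmul p (sec c q s).
Proof.
elim: s c p q => [//|x s IHs] [] p q; last by rewrite !sec_false.
by rewrite !sec_true -IHs !dih_mulA.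
Qed.

Lemma section_cons (c : bool) (x y : dih) (s : seq dih) :
  section c (x, y :: s) =
  if c (+) x.1.1 then
    lmul (dih_mul (dih_flip (dih_sec x c)) dih_a) (section true (y, s))
  else consw (dih_flip (dih_sec x c)) (section false (y, s)).
Proof.
rewrite /section [(x, _).1]/= [(x, _).2]/=.
by case: (c (+) _); rewrite ?sec_false // sec_true sec_lmul.
Qed.

Lemma section_consw (c : bool) (x : dih) (W : nword) :
  section c (consw x W) =
  if c (+) x.1.1 then
    lmul (dih_mul (dih_flip (dih_sec x c)) dih_a) (section true W)
  else consw (dih_flip (dih_sec x c)) (section false W).
Proof. by case: W => y s; rewrite -section_cons. Qed.

Definition nmulw (U V : nword) : nword := nmul U.1 U.2 V.

Lemma nmulw_lmul (p : dih) (U V : nword) : nmulw (lmul p U) V = lmul p (nmulw U V).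
Proof. by case: U => x [|y s] //; rewrite /nmulw /lmul /= dih_mulA. Qed.

Lemma dih_flipD (b c : bool) :
  dih_flip (b (+) c) = dih_mul (dih_flip b) (dih_flip c).
Proof. by case: b c => [] []. Qed.

(** The cocycle rule for sections of a product. It holds for the words themselves, and not only for
    the maps that they represent, because neither [nmulw] nor [section] cancels. *)
Lemma section_nmulw (c : bool) (U V : nword) :
  section c (nmulw U V) =
  nmulw (section c U) (section (c (+) (U.1.1.1 (+) parity U.2)) V).
Proof.
case: U => x s; rewrite /nmulw; elim: s c x => [|y s IHs] c x.
  rewrite /section /= addbF /nmul /= -sec_lmul addbA.
  congr (sec _ _ _); case: c x V => [] [[[] s0] s1] [[[e u0] u1] r] /=;
    exact: dih_flipD.
rewrite [nmul _ _ _]/= section_consw section_cons !IHs [parity _]/=.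
have -> : c (+) ((x, y :: s).1.1.1 (+) (y.1.1 (+) parity s)) =
    (c (+) x.1.1) (+) ((y, s).1.1.1 (+) parity (y, s).2) by rewrite /= addbA.
by case: (c (+) x.1.1) => //; rewrite -[RHS]/(nmulw _ _) nmulw_lmul.
Qed.

Lemma isum_nmulw (f : dih -> nat) (U V : nword) :
  (isum f U.2 + isum f V.2 <= isum f (nmulw U V).2)%N.
Proof.
case: U => x s; rewrite /nmulw [(x, s).2]/= [(x, s).1]/=.
elim: s x => [//|y s IHs] x; have := IHs y; rewrite [nmul x _ _]/=.
case: s {IHs} => [|z s]; first by rewrite /= /letters; have := isum_behead f (dih_mul y V.1) V.2; rewrite /=; lia.
rewrite -[nmul y (z :: s) V]/(consw y (nmul z s V)); move: (nmul z s V) => W.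
by rewrite /consw ![(_, _).2]/= letters_pair isum_letters isum_cons2; lia.
Qed.

Lemma gain_nmulw (k : nat) (U V : nword) : (gain k U + gain k V <= gain k (nmulw U V))%N.
Proof.
rewrite /gain; elim: k U V => [|k IHk] U V /=.
  by have := isum_nmulw is_one U V; lia.
rewrite !section_nmulw addFb addTb.
have := isum_nmulw is_tat_or_atat U V.
move: (U.1.1.1 (+) parity U.2) => c.
have := IHk (section false U) (section c V).
have := IHk (section true U) (section (~~ c) V).
by case: c => /=; lia.
Qed.

Lemma gain_cat (k : nat) (x : dih) (s r : seq dih) :
  (gain k (x, s) + gain k (dih_one, r) <= gain k (x, s ++ r))%N.
Proof.
suff -> : (x, s ++ r) = nmulw (x, s) (dih_one, r) by apply: gain_nmulw.
rewrite /nmulw [_.2]/= [_.1]/=; elim: s x => [|y s IHs] x /=; last by rewrite -IHs.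
by rewrite /lmul; case: x => [[[] []] []].
Qed.

Definition dihs : seq dih :=
  [seq (e, s1) | e <- [seq (e, s0) | e <- [:: false; true], s0 <- [:: false; true]],
                 s1 <- [:: false; true]].

Lemma mem_dihs (x : dih) : x \in dihs.
Proof. by case: x => [[[] []] []]. Qed.

(* [forced u v] is the only letter that can follow [u, v] in a word whose
   sections at level three show no gain. *)
Definition forced (u v : dih) : dih :=
  head dih_one [seq x <- dihs |
    has (fun z => gain 3 (dih_one, [:: u; v; x; z; dih_one]) == 0%N) dihs].

(** A finite check over the [8 ^ 4] choices of [u], [v], [x], [z]. The fifth letter is an end letter
    of the window, so it may be taken to be 1 here. *)
Lemma forced_check :
  all (fun u => all (fun v => let f := forced u v in all (fun x => (x == f) || all (fun z =>
    (0 < gain 3 (dih_one, [:: u; v; x; z; dih_one]))%N) dihs) dihs) dihs) dihs.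
Proof. by vm_compute. Qed.

Lemma gain_not_forced (u v x z y : dih) : x != forced u v ->
  (0 < gain 3 (dih_one, [:: u; v; x; z; y]))%N.
Proof.
move=> xf; have /allP/(_ _ (mem_dihs u))/allP/(_ _ (mem_dihs v)) := forced_check.
move=> /allP/(_ _ (mem_dihs x)); rewrite (negbTE xf) => /allP/(_ _ (mem_dihs z)) gt0.
have := gain_nmulw 3 (dih_one, [:: u; v; x; z; dih_one]) (y, [::]).
rewrite -[nmulw _ _]/(dih_one, [:: u; v; x; z; dih_mul dih_one y]) dih_mul1.
by apply: leq_trans; rewrite ltn_addr.
Qed.

(* Counts disjoint windows with a gain; [st] holds the last letters read since
   the previous window. *)
Fixpoint count_gains (st s : seq dih) {struct s} : nat :=
  if s is x :: s' then
    match st with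
    | [:: u; v] =>
        if x == forced u v then count_gains [:: v; x] s'
        else if s' is [:: z, y & s''] then (count_gains [::] s'').+1 else 0%N
    | _ => count_gains (rcons st x) s'
    end
  else 0%N.

Lemma gain_suffix (k : nat) (s r : seq dih) :
  (gain k (dih_one, r) <= gain k (dih_one, s ++ r))%N.
Proof. by apply: leq_trans (gain_cat k dih_one s r); rewrite leq_addl. Qed.

Lemma count_gains_le (st s : seq dih) : (size st <= 2)%N ->
  (count_gains st s <= gain 3 (dih_one, st ++ s))%N.
Proof.
have [n] := ubnP (size s); elim: n st s => // n IHn st [|x s] //= sn st2.
have aux (st' : seq dih) : (size st' < 2)%N ->
    (count_gains (rcons st' x) s <= gain 3 (dih_one, st' ++ x :: s))%N.
  by move=> h; rewrite -cat_rcons; apply: IHn; rewrite ?size_rcons.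
case: st st2 aux => [|u [|v [|w st]]] //= st2 aux; [exact: (aux [::])|exact: (aux [:: u])|].
case: eqP => [_|/eqP xf].
  apply: leq_trans (gain_suffix 3 [:: u] _); exact: (IHn [:: v; x]).
case: s sn {aux} => [|z [|y s]] // sn.
apply: leq_trans (gain_cat 3 dih_one [:: u; v; x; z; y] s).
rewrite -add1n leq_add ?gain_not_forced //.
by apply: (IHn [::]) => //; move: sn => /=; lia.
Qed.

(** * Counting words with few gains *)

Section covering.
Variable R : realType.
Local Open Scope ring_scope.

(** An upper bound on the cardinality of [A] that passes to unions, images and products without
    decidable equality on [T]. *)
Definition covered (T : Type) (A : T -> Prop) (r : R) : Prop :=
  exists (J : finType) (g : J -> T),
    #|J|%:R <= r /\ forall x, A x -> exists j, g j = x.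

Lemma covered_sub (T : Type) (A B : T -> Prop) (r s : R) :
  (forall x, A x -> B x) -> r <= s -> covered B r -> covered A s.
Proof.
move=> AB rs [J [g [Jr gB]]]; exists J, g; split; first exact: le_trans rs.
by move=> x /AB; exact: gB.
Qed.

Lemma covered_union (T : Type) (A B : T -> Prop) (r s : R) :
  covered A r -> covered B s -> covered (fun x => A x \/ B x) (r + s).
Proof.
move=> [J [g [Jr gA]]] [K [h [Ks hB]]].
exists (J + K)%type, (fun j => match j with inl i => g i | inr i => h i end).
split; first by rewrite card_sum natrD lerD.
by move=> x [/gA [j <-]|/hB [j <-]]; [exists (inl j)|exists (inr j)].
Qed.

Lemma covered_image2 (T U V : Type) (f : T -> U -> V) (A : T -> Prop)
    (B : U -> Prop) (r s : R) : covered A r -> covered B s ->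
  covered (fun z => exists x y, [/\ A x, B y & z = f x y]) (r * s).
Proof.
move=> [J [g [Jr gA]]] [K [h [Ks hB]]].
exists (J * K)%type, (fun j => f (g j.1) (h j.2)); split.
  by rewrite card_prod natrM ler_pM.
by move=> z [x [y [/gA [j <-] /hB [k <-] ->]]]; exists (j, k).
Qed.

Lemma covered_fin (I : finType) (T : Type) (A : I -> T -> Prop) (r : R) :
  (forall i, covered (A i) r) ->
  covered (fun x => exists i, A i x) (#|I|%:R * r).
Proof.
move=> Ar; suff H (s : seq I) : covered (fun x => exists i, i \in s /\ A i x) ((size s)%:R * r).
  apply: covered_sub (H (enum I)); last by rewrite -cardT.
  by move=> x [i Ai]; exists i; rewrite mem_enum.
elim: s => [|i s IHs].
  by exists void, (fun j : void => match j with end); rewrite card_void mul0r; split=> // x [? []].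
rewrite /= -natr1 mulrDl mul1r addrC.
apply: covered_sub (lexx _) (covered_union (Ar i) IHs) => x [j [+ Aj]].
by rewrite inE => /predU1P[<-|js]; [left|right; exists j].
Qed.

Lemma covered_one (T : Type) (a : T) : covered (eq^~ a) 1.
Proof. by exists unit, (fun=> a); rewrite card_unit; split=> // x ->; exists tt. Qed.

Lemma covered_full (I : finType) : covered (fun _ : I => True) #|I|%:R.
Proof. by exists I, id; split=> // x _; exists x. Qed.

Lemma card_dih : #|{: bool * bool * bool}| = 8%N.
Proof. by rewrite !card_prod card_bool. Qed.

Definition few (n e : nat) (st s : seq dih) : Prop :=
  size s = n /\ (count_gains st s <= e)%N.

Lemma covered_size (n : nat) : covered (fun s : seq dih => size s = n) (8 ^+ n).
Proof.
elim: n => [|n IHn].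
  by apply: covered_sub (lexx _) (covered_one [::]) => -[].
rewrite exprS; have := covered_image2 cons (covered_full (bool * bool * bool)%type) IHn.
rewrite card_dih; apply: covered_sub => // -[//|x s] [sn].
by exists x, s.
Qed.

Variables mu Y : R.
Hypothesis mu_ge1 : 1 <= mu.
Hypothesis Y_ge1 : 1 <= Y.
Hypothesis Y_big : 8 ^+ 5 <= Y * (mu - 1).

(** Each letter read while the state fills up has 8 choices, paid by the exponent [4 - size st]. The
    [8 ^ 2] left at a full state pays for words of at most two letters. A window is paid by a factor
    [Y]. *)
Definition few_bound (n e : nat) (st : seq dih) : R :=
  8 ^+ (4 - size st) * Y ^+ e * mu ^+ n.

(** With a full state, the next letter is forced, or a window takes three more letters, with [8 ^ 3]
    choices, uses one unit of [e] and clears the state. The constant in [Y_big] is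
    [8 ^ 3 * 8 ^ 4 / 8 ^ 2]. *)
Lemma few_bound_step (n e : nat) : few_bound n e.+1 [::] * 8 ^+ 3 * Y^-1 +
  few_bound n.+2 e.+1 [:: dih_one; dih_one] <= few_bound n.+3 e.+1 [:: dih_one; dih_one].
Proof.
rewrite /few_bound /= !subn0.
have -> : (4 - 2 = 2)%N by [].
have Y0 : 0 < Y by apply: lt_le_trans Y_ge1.
have -> : 8 ^+ 4 * Y ^+ e.+1 * mu ^+ n * 8 ^+ 3 * Y^-1 =
   8 ^+ 5 * (8 ^+ 2 * Y ^+ e * mu ^+ n) by rewrite [Y ^+ _]exprS; field; rewrite gt_eqF.
have -> : 8 ^+ 2 * Y ^+ e.+1 * mu ^+ n.+3 =
   8 ^+ 2 * Y ^+ e * mu ^+ n * (Y * (mu - 1)) * mu ^+ 2 + 8 ^+ 2 * Y ^+ e.+1 * mu ^+ n.+2.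
  by rewrite ![mu ^+ _.+1]exprS [Y ^+ _]exprS; ring.
rewrite lerD2r mulrC.
have P0 : 0 <= 8 ^+ 2 * Y ^+ e * mu ^+ n.
  by rewrite !mulr_ge0 ?exprn_ge0 ?ltW // (lt_le_trans _ mu_ge1).
rewrite -[leRHS]mulrA ler_wpM2l //; apply: le_trans Y_big _.
by rewrite ler_peMr ?exprn_ege1 // mulr_ge0 ?subr_ge0 // ltW.
Qed.

Lemma covered_few (n e : nat) (st : seq dih) : (size st <= 2)%N ->
  covered (few n e st) (few_bound n e st).
Proof.
have mu0 : 0 <= mu by apply: le_trans mu_ge1.
have Y0 : 0 <= Y by apply: le_trans Y_ge1.
have ge1 k j : 1 <= Y ^+ k * mu ^+ j by rewrite mulr_ege1 ?exprn_ege1.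
have [m] := ubnP n; elim: m n e st => // m IHm [|n] e st nm st2.
  apply: (covered_sub (B := eq^~ [::]) _ _ (covered_one [::])) => [s [/size0nil]//|].
  by rewrite /few_bound -mulrA mulr_ege1 // exprn_ege1 // ler1n.
have few_le st' : (size st' <= 2)%N -> few_bound n e st' <= few_bound n.+1 e st'.
  by move=> _; rewrite /few_bound ler_wpM2l ?mulr_ge0 ?exprn_ge0 // ler_weXn2l.
case: (ltnP (size st) 2) => [{}st2|st2'].
  have := covered_fin (I := (bool * bool * bool)%type)
    (A := fun x s => exists y s', [/\ y = x, few n e (rcons st x) s' & s = y :: s']) (r := few_bound n e (rcons st dih_one)).
  rewrite card_dih => /(_ _)/covered_sub; apply.
  - case=> [[]//|x s] [[sn] ps]; exists x, x, s; split=> //; split=> //.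
    by move: ps; case: (st) st2 => [|u [|]].
  - have -> : few_bound n.+1 e st = 8%:R * few_bound n.+1 e (rcons st dih_one).
      rewrite /few_bound size_rcons !mulrA -exprS; congr (_ ^+ _ * _ * _).
      by move: st2; lia.
    by rewrite ler_wpM2l // few_le // size_rcons.
  - move=> x; have := IHm n e (rcons st x).
    rewrite size_rcons => /(_ nm st2) cov.
    have := covered_image2 cons (covered_one x) cov; rewrite mul1r.
    by rewrite /few_bound !size_rcons.
case: st st2 st2' => [|u [|v []]] // _ _.
case: (ltnP n 2) => n2.
  apply: (covered_sub (B := fun s => size s = n.+1) _ _ (covered_size n.+1)) => [s []//|].
  rewrite /few_bound -mulrA -[leLHS]mulr1 ler_pM ?exprn_ge0 // ler_weXn2l //.
  by rewrite ler1n.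
case: n n2 nm few_le => [|[|n]] // _ nm few_le.
have IH1 := IHm n.+2 e [:: v; forced u v] nm erefl.
have := covered_image2 cons (covered_one (forced u v)) IH1; rewrite mul1r => cov1.
case: e few_le IH1 cov1 => [|e] few_le IH1 cov1.
  apply: (covered_sub _ _ cov1); last exact: (few_le [:: v; forced u v]).
  case=> [[]//|x s] [[sn] /=]; case: eqP => [->|_] ps.
    by exists (forced u v), s.
  by case: s sn ps => [|z [|y s]].
have nm' : (n < m)%N by move: nm; lia.
have IH0 := IHm n e [::] nm' erefl.
have D8 := covered_full (bool * bool * bool)%type; rewrite card_dih in D8.
have cov0 := covered_image2 cons D8 (covered_image2 cons D8 (covered_image2 cons D8 IH0)).
apply: (covered_sub _ _ (covered_union cov1 cov0)).
- case=> [[]//|x s] [[sn] /=]; case: eqP => [->|_] ps; first by left; exists (forced u v), s.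
  case: s sn ps => [|z [|y s]] // [sn] ps; right.
  exists x, [:: z, y & s]; split=> //; exists z, (y :: s); split=> //; exists y, s; split=> //.
- rewrite addrC; apply: le_trans (few_bound_step n e).
  rewrite lerD2r /few_bound /= !subn0 [Y ^+ e.+1]exprS.
  have Y1 : 0 < Y by apply: lt_le_trans Y_ge1.
  by rewrite le_eqVlt; apply/orP; left; apply/eqP; field; rewrite gt_eqF.
Qed.
End covering.

Local Open Scope classical_set_scope.

(** * Growth rates *)

Definition tree_map : Type := seq bool -> seq bool.

Definition cost_ball (m : nat) (f : tree_map) : Prop :=
  exists W, f = nact W /\ (cost W <= m)%N.

Definition branch (e : bool) (f0 f1 : tree_map) : tree_map :=
  fun w => if w is c :: w' then (c (+) e) :: (if c then f1 else f0) w' else [::].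

(* Maps whose [2 ^ k] sections at level [k] have total cost at most [m]. *)
Fixpoint spread (k m : nat) (f : tree_map) : Prop :=
  if k is k'.+1 then
    exists e f0 f1 m0 m1,
      [/\ (m0 + m1 <= m)%N, spread k' m0 f0, spread k' m1 f1 & f = branch e f0 f1]
  else cost_ball m f.

Lemma spread_le (k m n : nat) (f : tree_map) : (m <= n)%N -> spread k m f -> spread k n f.
Proof.
case: k => [|k] mn /=.
  by move=> [W [-> Wm]]; exists W; split=> //; apply: leq_trans mn.
move=> [e [f0 [f1 [m0 [m1 [mm s0 s1 ->]]]]]]; exists e, f0, f1, m0, m1; split=> //.
exact: leq_trans mn.
Qed.

Lemma spread_total_cost (k : nat) (W : nword) : spread k (total_cost k W) (nact W).
Proof.
elim: k W => [|k IHk] W /=.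
  exists (red W.1 W.2); split=> //; apply/funext => w.
  by rewrite nact_red -surjective_pairing.
exists (W.1.1.1 (+) parity W.2), (nact (section false W)), (nact (section true W)).
exists (total_cost k (section false W)), (total_cost k (section true W)); split=> //.
apply/funext => -[|c w]; first exact: nact_nil.
by rewrite nact_section; case: c.
Qed.

Definition few_ball (m e : nat) (f : tree_map) : Prop :=
  exists W, [/\ f = nact W, (cost W <= m)%N & (count_gains [::] W.2 <= e)%N].

Lemma ball_split (m e : nat) (f : tree_map) :
  cost_ball m f -> few_ball m e f \/ spread 3 (m - e.+1) f.
Proof.
move=> [W [-> Wm]]; case: (leqP (count_gains [::] W.2) e) => We; [by left; exists W|right].
apply: spread_le (spread_total_cost 3 W).
have := total_cost_gain W; have := @count_gains_le [::] W.2 erefl.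
have := gain_cat 3 W.1 [::] W.2; rewrite -surjective_pairing [[::] ++ _]/=.
by move: We Wm; lia.
Qed.

Lemma size_le_cost (W : nword) : (size W.2 <= cost W)%N.
Proof. by rewrite /cost; lia. Qed.

Section rate.
Variable R : realType.
Local Open Scope ring_scope.

(** Absorbs the polynomial factors of the counts, and shows that powers of [rho] exceed any
    constant. *)
Lemma nat_le_exp (rho : R) : 1 < rho ->
  exists2 C : R, 0 < C & forall m, m.+1%:R <= C * rho ^+ m.
Proof.
move=> rho1; have d0 : 0 < rho - 1 by rewrite subr_gt0.
exists (1 + (rho - 1)^-1) => [|m]; first by rewrite addr_gt0 ?invr_gt0.
elim: m => [|m IHm]; first by rewrite expr0 mulr1 lerDl invr_ge0 ltW.
rewrite -natr1 exprS.
have -> : (1 + (rho - 1)^-1) * (rho * rho ^+ m) =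
  (1 + (rho - 1)^-1) * rho ^+ m + (rho - 1 + (rho - 1) * (rho - 1)^-1) * rho ^+ m by ring.
rewrite lerD // divff ?gt_eqF // subrK.
by rewrite mulr_ege1 ?exprn_ege1 ?ltW.
Qed.

Lemma nat_root (x : R) (n : nat) : 1 < x -> (0 < n)%N ->
  exists2 y : R, 1 < y & y ^+ n = x.
Proof.
move=> x1 n0; have x0 : 0 <= x by rewrite ltW // (lt_trans _ x1).
exists (x `^ (n%:R^-1)).
  rewrite ltNge; apply/negP => y1.
  have : (x `^ (n%:R^-1)) ^+ n <= 1 by rewrite exprn_ile1 ?powR_ge0.
  rewrite -powR_mulrn ?powR_ge0 // -powRrM mulVf ?pnatr_eq0 -?lt0n //.
  by rewrite powRr1 // leNgt x1.
by rewrite -powR_mulrn ?powR_ge0 // -powRrM mulVf ?pnatr_eq0 -?lt0n // powRr1.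
Qed.

Definition rate (A : nat -> tree_map -> Prop) (l : R) : Prop :=
  exists2 C : R, 0 <= C & forall m, covered (A m) (C * l ^+ m).

(** There are [m + 1] ways to share the cost between the two sections and 2 actions on the first
    letter. The linear factor is absorbed by passing from [l] to [l']. *)
Lemma rate_spread (k : nat) (l l' : R) : 1 <= l -> l < l' ->
  rate (spread k) l -> rate (spread k.+1) l'.
Proof.
move=> l1 ll' [C C0 HC]; have l0 : 0 < l by apply: lt_le_trans l1.
have [|D D0 HD] := @nat_le_exp (l' / l); first by rewrite ltr_pdivlMr // mul1r.
exists (2 * D * C ^+ 2) => [|m]; first by rewrite !mulr_ge0 // ltW.
pose A (i : bool * 'I_m.+1) (f : tree_map) :=
  exists f0 f1, [/\ spread k i.2 f0, spread k (m - i.2) f1 & f = branch i.1 f0 f1].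
have HA i : covered (A i) (C ^+ 2 * l ^+ m).
  apply: covered_sub (covered_image2 (branch i.1) (HC i.2) (HC (m - i.2)%N)) => //.
  have -> : C * l ^+ i.2 * (C * l ^+ (m - i.2)) = C ^+ 2 * (l ^+ i.2 * l ^+ (m - i.2)) by ring.
  by rewrite -exprD subnKC // -ltnS.
apply: covered_sub (covered_fin HA).
  move=> f [e [f0 [f1 [m0 [m1 [mm s0 s1 ->]]]]]].
  have m0m : (m0 < m.+1)%N by rewrite ltnS (leq_trans _ mm) // leq_addr.
  exists (e, Ordinal m0m), f0, f1; split=> //=.
  by apply: spread_le s1; move: mm; lia.
rewrite card_prod card_bool card_ord natrM.
have -> : 2 * D * C ^+ 2 * l' ^+ m = 2 * (D * (l' / l) ^+ m) * (C ^+ 2 * l ^+ m).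
  by rewrite expr_div_n; field; rewrite expf_neq0 // gt_eqF.
by rewrite ler_wpM2r ?ler_wpM2l // mulr_ge0 ?exprn_ge0 // ltW.
Qed.

Lemma rate_le (A : nat -> tree_map -> Prop) (l l' : R) :
  0 <= l -> l <= l' -> rate A l -> rate A l'.
Proof.
move=> l0 ll' [C C0 HC]; exists C => // m.
by apply: covered_sub (HC m) => //; rewrite ler_wpM2l // lerXn2r // nnegrE (le_trans l0).
Qed.

Lemma rate_spread3 (l l' : R) : 1 <= l -> l < l' -> rate cost_ball l -> rate (spread 3) l'.
Proof.
move=> l1 ll' H0; pose d := (l' - l) / 3.
have d0 : 0 < d by rewrite divr_gt0 // subr_gt0.
have H1 : rate (spread 1) (l + d) by apply: (@rate_spread 0) H0 => //; rewrite ltrDl.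
have H2 : rate (spread 2) (l + d + d).
  by apply: rate_spread H1; rewrite ?ltrDl // (le_trans l1) // lerDl ltW.
apply: rate_spread H2; first by rewrite -addrA (le_trans l1) // lerDl addr_ge0 ?ltW.
by rewrite /d; lra.
Qed.

Lemma covered_nact (B : seq dih -> Prop) (r : R) : covered B r ->
  covered (fun f => exists W, f = nact W /\ B W.2) (8 * r).
Proof.
move=> HB; have := covered_image2 (fun x s => nact (x, s)) (covered_full R (bool * bool * bool)%type) HB.
rewrite card_dih; apply: covered_sub => // f [[x s] [-> Bs]]; by exists x, s.
Qed.

(** A crude start for the descent: [8 ^ m] bounds the words of each length up to [m], and a factor
    [2 ^ m] the number of lengths. *)
Lemma rate_ball16 : rate cost_ball 16.
Proof.
have [|D D0 HD] := @nat_le_exp 2; first by rewrite ltr1n.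
exists (8 * D) => [|m]; first by rewrite mulr_ge0 // ltW.
have HA (i : 'I_m.+1) : covered (fun s : seq dih => size s = i) (8 ^+ m : R).
  apply: covered_sub (covered_size R i) => //.
  by rewrite ler_weXn2l ?ler1n // -ltnS.
apply: covered_sub (covered_nact (covered_fin HA)).
  move=> f [W [-> Wm]]; exists W; split=> //.
  have h : (size W.2 < m.+1)%N by rewrite ltnS (leq_trans (size_le_cost W)).
  by exists (Ordinal h).
have -> : (16 : R) ^+ m = 2 ^+ m * 8 ^+ m by rewrite -exprMn; congr (_ ^+ _); lra.
by rewrite card_ord -!mulrA ler_wpM2l // mulrA ler_wpM2r ?exprn_ge0.
Qed.

(** The three factors [mu ^ m] bound the [mu ^ n] of [few_bound], the power [Y ^ (m %/ q)] once
    [Y <= mu ^ q], and the number of lengths up to [m]. *)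
Lemma rate_few (mu : R) : 1 < mu ->
  exists2 q : nat, (0 < q)%N & rate (fun m => few_ball m (m %/ q)) (mu ^+ 3).
Proof.
move=> mu1; have mu0 : 0 < mu by apply: lt_trans mu1.
have d0 : 0 < mu - 1 by rewrite subr_gt0.
pose Y : R := 1 + 8 ^+ 5 / (mu - 1).
have Y1 : 1 <= Y by rewrite lerDl divr_ge0 ?exprn_ge0 ?ltW.
have YB : 8 ^+ 5 <= Y * (mu - 1).
  by rewrite mulrDl divfK ?gt_eqF // mul1r lerDr ltW.
have [D D0 HD] := nat_le_exp mu1.
have Y0 : 0 < Y by apply: lt_le_trans Y1.
have [q q0 Yq] : exists2 q : nat, (0 < q)%N & Y <= mu ^+ q.
  have := archi_boundP (mulr_ge0 (ltW Y0) (ltW D0)); set q := Num.bound _ => hq.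
  exists q.+1 => //; rewrite -(ler_pM2l D0) mulrC; apply: le_trans (HD _).
  by rewrite (le_trans (ltW hq)) // ler_nat ltnW.
exists q => //; exists (8 * (D * 8 ^+ 4)) => [|m].
  by rewrite !mulr_ge0 ?exprn_ge0 // ltW.
set e := (m %/ q)%N.
have Ye : Y ^+ e <= mu ^+ m.
  apply: (@le_trans _ _ (mu ^+ q ^+ e)); first by rewrite lerXn2r // nnegrE ltW // exprn_gt0.
  by rewrite -exprM ler_weXn2l ?(ltW mu1) // mulnC leq_trunc_div.
have HA (i : 'I_m.+1) : covered (few i e [::]) (8 ^+ 4 * mu ^+ m * mu ^+ m).
  apply: covered_sub (@covered_few R mu Y (ltW mu1) Y1 YB i e [::] erefl) => //.
  rewrite /few_bound subn0 ler_pM ?mulr_ge0 ?exprn_ge0 ?(ltW mu0) ?(ltW Y0) //.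
    by rewrite ler_wpM2l ?exprn_ge0.
  by rewrite ler_weXn2l ?(ltW mu1) // -ltnS.
apply: covered_sub (covered_nact (covered_fin HA)).
  move=> f [W [-> Wm We]]; exists W; split=> //.
  have h : (size W.2 < m.+1)%N by rewrite ltnS (leq_trans (size_le_cost W)).
  by exists (Ordinal h).
rewrite card_ord.
have -> : 8 * (D * 8 ^+ 4) * (mu ^+ 3) ^+ m =
   8 * ((D * mu ^+ m) * (8 ^+ 4 * mu ^+ m * mu ^+ m)).
  by rewrite -exprM mulnC exprM [(mu ^+ m) ^+ 3]exprS expr2; ring.
by rewrite ler_wpM2l // ler_wpM2r // !mulr_ge0 ?exprn_ge0 // ltW.
Qed.

(** Elements with more than [m %/ q] windows have sections of total cost at most [(1 - 1/q) m].
    Going to level three turns [th ^ (j + 1)] into [th ^ (j + 2)], and [(j + 2) (1 - 1/q) <= j] when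
    [j + 2 >= 2 q]. *)
Lemma rate_improve (q j : nat) (th : R) : (0 < q)%N -> (2 * q <= j.+1)%N -> 1 < th ->
  rate (fun m => few_ball m (m %/ q)) (th ^+ j) ->
  rate cost_ball (th ^+ j.+1) -> rate cost_ball (th ^+ j).
Proof.
move=> q0 qj th1 [A A0 HA] Hj; have th0 : 0 < th by apply: lt_trans th1.
have [C C0 HC] : rate (spread 3) (th ^+ j.+2).
  by apply: rate_spread3 Hj; rewrite ?ltr_eXn2l // exprn_ege1 // ltW.
exists (A + C) => [|m]; first by rewrite addr_ge0.
have := covered_union (HA m) (HC (m - (m %/ q).+1)%N).
apply: covered_sub => [f|]; first exact: ball_split.
rewrite mulrDl lerD2l ler_wpM2l // -!exprM ler_weXn2l ?ltW //.
have := ltn_ceil m q0; move: (m %/ q)%N => e; set m' := (m - e.+1)%N => meq.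
have h1 : (q * m' <= q.-1 * m)%N by rewrite /m'; nia.
rewrite -(leq_pmul2l q0).
by nia.
Qed.

Lemma rate_ball (l : R) : 1 < l -> rate cost_ball l.
Proof.
move=> l1; have [mu mu1 <-] := nat_root l1 (isT : (0 < 3)%N).
have [q q0 Hq] := rate_few mu1.
have mu3 : 1 < mu ^+ 3 by rewrite exprn_egt1.
(* [q] depends on [l] alone, so [th] can be its root of order [2 q], written as a successor to be
   visibly positive. The descent on the exponent then stops exactly at [th ^ (2 q) = l]. *)
have [th th1 thE] := nat_root mu3 (isT : (0 < (2 * q).-1.+1)%N).
have th0 : 0 < th by apply: lt_trans th1.
have few_th j : ((2 * q).-1.+1 <= j)%N -> rate (fun m => few_ball m (m %/ q)) (th ^+ j).
  by move=> jq; apply: rate_le Hq; rewrite -?thE ?exprn_ge0 ?ler_weXn2l ?ltW.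
have [D D0 HD] := nat_le_exp th1.
have [j0 Hj0] : exists j, rate cost_ball (th ^+ (j + (2 * q).-1.+1)).
  have := archi_boundP (mulr_ge0 (ler0n R 16) (ltW D0)); set j := Num.bound _ => hj.
  exists j; apply: rate_le rate_ball16 => //.
  rewrite -(ler_pM2l D0) mulrC (le_trans (ltW hj)) //.
  apply: le_trans (le_trans (HD j) _); first by rewrite ler_nat.
  by rewrite ler_pM2l // ler_weXn2l ?leq_addr // ltW.
rewrite -thE; elim: j0 Hj0 => [//|j IHj] Hj; apply: IHj.
apply: (@rate_improve q (j + (2 * q).-1.+1) th q0 _ th1 (few_th _ _) Hj).
  by move: q0; lia.
exact: leq_addl.
Qed.
End rate.

(** * Word balls of [GA] *)

Lemma state_autE (q : state) (w : seq bool) : state_aut q w = state_act q w.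
Proof. by []. Qed.

Lemma state_aut_inv (q : state) : (state_aut q)^-1%g = state_aut q.
Proof. exact: treeIso_eq. Qed.

Definition gens : seq (treeAut binary_tree) :=
  [:: state_aut st_a; state_aut st_b; state_aut st_t].

Lemma generated_gens : generated [set` gens] = GA.
Proof.
congr generated; apply/seteqP; split => x /=.
  by rewrite !inE => /or3P[] /eqP ->; [left; left|left; right|right].
by rewrite !inE => -[[->|->]|->]; rewrite eqxx ?orbT.
Qed.

Lemma dih_len_le4 (x : dih) : (dih_len x <= 4)%N.
Proof. by case: x => [[[] []] []]. Qed.

Lemma cost_le (W : nword) : (cost W <= 8 * size W.2)%N.
Proof.
suff : (isum dih_len W.2 <= 4 * size W.2)%N by rewrite /cost; lia.
elim: W.2 => [//|x [//|y s] IHs]; rewrite isum_cons2.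
by have := dih_len_le4 x; move: IHs => /=; lia.
Qed.

Lemma word_ball_nact (n : nat) (g : treeAut binary_tree) :
  word_ball gens n g -> cost_ball (8 * n) (iso_fun g).
Proof.
move=> [w [wn wS] <-].
suff [W [Wn gW]] : exists W, (size W.2 <= size w)%N /\
    forall u, (\prod_(s <- w) s)%g u = nact W u.
  exists W; split; first exact/funext.
  by rewrite (leq_trans (cost_le W)) // leq_mul2l (leq_trans Wn).
have {wn} : {subset w <= gens}.
  move=> s /wS; rewrite mem_cat => /orP[//|/mapP[q + ->]].
  by rewrite /gens !inE => /or3P[] /eqP ->; rewrite state_aut_inv eqxx ?orbT.
(* In a product of automorphisms the rightmost factor acts first, in an [nword] the leftmost letter
   does. A generator appended on the right therefore enters the [nword] on the left. *)
elim/last_ind: w {wS} => [|w s IHw] wS.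
  by exists (dih_one, [::]); split=> // u; rewrite big_nil /nact /= dih_act_one.
have [|[x r] [Wn gW]] := IHw; first by move=> q qw; apply: wS; rewrite mem_rcons inE qw orbT.
have gE u : (\prod_(i <- rcons w s) i)%g u = (\prod_(i <- w) i)%g (s u).
  by rewrite -cats1 big_cat /= big_seq1.
have : s \in gens by apply: wS; rewrite mem_rcons mem_head.
rewrite /gens !inE => /or3P[] /eqP sE.
- exists (dih_mul dih_a x, r); split=> [|u]; first by rewrite size_rcons (leq_trans Wn).
  by rewrite gE gW sE state_autE -dih_act_a /nact /= dih_act_mul.
- exists (dih_one, x :: r); split=> [|u]; first by rewrite size_rcons.
  by rewrite gE gW sE state_autE /nact /= dih_act_one.
- exists (dih_mul (dih_flip true) x, r); split=> [|u]; first by rewrite size_rcons (leq_trans Wn).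
  by rewrite gE gW sE state_autE -(dih_act_flip true) /nact /= dih_act_mul.
Qed.

Section subexponential.
Variable R : realType.
Local Open Scope ring_scope.

Lemma card_covered (T : choiceType) (A : set T) (r : R) :
  covered A r -> finite_set A /\ (#|` fset_set A|%:R <= r).
Proof.
move=> [J [g [Jr gA]]].
have sub : A `<=` [set` [fset g j | j in J]%fset].
  by move=> x /gA[j <-] /=; apply/imfsetP; exists j.
have finA : finite_set A by apply: sub_finite_set sub _; exact: finite_fset.
split=> //; apply: le_trans Jr; rewrite ler_nat.
apply: leq_trans (_ : #|` [fset g j | j in J]%fset| <= _)%N.
  apply: fsubset_leq_card; apply/fsubsetP => x.
  by rewrite in_fset_set // inE => /sub.
by rewrite (leq_trans (leq_imfset_card _ _ _)) //= -cardE.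
Qed.

Lemma covered_word_ball (n : nat) (r : R) : covered (cost_ball (8 * n)) r ->
  covered (word_ball gens n) r.
Proof.
move=> [J [g [Jr gA]]]; exists J.
exists (fun j => xget 1%g [set h : treeAut binary_tree | iso_fun h = g j]); split=> // h hn.
have [j gj] := gA _ (word_ball_nact hn); exists j; apply: treeIso_eq => u.
by have -> := @xgetI _ 1%g [set h : treeAut binary_tree | iso_fun h = g j] h (esym gj); rewrite gj.
Qed.

Lemma growth_GA : subexponential_growth R GA.
Proof.
exists gens; split; first exact: generated_gens.
have one_in n : word_ball gens n 1%g.
  by exists [::]; [split|rewrite big_nil].
have card_gt0 n (r : R) : covered (word_ball gens n) r -> (0 < #|` fset_set (word_ball gens n)|)%N.
  move=> /(card_covered)[fin _]; rewrite cardfs_gt0; apply/fset0Pn.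
  by exists 1%g; rewrite in_fset_set // inE.
apply/cvgrPdist_le => e e0.
have e1 : 1 < 1 + e by rewrite ltrDl.
(* Of the nine factors [l ^ n], eight bound the elements of cost at most [8 n] and the ninth absorbs
   the constant [C]. *)
have [l l1 lE] := nat_root e1 (isT : (0 < 9)%N).
have [C C0 HC] := rate_ball l1.
have [D D0 HD] := nat_le_exp l1.
have l0 : 0 < l by apply: lt_trans l1.
have cov n := covered_word_ball (HC (8 * n)%N).
near=> n.
have n0 : (0 < n)%N by near: n; exact: nbhs_infty_gt.
have Cn : C <= l ^+ n.
  rewrite -(ler_pM2l D0); apply: le_trans (HD n).
  have := archi_boundP (mulr_ge0 (ltW D0) C0) => /ltW/le_trans; apply.
  rewrite ler_nat ltnW //; near: n; exact: nbhs_infty_gt.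
have [_ Nle] := card_covered (cov n).
have N1 : 1 <= #|` fset_set (word_ball gens n)|%:R :> R by rewrite ler1n (card_gt0 _ _ (cov n)).
set N := _%:R in Nle N1 *.
have Nle' : N <= (1 + e) ^+ n.
  apply: le_trans Nle _; rewrite -lE -exprM.
  have -> : (9 * n = n + 8 * n)%N by lia.
  by rewrite exprD ler_wpM2r // exprn_ge0 // ltW.
have r1 : 1 <= N `^ n%:R^-1.
  have {1}<- : (1 : R) `^ n%:R^-1 = 1 by rewrite powR1.
  by rewrite ge0_ler_powR ?nnegrE // ?invr_ge0 // (le_trans _ N1).
rewrite distrC ger0_norm ?subr_ge0 // lerBlDl.
have e2 : 0 <= 1 + e by rewrite ltW // (lt_trans _ e1).
apply: (@le_trans _ _ (((1 + e) ^+ n) `^ n%:R^-1)).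
  by rewrite ge0_ler_powR ?nnegrE ?invr_ge0 ?exprn_ge0 // (le_trans _ N1).
by rewrite -powR_mulrn // -powRrM divff ?pnatr_eq0 -?lt0n // powRr1.
Unshelve. all: by end_near.
Qed.
End subexponential.

Local Open Scope classical_set_scope.
Local Open Scope ring_scope.
Local Open Scope complex_scope.

(** * Lifting paths and star-shaped regions through iterates *)

Section complex_continuity.
Variable R : realType.
Local Notation C := (R[i]^o).

Lemma continuous_atP (T : topologicalType) (K : numFieldType) (V : normedModType K)
    (f : T -> V) (x : T) :
  {for x, continuous f} <-> forall e : K, 0 < e -> nbhs x [set t | `|f x - f t| < e].
Proof. by split => [/cvgrPdist_lt|fx]; last exact/cvgrPdist_lt. Qed.

Lemma continuous_at_comp (T U V : topologicalType) (f : T -> U) (g : U -> V) (x : T) :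
  {for x, continuous f} -> {for f x, continuous g} ->
  {for x, continuous (fun y => g (f y))}.
Proof. by move=> cf cg; exact: continuous_comp. Qed.

Lemma nbhs_ballC (z : C) (e : R) : 0 < e -> nbhs z [set t : C | `|z - t| < e%:C].
Proof.
move=> e0; have e0' : 0 < e%:C :> R[i] by rewrite ltcR.
by have := nbhsx_ballx z _ e0'; rewrite -ball_normE.
Qed.

Lemma continuous_Re (z : C) : {for z, continuous (@complex.Re R : C -> R)}.
Proof.
apply/continuous_atP => e /(nbhs_ballC z); apply: filterS => t /= zt.
have := le_lt_trans (normc_ge_Re (z - t)) zt.
by rewrite ltcR; case: (z) (t) => [a b] [a' b'].
Qed.

Lemma normc_ge_Im (z : R[i]) : `|complex.Im z|%:C <= `|z|.
Proof.
by rewrite normc_def lecR -sqrtr_sqr ler_wsqrtr // lerDr sqr_ge0.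
Qed.

Lemma continuous_Im (z : C) : {for z, continuous (@complex.Im R : C -> R)}.
Proof.
apply/continuous_atP => e /(nbhs_ballC z); apply: filterS => t /= zt.
have := le_lt_trans (normc_ge_Im (z - t)) zt.
by rewrite ltcR; case: (z) (t) => [a b] [a' b'].
Qed.

Lemma continuous_at_Re (T : topologicalType) (f : T -> C) (x : T) :
  {for x, continuous f} -> {for x, continuous (fun y => complex.Re (f y))}.
Proof. by move=> cf; apply: (continuous_at_comp cf); exact: continuous_Re. Qed.

Lemma continuous_at_Im (T : topologicalType) (f : T -> C) (x : T) :
  {for x, continuous f} -> {for x, continuous (fun y => complex.Im (f y))}.
Proof. by move=> cf; apply: (continuous_at_comp cf); exact: continuous_Im. Qed.

Lemma continuous_real_complex (x : R) : {for x, continuous (fun x : R => x%:C : C)}.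
Proof.
apply/continuous_atP => e e0.
have [e' e'0 eE] : exists2 e' : R, 0 < e' & e = e'%:C.
  case: e e0 => a b; rewrite ltcE /= => /andP[/eqP -> a0].
  by exists a.
have := nbhsx_ballx x _ e'0; rewrite -ball_normE; apply: filterS => t /= xt.
by rewrite eE -rmorphB /= normc_def /= expr0n addr0 sqrtr_sqr ltcR.
Qed.

Lemma continuous_complex (T : topologicalType) (f : T -> C) (x : T) :
  {for x, continuous (fun y => complex.Re (f y))} ->
  {for x, continuous (fun y => complex.Im (f y))} -> {for x, continuous f}.
Proof.
move=> cR cI.
have -> : f = fun y => (complex.Re (f y))%:C + (0 +i* 1) * (complex.Im (f y))%:C :> C.
  by apply/funext => y; case: (f y) => a b; simpc.
apply: (@continuousD _ _ _ (fun y => (complex.Re (f y))%:C : C) (fun y => (0 +i* 1) * (complex.Im (f y))%:C : C)).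
  exact: (@continuous_at_comp T R C (fun y => complex.Re (f y)) (fun x => x%:C) x cR (@continuous_real_complex _)).
apply: (@continuousM _ _ (fun y => (0 +i* 1) : C) (fun y => (complex.Im (f y))%:C : C)).
  exact: cst_continuous.
exact: (@continuous_at_comp T R C (fun y => complex.Im (f y)) (fun x => x%:C) x cI (@continuous_real_complex _)).
Qed.

Definition principal_sqrt (z : C) : C :=
  let n := Num.sqrt (complex.Re z ^+ 2 + complex.Im z ^+ 2) in
  let u := Num.sqrt ((n + complex.Re z) / 2) in
  u +i* (complex.Im z / (2 * u)).

Lemma principal_sqrt_pos (z : C) : 0 < complex.Re z ->
  0 < (Num.sqrt (complex.Re z ^+ 2 + complex.Im z ^+ 2) + complex.Re z) / 2.
Proof. by move=> z0; rewrite divr_gt0 // ltr_wpDl // sqrtr_ge0. Qed.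

Lemma principal_sqrtK (z : C) : 0 < complex.Re z -> principal_sqrt z ^+ 2 = z.
Proof.
move=> z0; have := principal_sqrt_pos z0; case: z z0 => x y /= x0 u0.
rewrite /principal_sqrt /=; set n := Num.sqrt _ in u0 *.
have nE : n ^+ 2 = x ^+ 2 + y ^+ 2 by rewrite sqr_sqrtr // addr_ge0 ?sqr_ge0.
set u := Num.sqrt _; have uE : u ^+ 2 = (n + x) / 2 by rewrite sqr_sqrtr ?ltW.
have u_gt0 : 0 < u by rewrite sqrtr_gt0.
have uN0 : u != 0 by rewrite gt_eqF.
rewrite expr2; simpc; congr (_ +i* _); last by field.
have nx : n + x != 0 by move: u0; rewrite pmulr_lgt0 ?invr_gt0 // => /gt_eqF ->.
have -> : u * u - y / (2 * u) * (y / (2 * u)) = u ^+ 2 - y ^+ 2 / (4 * u ^+ 2) by field.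
rewrite uE.
have -> : y ^+ 2 = (n - x) * (n + x) by rewrite -subr_sqr nE; ring.
by field.
Qed.

Lemma principal_sqrt1 : principal_sqrt 1 = 1.
Proof.
rewrite /principal_sqrt /= expr1n expr0n addr0 sqrtr1 mul0r.
have -> : (1 + 1) / 2 = 1 :> R by field.
by rewrite sqrtr1.
Qed.

Lemma continuous_principal_sqrt (z : C) : 0 < complex.Re z ->
  {for z, continuous principal_sqrt}.
Proof.
move=> z0; have u0 := principal_sqrt_pos z0.
have cR := @continuous_Re z; have cI := @continuous_Im z.
have cu : {for z, continuous (fun z : C => Num.sqrt ((Num.sqrt
    (complex.Re z ^+ 2 + complex.Im z ^+ 2) + complex.Re z) / 2) : R)}.
  apply: continuous_comp; last exact: sqrt_continuous.
  apply: continuousM; last exact: cst_continuous.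
  apply: continuousD => //; apply: continuous_comp; last exact: sqrt_continuous.
  by apply: continuousD; rewrite /=; apply: continuousM.
apply: continuous_complex => //=.
apply: continuousM => //; apply: continuousV; last first.
  by apply: continuousM => //; exact: cst_continuous.
by rewrite mulf_neq0 // gt_eqF // sqrtr_gt0.
Qed.

Lemma near1_Re_gt0 (z : C) : `|z - 1| < 1 -> 0 < complex.Re z.
Proof.
move=> z1; have := le_lt_trans (normc_ge_Re (z - 1)) z1.
by rewrite ltcR; case: z {z1} => x y /=; rewrite ltr_norml => /andP[+ _]; lra.
Qed.

(* Two square roots of the same path have real inner product [+- |g|^2], which
   cannot change sign. *)
Lemma sqrt_path_unique (g h : R -> C) :
  (forall t : R, 0 <= t <= 1 -> {for t, continuous g}) ->
  (forall t : R, 0 <= t <= 1 -> {for t, continuous h}) ->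
  (forall t : R, 0 <= t <= 1 -> g t ^+ 2 = h t ^+ 2) ->
  (forall t : R, 0 <= t <= 1 -> h t != 0) ->
  g 0 = h 0 -> forall t : R, 0 <= t <= 1 -> g t = h t.
Proof.
move=> cg ch gh h0 gh0 t /andP[t0 t1].
pose q (s : R) := complex.Re (g s) * complex.Re (h s) + complex.Im (g s) * complex.Im (h s).
have cases s : 0 <= s <= 1 -> g s = h s \/ g s = - h s.
  by move=> /gh/eqP; rewrite eqf_sqr => /orP[]/eqP; [left|right].
have norm_gt0 s : 0 <= s <= 1 -> 0 < complex.Re (h s) ^+ 2 + complex.Im (h s) ^+ 2.
  move=> s01; have := h0 s s01; rewrite eq_complex /= negb_and => /orP[]hN;
    rewrite lt_neqAle addr_ge0 ?sqr_ge0 // andbT eq_sym.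
    by rewrite gt_eqF // ltr_wpDr ?sqr_ge0 // exprn_even_gt0.
  by rewrite gt_eqF // ltr_wpDl ?sqr_ge0 // exprn_even_gt0.
have qN0 s : 0 <= s <= 1 -> q s != 0.
  move=> s01; have := norm_gt0 s s01; rewrite /q.
  by case: (cases s s01) => ->; rewrite ?raddfN /= ?mulNr -?opprD ?oppr_eq0 -!expr2 => /gt_eqF ->.
have tI s : s \in `[0, t] -> 0 <= s <= 1.
  by rewrite in_itv /= => /andP[-> /le_trans]; apply.
have cq : {within `[0, t], continuous q}.
  apply: continuous_in_subspaceT => s; rewrite inE /= => /tI s01.
  exact: (continuousD (continuousM (continuous_at_Re (cg s s01)) (continuous_at_Re (ch s s01)))
           (continuousM (continuous_at_Im (cg s s01)) (continuous_at_Im (ch s s01)))).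
have t01 : 0 <= t <= 1 by rewrite t0.
have z01 : ((0 : R) <= (0 : R)) && ((0 : R) <= (1 : R)) by rewrite lexx ler01.
case: (cases t t01) => // gt; exfalso.
have [|s] := IVT t0 cq (v := 0).
  have q0 : 0 < q 0 by have := norm_gt0 0 z01; rewrite /q gh0 -!expr2.
  have qt : q t < 0.
    have := norm_gt0 t t01; rewrite /q gt !raddfN /= !mulNr -opprD oppr_lt0.
    by rewrite -!expr2.
  by rewrite ge_min (ltW qt) orbT le_max (ltW q0).
by move=> /tI s01 qs; have := qN0 s s01; rewrite qs eqxx.
Qed.
End complex_continuity.

Lemma continuous_at_near (T V : topologicalType) (f g : T -> V) (x : T) :
  {for x, continuous f} -> nbhs x [set y | f y = g y] -> {for x, continuous g}.
Proof.
move=> cf fg W; rewrite -(nbhs_singleton fg) => /cf; rewrite /= !nbhs_simpl /= => fW.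
by apply: filterS2 fg fW => y /= ->.
Qed.

(** * Square roots on star-shaped sets *)

Section star_sqrt.
Variable R : realType.
Local Notation C := (R[i]^o).

Definition seg (o z : C) (s : R) : C := o + s%:C * (z - o).

Definition star (o : C) (U : set C) : Prop :=
  forall z, U z -> forall s : R, 0 <= s <= 1 -> U (seg o z s).

Lemma seg0 (o z : C) : seg o z 0 = o.
Proof. by rewrite /seg mul0r addr0. Qed.

Lemma seg1 (o z : C) : seg o z 1 = z.
Proof. by rewrite /seg mul1r addrC subrK. Qed.

Lemma seg_seg (o z : C) (s t : R) : seg o (seg o z s) t = seg o z (t * s).
Proof. by rewrite /seg addrAC subrr add0r rmorphM mulrA. Qed.

Lemma seg_oo (o : C) (s : R) : seg o o s = o.
Proof. by rewrite /seg subrr mulr0 addr0. Qed.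

Lemma continuous_seg (o : C) (T : topologicalType) (f : T -> C) (s : T -> R) (x : T) :
  {for x, continuous f} -> {for x, continuous s} ->
  {for x, continuous (fun y => seg o (f y) (s y))}.
Proof.
move=> cf cs; apply: (@continuousD _ _ _ (fun=> o) (fun y => (s y)%:C * (f y - o) : C)).
  exact: cst_continuous.
apply: (@continuousM _ _ (fun y => (s y)%:C : C) (fun y => f y - o : C)).
  exact: (@continuous_at_comp T R C s (fun x => x%:C) x cs (@continuous_real_complex _ _)).
have cc : {for x, continuous (fun _ : T => o)} by exact: cst_continuous.
exact: (continuousB cf cc).
Qed.

Variables (U : set C) (o : C) (f : C -> C) (y0 : C).
Hypothesis openU : open U.
Hypothesis starU : star o U.
Hypothesis Uo : U o.
Hypothesis contf : forall z, U z -> {for z, continuous f}.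
Hypothesis f_neq0 : forall z, U z -> f z != 0.
Hypothesis y0E : y0 ^+ 2 = f o.

(* [f] turns by less than a right angle along steps of length [1 / n.+1] of the
   segment from [o] to [z]. *)
Let fine (n : nat) (z : C) : Prop := U z /\
  forall s s' : R, 0 <= s <= 1 -> 0 <= s' <= 1 -> `|s - s'| <= n.+1%:R^-1 ->
    `|f (seg o z s') - f (seg o z s)| < `|f (seg o z s)|.

(** By compactness of the unit interval, one number of steps serves all points near [z]. *)
Let near_fine (z : C) : U z -> exists n, nbhs z (fine n).
Proof.
move=> Uz.
pose P (i : C * nat) (s : R) : Prop := 0 <= s <= 1 -> forall s' : R, 0 <= s' <= 1 ->
  `|s - s'| <= i.2.+1%:R^-1 -> `|f (seg o i.1 s') - f (seg o i.1 s)| < `|f (seg o i.1 s)|.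
have cov := (compact_near_coveringP `[0%R : R, 1%R]).1 (@segment_compact R 0 1).
have := cov _ (filter_prod (nbhs z) \oo) P _.
have loc (s0 : R) : `[0%R : R, 1%R]%classic s0 ->
    \forall s \near s0 & i \near filter_prod (nbhs z) \oo, P i s.
  rewrite /= in_itv /= => s01; set w0 := seg o z s0.
  have Uw0 : U w0 by apply: starU.
  have w0N : 0 < `|f w0| by rewrite normr_gt0 f_neq0.
  (* Two values within a third of [|f w0|] from [f w0] differ by less than two thirds of it, while
     their moduli exceed two thirds. *)
  pose W := [set w | `|f w0 - f w| < `|f w0| / 3].
  have nW : nbhs w0 W.
    by have /continuous_atP := contf Uw0; apply; rewrite divr_gt0.
  have W2 w w' : W w -> W w' -> `|f w' - f w| < `|f w|.
    move=> Ww Ww'; have h1 : `|f w' - f w| < `|f w0| / 3 + `|f w0| / 3.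
      by apply: le_lt_trans (ler_distD (f w0) _ _) _; rewrite ltrD // distrC.
    apply: lt_le_trans h1 _.
    have h2 : `|f w0| <= `|f w0| / 3 + `|f w|.
      rewrite -lerBlDr; apply: le_trans (lerB_dist _ _) _; exact: ltW.
    rewrite -(lerD2l (`|f w0| / 3)); apply: le_trans h2.
    by rewrite addrA -{2}[ `|f w0| ](@mulfK _ 3) // le_eqVlt; apply/orP; left; apply/eqP; field.
  have cseg : {for (z, s0), continuous (fun x : C * R => seg o x.1 x.2)}.
    apply: continuous_seg; first exact: cvg_fst.
    exact: cvg_snd.
  have [[A B] /= [nA nB] AB] := cseg _ nW.
  have [r /= r0 rB] : exists2 r : R, 0 < r & ball s0 r `<=` B by apply/nbhs_ballP.
  have [N _ HN] : \forall n \near \oo, n.+1%:R^-1 < r / 2 :> R.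
    have r2 : 0 < r / 2 by rewrite divr_gt0.
    exact: (near_infty_natSinv_lt (PosNum r2)).
  exists (ball s0 (r / 2), A `*` [set n | (N <= n)%N]) => /=.
    split; first by apply: nbhsx_ballx; rewrite divr_gt0.
    by exists (A, [set n | (N <= n)%N]) => //=; split=> //; exists N.
  move=> [s [z' n]] /= [ss0 [Az' Nn]] s01' s' s'01 ss'.
  have Ns : `|s - s'| < r / 2 by apply: le_lt_trans ss' (HN _ Nn).
  have hs : W (seg o z' s).
    apply: (AB (z', s)); split=> //=; apply: rB; apply: le_ball ss0.
    by rewrite [leRHS](splitr r) lerDl divr_ge0 // ltW.
  have hs' : W (seg o z' s').
    apply: (AB (z', s')); split=> //=; apply: rB; rewrite -ball_normE /=.
    rewrite -ball_normE /= in ss0.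
    have -> : s0 - s' = (s0 - s) + (s - s') by rewrite addrA subrK.
    apply: le_lt_trans (ler_normD _ _) _.
    by rewrite [ltRHS](splitr r) ltrD.
  exact: W2.
move=> /(_ _)/(_ loc) [[V N] /= [nV [n0 _ n0N]] VN].
exists n0; apply: filterS (filterI nV (open_nbhs_nbhs (conj openU Uz))) => z' [Vz' Uz'].
split=> // s s' s01 s'01 ss'.
have Nn0 : N n0 by apply: n0N => /=.
have sI : `[0%R : R, 1%R]%classic s by rewrite /= in_itv.
exact: (VN (z', n0) (conj Vz' Nn0) s sI s01 s' s'01 ss').
Qed.

Let ratio (n k : nat) (z : C) : C :=
  f (seg o z (k.+1%:R / n.+1%:R)) / f (seg o z (k%:R / n.+1%:R)).

(** The ratios telescope to [f z / f o]. On [fine n] they lie in the right half-plane, where the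
    principal root is continuous. *)
Let gN (n : nat) (z : C) : C := y0 * \prod_(k < n.+1) principal_sqrt (ratio n k z).

Let frac01 (n k : nat) : (k <= n)%N -> 0 <= (k%:R / n%:R : R) <= 1.
Proof.
case: n => [|n] kn; first by rewrite invr0 mulr0 lexx ler01.
by rewrite divr_ge0 //= ler_pdivrMr // mul1r ler_nat.
Qed.

Let fine_ratio (n : nat) (z : C) (k : nat) : fine n z -> (k <= n)%N ->
  0 < complex.Re (ratio n k z).
Proof.
move=> [Uz Fz] kn; apply: near1_Re_gt0.
have k01 := frac01 (leqW kn); have k1_01 := frac01 (kn : (k.+1 <= n.+1)%N).
have fN := f_neq0 (starU Uz k01).
rewrite /ratio -[X in `|_ - X|](divff fN) -mulrBl normrM normfV ltr_pdivrMr ?normr_gt0 //.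
rewrite mul1r; apply: Fz => //.
by rewrite -mulrBl -natr1 opprD addrA subrr sub0r mulN1r normrN ger0_norm // invr_ge0.
Qed.

Let gN_sq (n : nat) (z : C) : fine n z -> gN n z ^+ 2 = f z.
Proof.
move=> Fz; have [Uz _] := Fz.
have tele m : (m <= n.+1)%N -> (y0 * \prod_(k < m) principal_sqrt (ratio n k z)) ^+ 2 =
    f (seg o z (m%:R / n.+1%:R)).
  elim: m => [|m IHm] mn; first by rewrite big_ord0 mulr1 mul0r seg0.
  rewrite big_ord_recr /= mulrA exprMn IHm ?(ltnW mn) // principal_sqrtK; last exact: fine_ratio.
  rewrite /ratio mulrC divfK //; apply: f_neq0; apply: starU => //.
  by apply: frac01; exact: ltnW.
by rewrite tele // divff ?pnatr_eq0 // seg1.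
Qed.

Let gN_cont (n : nat) (z : C) : fine n z -> {for z, continuous (gN n)}.
Proof.
move=> Fz; have [Uz _] := Fz.
have cy : {for z, continuous (fun _ : C => y0)} by exact: cst_continuous.
have cid : {for z, continuous (fun z : C => z)} by exact: cvg_id.
have cf (t : R) : 0 <= t <= 1 -> {for z, continuous (fun z : C => f (seg o z t))}.
  move=> t01; apply: (@continuous_at_comp _ _ _ (fun z => seg o z t) f); last exact/contf/starU.
  by apply: continuous_seg; [exact: cid|exact: cst_continuous].
have cr k : (k <= n)%N -> {for z, continuous (fun z => principal_sqrt (ratio n k z))}.
  move=> kn; apply: (@continuous_at_comp _ _ _ (ratio n k) (@principal_sqrt R)); last first.
    exact/continuous_principal_sqrt/fine_ratio.
  have c1 := cf _ (frac01 (kn : (k.+1 <= n.+1)%N)); have c0 := cf _ (frac01 (leqW kn)).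
  have fN := f_neq0 (starU Uz (frac01 (leqW kn))).
  exact: (continuousM c1 (continuousV fN c0)).
have cprod m : (m <= n.+1)%N -> {for z, continuous (fun z => \prod_(k < m) principal_sqrt (ratio n k z) : C)}.
  elim: m => [|m IHm] mn.
    have -> : (fun z => \prod_(k < 0) principal_sqrt (ratio n k z) : C) = fun=> 1.
      by apply/funext => x; rewrite big_ord0.
    exact: cst_continuous.
  have -> : (fun z => \prod_(k < m.+1) principal_sqrt (ratio n k z) : C) =
      (fun z => (\prod_(k < m) principal_sqrt (ratio n k z)) * principal_sqrt (ratio n m z)).
    by apply/funext => x; rewrite big_ord_recr.
  exact: (continuousM (IHm (ltnW mn)) (cr m mn)).
exact: (continuousM cy (cprod n.+1 (leqnn _))).
Qed.

Let gN_o (n : nat) : gN n o = y0.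
Proof.
rewrite /gN big1 ?mulr1 // => k _.
by rewrite /ratio !seg_oo divff ?f_neq0 // principal_sqrt1.
Qed.

Let mul01 (s t : R) : 0 <= s <= 1 -> 0 <= t <= 1 -> 0 <= s * t <= 1.
Proof. by move=> /andP[s0 s1] /andP[t0 t1]; rewrite mulr_ge0 //= mulr_ile1. Qed.

Let fine_seg (n : nat) (z : C) (t : R) : 0 <= t <= 1 -> fine n z -> fine n (seg o z t).
Proof.
move=> t01 [Uz Fz]; split; first exact: starU.
move=> s s' s01 s'01 ss'; rewrite !seg_seg; apply: Fz; rewrite ?mul01 //.
have /andP[t0 t1] := t01.
by rewrite -mulrBl normrM (ger0_norm t0) (le_trans _ ss') // ler_piMr.
Qed.

(** Along the segment from [o] to [z] both sides are square roots of the same path, starting at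
    [y0]. *)
Let gN_eq (n m : nat) (z : C) : fine n z -> fine m z -> gN n z = gN m z.
Proof.
move=> Fn Fm; have [Uz _] := Fn.
have c k : fine k z -> forall t : R, 0 <= t <= 1 -> {for t, continuous (fun t => gN k (seg o z t))}.
  move=> Fk t t01; apply: (@continuous_at_comp _ _ _ (fun t => seg o z t) (gN k)).
    by apply: continuous_seg; [exact: cst_continuous|exact: cvg_id].
  exact/gN_cont/fine_seg.
have := @sqrt_path_unique R (fun t => gN n (seg o z t)) (fun t => gN m (seg o z t)) (c _ Fn) (c _ Fm).
rewrite !seg0 !gN_o => /(_ _ _ erefl 1); rewrite !seg1; apply.
- by move=> t t01; rewrite !gN_sq //; exact: fine_seg.
- move=> t t01; apply/eqP => g0; have := f_neq0 (starU Uz t01).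
  by rewrite -(gN_sq (fine_seg t01 Fm)) g0 expr0n eqxx.
- by rewrite ler01 lexx.
Qed.

(** The number of steps is chosen pointwise. Near a point, [gN_eq] replaces these choices by a
    single one, which gives continuity. *)
Theorem star_sqrt : exists g : C -> C,
  [/\ forall z, U z -> {for z, continuous g},
      forall z, U z -> g z ^+ 2 = f z & g o = y0].
Proof.
have N_ (z : C) : {n | U z -> nbhs z (fine n)}.
  apply: cid; have [Uz|nUz] := pselect (U z); last by exists 0%N.
  by have [n nP] := near_fine Uz; exists n.
exists (fun z => gN (projT1 (N_ z)) z).
have F z : U z -> fine (projT1 (N_ z)) z by move=> /(projT2 (N_ z)) /nbhs_singleton.
split; [|by move=> z /F /gN_sq|exact: gN_o].
move=> z Uz; have Fz := projT2 (N_ z) Uz.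
have near_eq : \forall y \near z, gN (projT1 (N_ z)) y = gN (projT1 (N_ y)) y.
  apply: filterS Fz => y Fy; apply: gN_eq => //; apply: F; exact: Fy.1.
exact: continuous_at_near (gN_cont (F z Uz)) near_eq.
Qed.
End star_sqrt.

Lemma continuous_at_pair (T U V : topologicalType) (f : T -> U) (g : T -> V) (x : T) :
  {for x, continuous f} -> {for x, continuous g} ->
  {for x, continuous (fun y => (f y, g y))}.
Proof. by move=> cf cg; exact: cvg_pair. Qed.

(** * Lifting through iterates, and transport along paths *)

Section lifting.
Variable R : realType.
Local Notation C := (R[i]^o).
Variables (c : C) (P : set C).
Hypothesis Pc : P c.
Definition quad (z : C) : C := z ^+ 2 + c.
Hypothesis Pquad : forall z, P z -> P (quad z).

Definition iquad (n : nat) (z : C) : C := iter n quad z.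

Lemma iquadS (n : nat) (z : C) : iquad n.+1 z = quad (iquad n z).
Proof. by []. Qed.

Lemma iquadSr (n : nat) (z : C) : iquad n.+1 z = iquad n (quad z).
Proof. by rewrite /iquad iterSr. Qed.

Lemma P_iquad (n : nat) (z : C) : P z -> P (iquad n z).
Proof. by move=> Pz; elim: n => // n; exact: Pquad. Qed.

Lemma continuous_quad (T : topologicalType) (f : T -> C) (x : T) :
  {for x, continuous f} -> {for x, continuous (fun y => quad (f y))}.
Proof.
move=> cf; have cc : {for x, continuous (fun _ : T => c)} by exact: cst_continuous.
exact: (continuousD (continuousM cf cf) cc).
Qed.

Lemma quad_neq0 (n : nat) (z : C) : ~ P (iquad n.+1 z) -> z != 0.
Proof.
move=> nP; apply/eqP => z0; apply: nP; rewrite iquadSr z0 /quad expr0n add0r.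
exact: P_iquad.
Qed.

Lemma quad_inj (z w : C) : quad z = quad w -> z ^+ 2 = w ^+ 2.
Proof. by move/addIr. Qed.

(** One square root is extracted per level. It never branches: a zero of [g - c] would put [F] in
    [P], as [P] contains [c] and is forward invariant. *)
Lemma star_lift (n : nat) (U : set C) (o y : C) (F : C -> C) :
  open U -> star o U -> U o -> (forall z, U z -> {for z, continuous F}) ->
  (forall z, U z -> ~ P (F z)) -> iquad n y = F o ->
  exists g : C -> C, [/\ forall z, U z -> {for z, continuous g},
    forall z, U z -> iquad n (g z) = F z & g o = y].
Proof.
move=> oU sU Uo; elim: n y F => [|n IHn] y F cF PF yE; first by exists F.
rewrite iquadSr in yE.
have [g [cg gE go]] := IHn _ _ cF PF yE.
have nP z : U z -> ~ P (g z) by move=> Uz Pg; apply: (PF z Uz); rewrite -gE //; exact: P_iquad.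
have cf z : U z -> {for z, continuous (fun z => g z - c)}.
  move=> Uz; have cc : {for z, continuous (fun _ : C => c)} by exact: cst_continuous.
  exact: (continuousB (cg z Uz) cc).
have fN z : U z -> g z - c != 0.
  by move=> /nP nPg; rewrite subr_eq0; apply/eqP => gc; apply: nPg; rewrite gc.
have y2 : y ^+ 2 = g o - c by rewrite go /quad addrK.
have [h [ch hE ho]] := star_sqrt oU sU Uo cf fN y2.
exists h; split=> // z Uz; rewrite iquadSr -gE // /quad hE //.
by rewrite subrK.
Qed.

Lemma unit_path_unique (n : nat) (f g : R -> C) :
  (forall t : R, 0 <= t <= 1 -> {for t, continuous f}) ->
  (forall t : R, 0 <= t <= 1 -> {for t, continuous g}) ->
  (forall t : R, 0 <= t <= 1 -> iquad n (f t) = iquad n (g t)) ->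
  (forall t : R, 0 <= t <= 1 -> ~ P (iquad n (g t))) ->
  f 0 = g 0 -> forall t : R, 0 <= t <= 1 -> f t = g t.
Proof.
elim: n f g => [|n IHn] f g cf cg fg nP fg0; first by move=> t /fg.
have E : forall t : R, 0 <= t <= 1 -> quad (f t) = quad (g t).
  apply: IHn => [t t01|t t01|t t01|t t01|].
  - exact/continuous_quad/cf.
  - exact/continuous_quad/cg.
  - by rewrite -!iquadSr fg.
  - by rewrite -iquadSr; exact: nP.
  - by rewrite fg0.
apply: sqrt_path_unique => // [t t01|t t01]; first exact/quad_inj/E.
exact/(@quad_neq0 n)/nP.
Qed.

Lemma star_unique (n : nat) (U : set C) (o : C) (f g : C -> C) :
  star o U -> (forall z, U z -> {for z, continuous f}) ->
  (forall z, U z -> {for z, continuous g}) ->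
  (forall z, U z -> iquad n (f z) = iquad n (g z)) ->
  (forall z, U z -> ~ P (iquad n (g z))) ->
  f o = g o -> forall z, U z -> f z = g z.
Proof.
move=> sU cf cg fg nP fgo z Uz.
have ch (h : C -> C) : (forall z, U z -> {for z, continuous h}) ->
    forall t : R, 0 <= t <= 1 -> {for t, continuous (fun t => h (seg o z t))}.
  move=> hc t t01; apply: (@continuous_at_comp _ _ _ (fun t => seg o z t) h).
    by apply: continuous_seg; [exact: cst_continuous|exact: cvg_id].
  exact/hc/sU.
have := @unit_path_unique n _ _ (ch _ cf) (ch _ cg).
rewrite !seg0 => /(_ _ _ fgo 1); rewrite !seg1; apply.
- by move=> t t01; apply/fg/sU.
- by move=> t t01; apply/nP/sU.
- by rewrite ler01 lexx.
Qed.

(** The end points are in no particular order, for use on both sides of a given parameter. *)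
Lemma path_unique (n : nat) (f g : R -> C) (a b : R) :
  (forall t, Num.min a b <= t <= Num.max a b -> {for t, continuous f}) ->
  (forall t, Num.min a b <= t <= Num.max a b -> {for t, continuous g}) ->
  (forall t, Num.min a b <= t <= Num.max a b -> iquad n (f t) = iquad n (g t)) ->
  (forall t, Num.min a b <= t <= Num.max a b -> ~ P (iquad n (g t))) ->
  f a = g a -> f b = g b.
Proof.
move=> cf cg fg nP fga; pose r (t : R) := a + t * (b - a).
have rI t : 0 <= t <= 1 -> Num.min a b <= r t <= Num.max a b.
  move=> /andP[t0 t1]; have t1' : 0 <= 1 - t by rewrite subr_ge0.
  rewrite /r; case: (leP a b) => ab.
    have d : 0 <= b - a by rewrite subr_ge0.
    have := mulr_ge0 t0 d; have := mulr_ge0 t1' d.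
    by rewrite mulrBl mul1r => h1 h2; apply/andP; split; lra.
  have d : 0 <= a - b by rewrite subr_ge0 ltW.
  have := mulr_ge0 t0 d; have := mulr_ge0 t1' d.
  by rewrite -(opprB b a) mulrBl mul1r mulrN => h1 h2; apply/andP; split; lra.
have ch (h : R -> C) : (forall t, Num.min a b <= t <= Num.max a b -> {for t, continuous h}) ->
    forall t : R, 0 <= t <= 1 -> {for t, continuous (fun t => h (r t))}.
  move=> hc t t01; apply: (@continuous_at_comp _ _ _ r h); last exact/hc/rI.
  have ca : {for t, continuous (fun _ : R => a)} by exact: cst_continuous.
  have cba : {for t, continuous (fun _ : R => b - a)} by exact: cst_continuous.
  have ci : {for t, continuous (fun t : R => t)} by exact: cvg_id.
  exact: (continuousD ca (continuousM ci cba)).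
have r0 : r 0 = a by rewrite /r mul0r addr0.
have r1 : r 1 = b by rewrite /r mul1r addrC subrK.
have := @unit_path_unique n _ _ (ch _ cf) (ch _ cg).
rewrite !r0 => /(_ _ _ fga 1); rewrite !r1; apply.
- by move=> t /rI; exact: fg.
- by move=> t /rI; exact: nP.
- by rewrite ler01 lexx.
Qed.

(** Paths live on the whole line, which avoids continuity relative to a subspace; [clamp] extends a
    path given on the unit interval. *)
Definition avoiding_path (gamma : R -> C) : Prop :=
  (forall s, {for s, continuous gamma}) /\ forall s, ~ P (gamma s).

Definition transport (n : nat) (gamma : R -> C) (y y' : C) : Prop :=
  exists f : R -> C, [/\ forall s, {for s, continuous f},
    forall s, iquad n (f s) = gamma s, f 0 = y & f 1 = y'].

(** The plane of parameters is read as [C], which is star-shaped about 0, so that [star_lift] also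
    lifts homotopies. *)
Lemma square_lift (n : nat) (H : R * R -> C) (y : C) :
  (forall x, {for x, continuous H}) -> (forall x, ~ P (H x)) -> iquad n y = H (0, 0) ->
  exists L : R * R -> C, [/\ forall x, {for x, continuous L},
    forall x, iquad n (L x) = H x & L (0, 0) = y].
Proof.
move=> cH nP yE.
have sT : star (0 : C) (@setT C) by [].
have cF z : @setT C z -> {for z, continuous (fun z : C => H (complex.Re z, complex.Im z))}.
  move=> _; apply: (@continuous_at_comp C _ _ (fun z => (complex.Re z, complex.Im z)) H); last exact: cH.
  apply: continuous_at_pair; [exact: continuous_Re|exact: continuous_Im].
have [|g [cg gE go]] := @star_lift n (@setT C) 0 y _ openT sT I cF _ yE.
  by move=> z _; exact: nP.
exists (fun x : R * R => g (x.1 +i* x.2)); split; last exact: go.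
  move=> x; apply: (@continuous_at_comp _ C C (fun x : R * R => x.1 +i* x.2) g); last exact: cg.
  apply: continuous_complex; [exact: cvg_fst|exact: cvg_snd].
by case=> a b; exact: (gE (a +i* b) I).
Qed.

Lemma transport_unique (n : nat) (gamma : R -> C) (y y1 y2 : C) :
  avoiding_path gamma -> transport n gamma y y1 -> transport n gamma y y2 -> y1 = y2.
Proof.
move=> [_ nP] [f [cf fE f0 <-]] [g [cg gE g0 <-]].
apply: (@path_unique n f g 0 1) => [t _|t _|t _|t _|]; [exact: cf|exact: cg| | |].
- by rewrite fE gE.
- by rewrite gE.
- by rewrite f0 g0.
Qed.

Lemma transportS (n : nat) (gamma : R -> C) (y y' : C) :
  transport n gamma y y' -> transport n.+1 (fun s => quad (gamma s)) y y'.
Proof.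
move=> [f [cf fE f0 f1]]; exists f; split; [exact: cf| |exact: f0|exact: f1].
by move=> s; rewrite iquadS fE.
Qed.

Lemma transport_field (n : nat) (U : set C) (F : C -> C) (gamma : R -> C) :
  (forall z, U z -> {for z, continuous F}) -> (forall z, U z -> iquad n (F z) = z) ->
  (forall s, {for s, continuous gamma}) -> (forall s, U (gamma s)) ->
  transport n gamma (F (gamma 0)) (F (gamma 1)).
Proof.
move=> cF FE cg Ug; exists (fun s => F (gamma s)); split; [|by move=> s; rewrite FE|by []|by []].
by move=> s; apply: (continuous_at_comp (cg s)); apply: cF.
Qed.

Definition path_rev (gamma : R -> C) (s : R) : C := gamma (1 - s).

Lemma continuous_rev (gamma : R -> C) (s : R) :
  (forall s, {for s, continuous gamma}) -> {for s, continuous (path_rev gamma)}.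
Proof.
move=> cg; apply: (@continuous_at_comp _ _ _ (fun s : R => 1 - s) gamma); last exact: cg.
have c1 : {for s, continuous (fun _ : R => 1 : R)} by exact: cst_continuous.
have ci : {for s, continuous (fun t : R => t)} by exact: cvg_id.
exact: (continuousB c1 ci).
Qed.

Lemma avoiding_rev (gamma : R -> C) : avoiding_path gamma -> avoiding_path (path_rev gamma).
Proof. by move=> [cg nP]; split=> s; [exact: continuous_rev|exact: nP]. Qed.

Lemma transport_rev (n : nat) (gamma : R -> C) (y y' : C) :
  transport n gamma y y' -> transport n (path_rev gamma) y' y.
Proof.
move=> [f [cf fE f0 f1]]; exists (path_rev f); split.
- by move=> s; exact: continuous_rev.
- by move=> s; exact: fE.
- by rewrite /path_rev subr0.
- by rewrite /path_rev subrr.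
Qed.

Definition clamp (s : R) : R := Num.max 0 (Num.min 1 s).

Lemma clamp01 (s : R) : 0 <= clamp s <= 1.
Proof. by rewrite /clamp le_max lexx /= ge_max ler01 /= ge_min lexx. Qed.

Lemma clamp_id (s : R) : 0 <= s <= 1 -> clamp s = s.
Proof. by move=> /andP[s0 s1]; rewrite /clamp (min_idPr s1) (max_idPr s0). Qed.

Lemma clamp_le0 (s : R) : s <= 0 -> clamp s = 0.
Proof.
by move=> s0; rewrite /clamp min_r ?(le_trans s0) // max_l.
Qed.

Lemma clamp_ge1 (s : R) : 1 <= s -> clamp s = 1.
Proof. by move=> s1; rewrite /clamp min_l // max_r. Qed.

Lemma continuous_clamp (T : topologicalType) (f : T -> R) (x : T) :
  {for x, continuous f} -> {for x, continuous (fun y => clamp (f y))}.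
Proof.
move=> cf; have c0 : {for x, continuous (fun _ : T => 0 : R)} by exact: cst_continuous.
have c1 : {for x, continuous (fun _ : T => 1 : R)} by exact: cst_continuous.
exact: (continuous_max c0 (continuous_min c1 cf)).
Qed.

(** A sum instead of a case distinction, so that continuity requires no gluing: on each half one of
    the two terms is constant. *)
Definition path_cat (gamma delta : R -> C) (s : R) : C :=
  gamma (clamp (2 * s)) + (delta (clamp (2 * s - 1)) - delta 0).

Lemma path_catE (gamma delta : R -> C) (s : R) : gamma 1 = delta 0 ->
  path_cat gamma delta s =
  if 2 * s <= 1 then gamma (clamp (2 * s)) else delta (clamp (2 * s - 1)).
Proof.
move=> gd; rewrite /path_cat; case: ifPn => [s1|]; first by rewrite (clamp_le0 _ : clamp (2 * s - 1) = 0) ?subr_le0 // subrr addr0.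
by rewrite -ltNge => /ltW s1; rewrite clamp_ge1 // gd addrC subrK.
Qed.

Lemma continuous_cat (gamma delta : R -> C) (s : R) :
  (forall s, {for s, continuous gamma}) -> (forall s, {for s, continuous delta}) ->
  {for s, continuous (path_cat gamma delta)}.
Proof.
move=> cg cd; have ci : {for s, continuous (fun t : R => t)} by exact: cvg_id.
have c1 : {for s, continuous (fun _ : R => 1 : R)} by exact: cst_continuous.
have c2 : {for s, continuous (fun _ : R => 2 : R)} by exact: cst_continuous.
have cd0 : {for s, continuous (fun _ : R => delta 0)} by exact: cst_continuous.
have cg' := continuous_at_comp (continuous_clamp (continuousM c2 ci)) (cg _).
have cd' := continuous_at_comp (continuous_clamp (continuousB (continuousM c2 ci) c1)) (cd _).
exact: (continuousD cg' (continuousB cd' cd0)).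
Qed.

Lemma path_cat0 (gamma delta : R -> C) : path_cat gamma delta 0 = gamma 0.
Proof.
by rewrite /path_cat mulr0 sub0r !clamp_le0 ?lexx ?oppr_le0 ?ler01 // subrr addr0.
Qed.

Lemma path_cat1 (gamma delta : R -> C) : gamma 1 = delta 0 -> path_cat gamma delta 1 = delta 1.
Proof.
move=> gd; have h1 : clamp (2 * 1) = 1 by apply: clamp_ge1; lra.
have h2 : clamp (2 * 1 - 1) = 1 by apply: clamp_ge1; lra.
by rewrite /path_cat h1 h2 gd addrC subrK.
Qed.

Lemma avoiding_cat (gamma delta : R -> C) : gamma 1 = delta 0 ->
  avoiding_path gamma -> avoiding_path delta -> avoiding_path (path_cat gamma delta).
Proof.
move=> gd [cg nPg] [cd nPd]; split=> s; first exact: continuous_cat.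
by rewrite path_catE //; case: ifP => _; [exact: nPg|exact: nPd].
Qed.

Lemma transport_cat (n : nat) (gamma delta : R -> C) (y y' y'' : C) :
  gamma 1 = delta 0 -> transport n gamma y y' -> transport n delta y' y'' ->
  transport n (path_cat gamma delta) y y''.
Proof.
move=> gd [f [cf fE f0 f1]] [g [cg gE g0 g1]].
have fg : f 1 = g 0 by rewrite f1 g0.
exists (path_cat f g); split=> [s|s||].
- exact: continuous_cat.
- by rewrite !path_catE //; case: ifP => _; [exact: fE|exact: gE].
- by rewrite path_cat0.
- by rewrite path_cat1.
Qed.
End lifting.

(** * The slit plane of the tribonacci polynomial *)

Lemma Re_add (R : realType) (z w : R[i]^o) :
  complex.Re (z + w) = complex.Re z + complex.Re w.
Proof. by case: z w => [a b] [a' b']. Qed.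

Lemma Im_add (R : realType) (z w : R[i]^o) :
  complex.Im (z + w) = complex.Im z + complex.Im w.
Proof. by case: z w => [a b] [a' b']. Qed.

Lemma Re_scale (R : realType) (r : R) (z : R[i]^o) :
  complex.Re (r%:C * z : R[i]^o) = r * complex.Re z.
Proof. by case: z => a b; simpc. Qed.

Lemma Im_scale (R : realType) (r : R) (z : R[i]^o) :
  complex.Im (r%:C * z : R[i]^o) = r * complex.Im z.
Proof. by case: z => a b; simpc. Qed.

(** * Half-planes and convexity *)

Section halfspace.
Variable R : realType.
Local Notation C := (R[i]^o).
Variable o : C.

Definition halfspace (w : C) (e : R) (z : C) : Prop :=
  0 < complex.Re (w * (z - o)) + e.

Lemma halfspace_conv (w : C) (e r0 r1 r2 : R) (z0 z1 z2 : C) :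
  0 <= r0 -> 0 <= r1 -> 0 <= r2 -> r0 + r1 + r2 = 1 ->
  halfspace w e z0 -> halfspace w e z1 -> halfspace w e z2 ->
  halfspace w e (r0%:C * z0 + r1%:C * z1 + r2%:C * z2).
Proof.
move=> p0 p1 p2 r1E; rewrite /halfspace.
have -> : w * (r0%:C * z0 + r1%:C * z1 + r2%:C * z2 - o) =
    r0%:C * (w * (z0 - o)) + r1%:C * (w * (z1 - o)) + r2%:C * (w * (z2 - o)) :> R[i].
  have oE : o = r0%:C * o + r1%:C * o + r2%:C * o by rewrite -!mulrDl -!rmorphD r1E mul1r.
  by rewrite {1}oE; ring.
rewrite !Re_add !Re_scale; move: (complex.Re _) (complex.Re _) (complex.Re _) => d b a ha hb hd.
have -> : r0 * a + r1 * b + r2 * d + e = r0 * (a + e) + r1 * (b + e) + r2 * (d + e).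
  have eE : e = r0 * e + r1 * e + r2 * e by rewrite -!mulrDl r1E mul1r.
  by rewrite {1}eE; ring.
have m0 := mulr_ge0 p0 (ltW ha); have m1 := mulr_ge0 p1 (ltW hb); have m2 := mulr_ge0 p2 (ltW hd).
have [r00|r00] := eqVneq r0 0; last first.
  have : 0 < r0 * (a + e) by rewrite mulr_gt0 // lt_neqAle eq_sym r00.
  lra.
have [r10|r10] := eqVneq r1 0; last first.
  have : 0 < r1 * (b + e) by rewrite mulr_gt0 // lt_neqAle eq_sym r10.
  lra.
have -> : r2 = 1 by lra.
by rewrite mul1r; lra.
Qed.

Lemma halfspace_seg (w : C) (e s : R) (z0 z1 : C) : 0 <= s <= 1 ->
  halfspace w e z0 -> halfspace w e z1 -> halfspace w e (seg z0 z1 s).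
Proof.
move=> /andP[s0 s1] h0 h1.
have -> : seg z0 z1 s = (1 - s)%:C * z0 + s%:C * z1 + 0%:C * z1.
  by rewrite /seg rmorphB rmorph1; ring.
by apply: halfspace_conv => //; rewrite ?subr_ge0 //; ring.
Qed.

(* The image of a segment under [quad] is a quadratic Bezier curve, contained in
   the convex hull of its control points. *)
Lemma halfspace_quad_seg (c w : C) (e s : R) (z0 z1 : C) : 0 <= s <= 1 ->
  halfspace w e (quad c z0) -> halfspace w e (z0 * z1 + c) -> halfspace w e (quad c z1) ->
  halfspace w e (quad c (seg z0 z1 s)).
Proof.
move=> /andP[s0 s1] h0 h1 h2; have s1' : 0 <= 1 - s by rewrite subr_ge0.
have -> : quad c (seg z0 z1 s) = ((1 - s) ^+ 2)%:C * quad c z0 +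
    (2 * s * (1 - s))%:C * (z0 * z1 + c) + (s ^+ 2)%:C * quad c z1.
  by rewrite /quad /seg !(rmorphM, rmorphXn, rmorphB, rmorph1, rmorph_nat); ring.
by apply: halfspace_conv => //; rewrite ?sqr_ge0 ?mulr_ge0 //; ring.
Qed.

Lemma continuous_halfspace (w : C) (z : C) :
  {for z, continuous (fun z : C => complex.Re (w * (z - o)))}.
Proof.
have cw : {for z, continuous (fun _ : C => w)} by exact: cst_continuous.
have co : {for z, continuous (fun _ : C => o)} by exact: cst_continuous.
have ci : {for z, continuous (fun z : C => z)} by exact: cvg_id.
exact: (continuous_at_Re (continuousM cw (continuousB ci co))).
Qed.

Lemma open_halfspace (w : C) (e : R) : open [set z | halfspace w e z].
Proof.
rewrite openE => z hz; rewrite /interior.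
have /continuous_atP/(_ _ hz) := @continuous_halfspace w z.
apply: filterS => t; rewrite /= ltr_norml => /andP[_ ht]; rewrite /halfspace.
by rewrite -subr_gt0 in ht; apply: lt_le_trans ht _; rewrite le_eqVlt; apply/orP; left; apply/eqP; ring.
Qed.
End halfspace.

(** * The parameter [a] and its numerical bounds *)

Section tribonacci.
Variable R : realType.
Local Notation C := (R[i]^o).

(** The root is about -0.4196 + 0.6063 i. All later numerical checks rest on these rational bounds
    for [a] and [a ^+ 2]. *)
Definition tribonacci_conjugate (a : C) : Prop :=
  [/\ a ^+ 3 = a ^+ 2 + a + 1,
    (- (42 / 100) <= complex.Re a) && (complex.Re a <= - (41 / 100)),
    (3 / 5 <= complex.Im a) && (complex.Im a <= 5 / 8),
    (- (1 / 5) <= complex.Re (a ^+ 2)) && (complex.Re (a ^+ 2) <= - (1 / 6))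
  & (- (21 / 40) <= complex.Im (a ^+ 2)) && (complex.Im (a ^+ 2) <= - (1 / 2))].

Lemma tribonacci_conjugate_exists : exists a : C, tribonacci_conjugate a.
Proof.
pose l : R := - (42 / 100); pose r : R := - (42 / 100 - 1 / 10 / 100).
(* For a root [x + i y] with [y] nonzero, the imaginary part of the equation gives
   [y^2 = 3 x^2 - 2 x - 1]. Substituting this in the real part gives [4 x^3 - 4 x^2 + 1 = 0]. *)
pose p : {poly R} := 4 *: 'X^3 - 4 *: 'X^2 + 1.
have pE t : p.[t] = 4 * t ^+ 3 - 4 * t ^+ 2 + 1 by rewrite /p !hornerE.
have h : l <= r by rewrite /l /r; lra.
have hp : p.[l] <= 0 <= p.[r].
  by rewrite !pE /l /r; apply/andP; split; lra.
have [x /andP[x0 x1] /rootP] := poly_ivt h hp; rewrite pE {p pE h hp} => xE.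
have hx0 : 0 <= x - l by rewrite subr_ge0.
have hx1 : 0 <= r - x by rewrite subr_ge0.
rewrite /l /r {l r} in x0 x1 hx0 hx1 *.
have h01 := mulr_ge0 hx0 hx1; have h00 := mulr_ge0 hx0 hx0.
pose y2 := 3 * x ^+ 2 - 2 * x - 1.
have x2a : 175 / 10 / 100 <= x ^+ 2 by lra.
have x2b : x ^+ 2 <= 177 / 10 / 100 by lra.
have y20 : 0 <= y2 by rewrite /y2; lra.
pose y := Num.sqrt y2; have yE : y ^+ 2 = y2 by rewrite sqr_sqrtr.
have y_ge0 : 0 <= y by rewrite sqrtr_ge0.
have y0 : 60 / 100 <= y.
  by rewrite -(ler_pXn2r (n := 2)) ?nnegrE // ?yE /y2; lra.
have y1 : y <= 61 / 100.
  by rewrite -(ler_pXn2r (n := 2)) ?nnegrE // ?yE /y2; lra.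
exists (x +i* y); split.
- rewrite !exprS expr0 mulr1; simpc; congr (_ +i* _).
    have -> : x * (x * x - y * y) - y * (x * y + y * x) =
       x ^+ 3 - 3 * x * y ^+ 2 by ring.
    have -> : x * x - y * y + x + 1 = x ^+ 2 - y ^+ 2 + x + 1 by ring.
    by rewrite yE /y2; apply/eqP; rewrite -subr_eq0; apply/eqP; rewrite -[0](mulr0 (-2)) -xE; ring.
  have -> : x * (x * y + y * x) + y * (x * x - y * y) = y * (3 * x ^+ 2 - y ^+ 2) by ring.
  by rewrite yE /y2; ring.
- by rewrite [complex.Re _]/=; apply/andP; split; lra.
- by rewrite [complex.Im _]/=; apply/andP; split; lra.
- have -> : complex.Re ((x +i* y) ^+ 2) = x ^+ 2 - y ^+ 2 by rewrite !expr2; simpc.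
  by rewrite yE /y2; apply/andP; split; lra.
- have -> : complex.Im ((x +i* y) ^+ 2) = x * y + y * x by rewrite !expr2.
  have hy0 : 0 <= y - 60 / 100 by rewrite subr_ge0.
  have hy1 : 0 <= 61 / 100 - y by rewrite subr_ge0.
  have := mulr_ge0 hx0 hy0; have := mulr_ge0 hx1 hy1.
  have := mulr_ge0 hx0 hy1; have := mulr_ge0 hx1 hy0.
  by move=> *; apply/andP; split; lra.
Qed.

Variable a : C.
Hypothesis Ha : tribonacci_conjugate a.

(* The points [c_t, c_a, c_b] of the post-critical set are [a + spoke q]. *)
Definition spoke (q : state) : C :=
  match q with
  | st_t => - a ^+ 2
  | st_a => - 1
  | st_b => 1 - 2 * a
  | st_id => 0
  end.

(** Inverses in the field Q(a); the denominator arises because [1 - 2 a] has norm -13. *)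
Definition spoke_inv (q : state) : C :=
  match q with
  | st_t => a ^+ 2 - 2 * a
  | st_a => - 1
  | st_b => (5 + 2 * a - 4 * a ^+ 2) / 13
  | st_id => 0
  end.

Definition zeta (A B D : R) : C := A%:C + B%:C * a + D%:C * a ^+ 2.

Lemma a3 : a ^+ 3 = a ^+ 2 + a + 1.
Proof. by have [] := Ha. Qed.

Lemma spoke_invK (q : state) : q <> st_id -> spoke q * spoke_inv q = 1.
Proof.
have K (x y k : C) : x - y = k * (a ^+ 3 - (a ^+ 2 + a + 1)) -> x = y.
  by rewrite a3 subrr mulr0 => /eqP; rewrite subr_eq0 => /eqP.
case: q => //= _.
- by rewrite mulrNN mulr1.
- by apply: (K _ _ (8 / 13)); field.
- by apply: (K _ _ (1 - a)); ring.
Qed.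
End tribonacci.

(* [%Z] would otherwise denote [int_scope]. *)
Delimit Scope Z_scope with Z.

(** * Integer tests for the polygons *)

Definition zpoint : Type := (Z * Z * Z)%type.

(** Interval arithmetic for [p + q Re a + r Im a + s Re a^2 + t Im a^2]: the bounds of
    [tribonacci_conjugate] are multiplied by 600, their common denominator. *)
Definition affine_pos (p q r s t : Z) : bool :=
  Z.ltb 0 (600 * p + Z.min (q * (-252)) (q * (-246)) + Z.min (r * 360) (r * 375)
    + Z.min (s * (-120)) (s * (-100)) + Z.min (t * (-315)) (t * (-300))).

(** The coordinates in 1, [a], [a^2] of [chart q z], multiplied by [zscale q] to make them
    integral. *)
Definition zchart (q : state) (z : zpoint) : zpoint :=
  let: (A, B, D) := z in
  match q with
  | st_t => (B - D - 1, B - 1 - 2 * A, A - B + 1)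
  | st_a => (- A, 1 - B, - D)
  | _ => (5 * A - 4 * (B - 1) - 2 * D, 2 * A + (B - 1) - 6 * D,
          (-4) * A - 2 * (B - 1) - D)
  end%Z.

Definition zscale (q : state) : Z := if q is st_b then 13 else 1.

Definition zoff_cut (q : state) (k : Z) (z : zpoint) : bool :=
  let: (A, B, D) := zchart q z in
  affine_pos (zscale q - A) (- B) (k * B) (- D) (k * D).

Definition zbeyond (q : state) (z : zpoint) : bool :=
  let: (A, B, D) := zchart q z in affine_pos (A - zscale q) B 0 D 0.

Definition zleft_of (q : state) (z : zpoint) : bool :=
  let: (_, B, D) := zchart q z in affine_pos 0 0 B 0 D.

Definition zright_of (q : state) (z : zpoint) : bool :=
  let: (_, B, D) := zchart q z in affine_pos 0 0 (- B) 0 (- D).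

Definition zoff_cuts (k : zpoint) (z : zpoint) : bool :=
  let: (kt, ka, kb) := k in
  [&& zoff_cut st_t kt z, zoff_cut st_a ka z & zoff_cut st_b kb z].

(* [v * w + c] for [v] and [w] in [Z + Z a] *)
Definition zmul (v w : Z * Z) : zpoint :=
  (v.1 * w.1, v.1 * w.2 + v.2 * w.1 + 1, v.2 * w.2 - 1)%Z.

(** * Charts of the cuts *)

Section slit_plane.
Variable R : realType.
Local Notation C := (R[i]^o).
Variable a : C.
Hypothesis Ha : tribonacci_conjugate a.
Local Notation spoke := (spoke a).
Local Notation spoke_inv := (spoke_inv a).
Local Notation zeta := (zeta a).

(* In the coordinate [chart q] the cut from [a + spoke q] to infinity is the
   half-line [1, +oo[. *)
Definition chart (q : state) (z : C) : C := spoke_inv q * (z - a).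

Definition tribonacci_quad : C := a - a ^+ 2.
Local Notation c := tribonacci_quad.

Definition post_points : set C := [set z | exists2 q, q <> st_id & z = a + spoke q].

(* A half-plane whose boundary line separates [a] from the cut [q]. *)
Definition off_cut (q : state) (k : R) (z : C) : Prop :=
  halfspace a (spoke_inv q * ((-1) +i* (- k))) 1 z.

(** The complement of a cut is written as a union of half-planes, so that a segment is checked at
    its end points by naming one slope [k] for each cut. The condition is void for [st_id]. *)
Definition slit : set C := [set z | forall q, exists k, off_cut q k z].

Definition beyond (q : state) : set C := [set z | halfspace a (spoke_inv q) (-1) z].

Definition left_of (q : state) : set C := [set z | halfspace a (spoke_inv q * (0 +i* (-1))) 0 z].

Definition right_of (q : state) : set C := [set z | halfspace a (spoke_inv q * (0 +i* 1)) 0 z].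

Lemma off_cutE (q : state) (k : R) (z : C) :
  off_cut q k z <-> complex.Re (chart q z) < 1 + k * complex.Im (chart q z).
Proof.
rewrite /off_cut /halfspace /chart mulrAC; case: (spoke_inv q * (z - a)) => x y.
rewrite -(subr_gt0 x).
suff -> : complex.Re ((x +i* y) * ((-1) +i* (- k)) : R[i]) + 1 = 1 + k * y - x by [].
by rewrite /=; ring.
Qed.

Lemma beyondE (q : state) (z : C) : beyond q z <-> 1 < complex.Re (chart q z).
Proof. by rewrite /beyond /= /halfspace -/(chart q z) subr_gt0. Qed.

Lemma left_ofE (q : state) (z : C) : left_of q z <-> 0 < complex.Im (chart q z).
Proof.
rewrite /left_of /= /halfspace /chart mulrAC; case: (spoke_inv q * (z - a)) => x y.
suff -> : complex.Re ((x +i* y) * (0 +i* (-1)) : R[i]) + 0 = y by [].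
by rewrite /=; ring.
Qed.

Lemma right_ofE (q : state) (z : C) : right_of q z <-> complex.Im (chart q z) < 0.
Proof.
rewrite /right_of /= /halfspace /chart mulrAC; case: (spoke_inv q * (z - a)) => x y.
rewrite -(oppr_gt0 y).
suff -> : complex.Re ((x +i* y) * (0 +i* 1) : R[i]) + 0 = - y by [].
by rewrite /=; ring.
Qed.

Lemma off_cut_id (k : R) (z : C) : off_cut st_id k z.
Proof. by rewrite /off_cut /halfspace !mul0r add0r ltr01. Qed.

Lemma off_cut_ex (q : state) (z : C) :
  complex.Im (chart q z) != 0 \/ complex.Re (chart q z) < 1 -> exists k, off_cut q k z.
Proof.
move=> [y0|x1]; last by exists 0; rewrite off_cutE mul0r addr0.
exists (complex.Re (chart q z) / complex.Im (chart q z)); rewrite off_cutE divfK //.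
by rewrite ltrDr.
Qed.

Lemma on_cut (q : state) (z : C) : ~ (exists k, off_cut q k z) ->
  complex.Im (chart q z) = 0 /\ 1 <= complex.Re (chart q z).
Proof.
move=> nk; split.
  by apply/eqP; apply: contra_notT nk => ?; apply: off_cut_ex; left.
by rewrite leNgt; apply/negP => ?; apply: nk; apply: off_cut_ex; right.
Qed.

Lemma chart_spoke (q : state) (s : C) : q <> st_id -> chart q (a + s * spoke q) = s.
Proof.
move=> qN; rewrite /chart addrAC subrr add0r mulrCA -[spoke_inv q * _]mulrC spoke_invK //.
by rewrite mulr1.
Qed.

Lemma chart_inj (q : state) (z : C) : q <> st_id -> z = a + chart q z * spoke q.
Proof.
move=> qN; rewrite /chart mulrAC -[spoke_inv q * _]mulrC spoke_invK // mul1r.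
by rewrite addrC subrK.
Qed.

Lemma Re_zeta (A B D : R) :
  complex.Re (zeta A B D) = A + B * complex.Re a + D * complex.Re (a ^+ 2).
Proof. by rewrite /zeta !Re_add !Re_scale. Qed.

Lemma Im_zeta (A B D : R) :
  complex.Im (zeta A B D) = B * complex.Im a + D * complex.Im (a ^+ 2).
Proof. by rewrite /zeta !Im_add !Im_scale /= add0r. Qed.

Lemma reduce_a3 (k x y : C) : x - y = k * (a ^+ 3 - (a ^+ 2 + a + 1)) -> x = y.
Proof. by rewrite (a3 Ha) subrr mulr0 => /eqP; rewrite subr_eq0 => /eqP. Qed.

Lemma chart_t (A B D : R) :
  chart st_t (zeta A B D) = zeta (B - D - 1) (B - 1 - 2 * A) (A - B + 1).
Proof.
apply: (@reduce_a3 (B%:C - 1 - 2 * D%:C + D%:C * (a + 1))).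
by rewrite /chart /zeta !(rmorphB, rmorphD, rmorphM, rmorph1, rmorph_nat) /=; ring.
Qed.

Lemma chart_a (A B D : R) : chart st_a (zeta A B D) = zeta (- A) (1 - B) (- D).
Proof. by rewrite /chart /zeta !(rmorphB, rmorphN, rmorph1) /=; ring. Qed.

Lemma chart_b (A B D : R) :
  chart st_b (zeta A B D) = zeta ((5 * A - 4 * (B - 1) - 2 * D) / 13)
    ((2 * A + (B - 1) - 6 * D) / 13) ((- 4 * A - 2 * (B - 1) - D) / 13).
Proof.
apply: (@reduce_a3 ((- 4 * (B%:C - 1) + 2 * D%:C - 4 * D%:C * (a + 1)) / 13)).
have i13 : (13^-1 : R)%:C = 13^-1 :> C by rewrite fmorphV rmorph_nat.
rewrite /chart /zeta !(rmorphM (real_complex R), rmorphB, rmorphD, rmorphN, rmorph1, rmorph_nat) /= ?i13.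
by field.
Qed.

Lemma zeta_mul (m n m' n' : R) :
  zeta m n 0 * zeta m' n' 0 + c = zeta (m * m') (m * n' + n * m' + 1) (n * n' - 1).
Proof. by rewrite /zeta /c !(rmorphB, rmorphD, rmorphM, rmorph1, rmorph0) /=; ring. Qed.

Lemma zetaZ (r A B D : R) : r%:C * zeta A B D = zeta (r * A) (r * B) (r * D).
Proof. by rewrite /zeta !rmorphM /=; ring. Qed.

Lemma re_a : - (42 / 100) <= complex.Re a /\ complex.Re a <= - (41 / 100).
Proof. by have [_ /andP] := Ha. Qed.

Lemma im_a : 3 / 5 <= complex.Im a /\ complex.Im a <= 5 / 8.
Proof. by have [_ _ /andP] := Ha. Qed.

Lemma re_a2 : - (1 / 5) <= complex.Re (a ^+ 2) /\ complex.Re (a ^+ 2) <= - (1 / 6).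
Proof. by have [_ _ _ /andP] := Ha. Qed.

Lemma im_a2 : - (21 / 40) <= complex.Im (a ^+ 2) /\ complex.Im (a ^+ 2) <= - (1 / 2).
Proof. by have [_ _ _ _ /andP] := Ha. Qed.

Lemma spoke_zeta (q : state) : q <> st_id -> a + spoke q =
  match q with st_t => zeta 0 1 (-1) | st_a => zeta (-1) 1 0 | _ => zeta 1 (-1) 0 end.
Proof.
by case: q => // _; rewrite /zeta /= !(rmorphN, rmorph1, rmorph0) /=; ring.
Qed.

Ltac bounds_a :=
  move: re_a im_a re_a2 im_a2;
  move: (complex.Re a) (complex.Im a) (complex.Re (a ^+ 2)) (complex.Im (a ^+ 2));
  move=> x y x2 y2 [? ?] [? ?] [? ?] [? ?].

Lemma spokes_obtuse (q q' : state) : q <> st_id -> q' <> st_id -> q <> q' ->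
  complex.Re (chart q (a + spoke q')) < 0.
Proof.
move=> qN q'N qq'; rewrite spoke_zeta //.
by case: q q' qN q'N qq' => [] [] // _ _ _;
  rewrite ?chart_t ?chart_a ?chart_b Re_zeta; bounds_a; lra.
Qed.

Definition seg_in (U : set C) (z z' : C) : Prop :=
  forall s : R, 0 <= s <= 1 -> U (seg z z' s).

Definition qseg_in (U : set C) (z z' : C) : Prop :=
  forall s : R, 0 <= s <= 1 -> U (quad c (seg z z' s)).

Lemma seg_slit (kt ka kb : R) (z z' : C) :
  off_cut st_t kt z -> off_cut st_t kt z' -> off_cut st_a ka z -> off_cut st_a ka z' ->
  off_cut st_b kb z -> off_cut st_b kb z' -> seg_in slit z z'.
Proof.
move=> t t' h h' b b' s s01 [].
- by exists ka; exact: halfspace_seg.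
- by exists kb; exact: halfspace_seg.
- by exists kt; exact: halfspace_seg.
- by exists 0; exact: off_cut_id.
Qed.

Lemma qseg_slit (kt ka kb : R) (z z' : C) :
  off_cut st_t kt (quad c z) -> off_cut st_t kt (z * z' + c) -> off_cut st_t kt (quad c z') ->
  off_cut st_a ka (quad c z) -> off_cut st_a ka (z * z' + c) -> off_cut st_a ka (quad c z') ->
  off_cut st_b kb (quad c z) -> off_cut st_b kb (z * z' + c) -> off_cut st_b kb (quad c z') ->
  qseg_in slit z z'.
Proof.
move=> t t' t'' h h' h'' b b' b'' s s01 [].
- by exists ka; exact: halfspace_quad_seg.
- by exists kb; exact: halfspace_quad_seg.
- by exists kt; exact: halfspace_quad_seg.
- by exists 0; exact: off_cut_id.
Qed.

Lemma seg_beyond (q : state) (z z' : C) :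
  beyond q z -> beyond q z' -> seg_in (beyond q) z z'.
Proof. by move=> h h' s s01; exact: halfspace_seg. Qed.

Lemma qseg_beyond (q : state) (z z' : C) :
  beyond q (quad c z) -> beyond q (z * z' + c) -> beyond q (quad c z') ->
  qseg_in (beyond q) z z'.
Proof. by move=> h h' h'' s s01; exact: halfspace_quad_seg. Qed.

Definition base (x : bool) : C := if x then a else - a.

Definition crosses (q : state) (z z' : C) : Prop :=
  if q is st_id then seg_in slit z z'
  else [/\ seg_in (beyond q) z z', right_of q z & left_of q z'].

(* A lift under [quad] of a loop around the cut [q], starting at [base x]. *)
Definition polygon_claim (q : state) (x : bool) : Prop :=
  exists z z' : C,
    [/\ seg_in slit (base x) z, crosses (transition q x) z z'
      & seg_in slit z' (base (output q x))] /\
    [/\ qseg_in slit (base x) z, qseg_in (beyond q) z z',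
        right_of q (quad c z), left_of q (quad c z')
      & qseg_in slit z' (base (output q x))].

(** * Soundness of the integer tests, and the polygons *)

Definition zr (z : Z) : R := (int_of_Z z)%:~R.

Lemma zrD (m n : Z) : zr (m + n)%Z = zr m + zr n.
Proof. by rewrite /zr -intrD -rmorphD. Qed.

Lemma zrN (m : Z) : zr (- m)%Z = - zr m.
Proof. by rewrite /zr -mulrNz -rmorphN. Qed.

Lemma zrB (m n : Z) : zr (m - n)%Z = zr m - zr n.
Proof. by rewrite -zrN -zrD. Qed.

Lemma zrM (m n : Z) : zr (m * n)%Z = zr m * zr n.
Proof. by rewrite /zr -intrM -rmorphM. Qed.

Lemma zr_pos (p : positive) : zr (Z.pos p) = (Pos.to_nat p)%:R.
Proof. by []. Qed.

Lemma zr_gt0 (m : Z) : Z.ltb 0 m -> 0 < zr m.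
Proof. by case: m => // p _; rewrite zr_pos ltr0n; apply/ssrnat.ltP; exact: Pos2Nat.is_pos. Qed.

Lemma zr_min_le (m n : Z) : zr (Z.min m n) <= zr m /\ zr (Z.min m n) <= zr n.
Proof.
have le0 (k l : Z) : Z.le k l -> zr k <= zr l.
  move=> kl; rewrite -subr_ge0 -zrB; have : Z.le 0 (l - k) by apply/Z.le_0_sub.
  by case: (l - k)%Z => // p _; rewrite zr_pos.
by split; apply: le0; [exact: Z.le_min_l|exact: Z.le_min_r].
Qed.

Lemma zr_min_mul (q l u : Z) (x : R) : zr l <= x -> x <= zr u ->
  zr (Z.min (q * l) (q * u)) <= zr q * x.
Proof.
move=> lx xu; have [] := zr_min_le (q * l) (q * u); rewrite !zrM => h1 h2.
case: (leP 0 (zr q)) => q0; first by apply: le_trans h1 _; rewrite ler_wpM2l.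
by apply: le_trans h2 _; rewrite ler_wnM2l // ltW.
Qed.

Lemma affine_posP (p q r s t : Z) : affine_pos p q r s t ->
  0 < zr p + zr q * complex.Re a + zr r * complex.Im a
    + zr s * complex.Re (a ^+ 2) + zr t * complex.Im (a ^+ 2).
Proof.
move/zr_gt0; rewrite !zrD zrM; bounds_a.
have e600 : zr 600 = 600 by [].
have e1 : zr (-252) = - 252 by []. have e2 : zr (-246) = - 246 by [].
have e3 : zr 360 = 360 by []. have e4 : zr 375 = 375 by [].
have e5 : zr (-120) = - 120 by []. have e6 : zr (-100) = - 100 by [].
have e7 : zr (-315) = - 315 by []. have e8 : zr (-300) = - 300 by [].
have h1 : zr (Z.min (q * (-252)) (q * (-246))) <= zr q * (600 * x).
  by apply: zr_min_mul; rewrite ?e1 ?e2; lra.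
have h2 : zr (Z.min (r * 360) (r * 375)) <= zr r * (600 * y).
  by apply: zr_min_mul; rewrite ?e3 ?e4; lra.
have h3 : zr (Z.min (s * (-120)) (s * (-100))) <= zr s * (600 * x2).
  by apply: zr_min_mul; rewrite ?e5 ?e6; lra.
have h4 : zr (Z.min (t * (-315)) (t * (-300))) <= zr t * (600 * y2).
  by apply: zr_min_mul; rewrite ?e7 ?e8; lra.
move=> pos; have := lt_le_trans pos (lerD (lerD (lerD (lerD (lexx _) h1) h2) h3) h4).
have p600 : 0 < 600 :> R by rewrite ltr0n.
by rewrite e600 !(mulrCA _ 600) -!mulrDr (pmulr_rgt0 _ p600).
Qed.

Definition zpt (z : zpoint) : C := zeta (zr z.1.1) (zr z.1.2) (zr z.2).

Lemma chart_zpt (q : state) (z : zpoint) : q <> st_id ->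
  zpt (zchart q z) = (zr (zscale q))%:C * chart q (zpt z).
Proof.
case: z => [[A B] D] qN; have e1 : zr 1 = 1 by []. have e13 : zr 13 = 13 by [].
have e5 : zr 5 = 5 by []. have e4 : zr 4 = 4 by []. have e2 : zr 2 = 2 by [].
have e6 : zr 6 = 6 by []. have em4 : zr (-4) = - 4 by [].
case: q qN => // _; rewrite [zscale _]/= ?e1 ?e13 ?mul1r.
- rewrite -[LHS]/(zeta (zr (- A)%Z) (zr (1 - B)%Z) (zr (- D)%Z)) !(zrN, zrB) e1.
  by rewrite -chart_a.
- rewrite -[LHS]/(zeta (zr (5 * A - 4 * (B - 1) - 2 * D)%Z)
    (zr (2 * A + (B - 1) - 6 * D)%Z) (zr (-4 * A - 2 * (B - 1) - D)%Z)).
  rewrite !(zrB, zrD, zrM) e5 e4 e2 e6 em4 e1.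
  rewrite -[zpt _]/(zeta (zr A) (zr B) (zr D)) chart_b zetaZ.
  by congr (zeta _ _ _); field.
- rewrite -[LHS]/(zeta (zr (B - D - 1)%Z) (zr (B - 1 - 2 * A)%Z) (zr (A - B + 1)%Z)).
  by rewrite !(zrB, zrD, zrM) e1 e2 -chart_t.
Qed.

Lemma zscale_gt0 (q : state) : 0 < zr (zscale q).
Proof. by case: q. Qed.

Lemma Re_zchart (q : state) (z : zpoint) : q <> st_id ->
  zr (zchart q z).1.1 + zr (zchart q z).1.2 * complex.Re a + zr (zchart q z).2 * complex.Re (a ^+ 2)
  = zr (zscale q) * complex.Re (chart q (zpt z)).
Proof. by move=> qN; rewrite -Re_zeta -Re_scale -chart_zpt. Qed.

Lemma Im_zchart (q : state) (z : zpoint) : q <> st_id ->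
  zr (zchart q z).1.2 * complex.Im a + zr (zchart q z).2 * complex.Im (a ^+ 2)
  = zr (zscale q) * complex.Im (chart q (zpt z)).
Proof. by move=> qN; rewrite -(Im_zeta (zr (zchart q z).1.1)) -Im_scale -chart_zpt. Qed.

Lemma zoff_cutP (q : state) (k : Z) (z : zpoint) : q <> st_id ->
  zoff_cut q k z -> off_cut q (zr k) (zpt z).
Proof.
move=> qN; have := Re_zchart z qN; have := Im_zchart z qN; rewrite /zoff_cut off_cutE.
case: (zchart q z) => [[A B] D] /= eI eR /affine_posP.
rewrite zrB !zrM !zrN.
have -> : zr (zscale q) - zr A + - zr B * complex.Re a + zr k * zr B * complex.Im a +
   - zr D * complex.Re (a ^+ 2) + zr k * zr D * complex.Im (a ^+ 2) =
   zr (zscale q) - (zr A + zr B * complex.Re a + zr D * complex.Re (a ^+ 2)) +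
   zr k * (zr B * complex.Im a + zr D * complex.Im (a ^+ 2)) by ring.
rewrite eR eI => h; rewrite -subr_gt0 -(pmulr_rgt0 _ (zscale_gt0 q)); apply: lt_le_trans h _.
by rewrite le_eqVlt; apply/orP; left; apply/eqP; ring.
Qed.

Lemma zbeyondP (q : state) (z : zpoint) : q <> st_id -> zbeyond q z -> beyond q (zpt z).
Proof.
move=> qN; have := Re_zchart z qN; rewrite /zbeyond beyondE.
case: (zchart q z) => [[A B] D] /= eR /affine_posP.
have z0 : zr 0 = 0 by []. rewrite zrB z0 !mul0r !addr0 => h.
rewrite -subr_gt0 -(pmulr_rgt0 _ (zscale_gt0 q)) mulrBr -eR mulr1; apply: lt_le_trans h _.
by rewrite le_eqVlt; apply/orP; left; apply/eqP; ring.
Qed.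

Lemma zleft_ofP (q : state) (z : zpoint) : q <> st_id -> zleft_of q z -> left_of q (zpt z).
Proof.
move=> qN; have := Im_zchart z qN; rewrite /zleft_of left_ofE.
case: (zchart q z) => [[A B] D] /= eI /affine_posP.
have z0 : zr 0 = 0 by []. rewrite z0 !mul0r !addr0 !add0r eI.
by rewrite pmulr_rgt0 // zscale_gt0.
Qed.

Lemma zright_ofP (q : state) (z : zpoint) : q <> st_id -> zright_of q z -> right_of q (zpt z).
Proof.
move=> qN; have := Im_zchart z qN; rewrite /zright_of right_ofE.
case: (zchart q z) => [[A B] D] /= eI /affine_posP.
have z0 : zr 0 = 0 by []. rewrite z0 !zrN !mul0r !addr0 !add0r !mulNr -opprD eI oppr_gt0.
by rewrite pmulr_rlt0 // zscale_gt0.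
Qed.

Definition zvertex (v : Z * Z) : C := zpt (v.1, v.2, 0%Z).

Lemma zvertex_mul (v w : Z * Z) : zvertex v * zvertex w + c = zpt (zmul v w).
Proof.
by rewrite /zvertex /zpt /zmul /= zeta_mul ?(zrD, zrB, zrM).
Qed.

Lemma zvertex_quad (v : Z * Z) : quad c (zvertex v) = zpt (zmul v v).
Proof. by rewrite /quad expr2 zvertex_mul. Qed.

Definition zlift (v : Z * Z) : zpoint := (v.1, v.2, 0%Z).

Lemma seg_slitZ (k : zpoint) (v w : Z * Z) :
  zoff_cuts k (zlift v) && zoff_cuts k (zlift w) -> seg_in slit (zvertex v) (zvertex w).
Proof.
case: k => [[kt ka] kb] /andP[/and3P[? ? ?] /and3P[? ? ?]].
by apply: (@seg_slit (zr kt) (zr ka) (zr kb)); apply: zoff_cutP.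
Qed.

Lemma qseg_slitZ (k : zpoint) (v w : Z * Z) :
  [&& zoff_cuts k (zmul v v), zoff_cuts k (zmul v w) & zoff_cuts k (zmul w w)] ->
  qseg_in slit (zvertex v) (zvertex w).
Proof.
case: k => [[kt ka] kb] /and3P[/and3P[? ? ?] /and3P[? ? ?] /and3P[? ? ?]].
by apply: (@qseg_slit (zr kt) (zr ka) (zr kb)); rewrite ?zvertex_quad ?zvertex_mul; apply: zoff_cutP.
Qed.

Lemma crossesZ (q : state) (v w : Z * Z) : q <> st_id ->
  [&& zbeyond q (zlift v), zbeyond q (zlift w), zright_of q (zlift v) & zleft_of q (zlift w)] ->
  crosses q (zvertex v) (zvertex w).
Proof.
move=> qN /and4P[/(zbeyondP qN) bv /(zbeyondP qN) bw /(zright_ofP qN) rv /(zleft_ofP qN) lw].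
by case: q qN bv bw rv lw => // _ bv bw rv lw; split=> //; exact: seg_beyond.
Qed.

Lemma qcrossesZ (q : state) (v w : Z * Z) : q <> st_id ->
  [&& zbeyond q (zmul v v), zbeyond q (zmul v w), zbeyond q (zmul w w),
      zright_of q (zmul v v) & zleft_of q (zmul w w)] ->
  [/\ qseg_in (beyond q) (zvertex v) (zvertex w), right_of q (quad c (zvertex v))
    & left_of q (quad c (zvertex w))].
Proof.
move=> qN /and5P[/(zbeyondP qN) b1 /(zbeyondP qN) b2 /(zbeyondP qN) b3].
move=> /(zright_ofP qN) rv /(zleft_ofP qN) lw; rewrite !zvertex_quad; split=> //.
by apply: qseg_beyond; rewrite ?zvertex_quad ?zvertex_mul.
Qed.

Lemma base_zvertex (x : bool) : base x = zvertex (0, if x then 1 else -1)%Z.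
Proof.
rewrite /zvertex /zpt /=.
have -> : zr 0 = 0 by []. have -> : zr (if x then 1 else -1)%Z = if x then 1 else -1 by case: x.
by case: x; rewrite /zeta /base !(rmorphN, rmorph1, rmorph0) /=; ring.
Qed.

(** As [quad] is even, the polygons for the two values of [x] have opposite vertices and the same
    image. Each triple lists the slopes of lines that separate the segment, or its image, from the
    cuts of [st_t], [st_a], [st_b] in this order. *)
Lemma polygon (q : state) (x : bool) : q <> st_id -> polygon_claim q x.
Proof.
case: q x => [] [] // _; rewrite /polygon_claim !base_zvertex /=.
- exists (zvertex ((1), (2))%Z), (zvertex ((0), (3))%Z); split; [split|].
  + by apply: (@seg_slitZ ((-2), (0), (0))%Z); vm_compute.
  + by apply: (@crossesZ st_t); [|vm_compute].
  + by apply: (@seg_slitZ ((1), (-1), (0))%Z); vm_compute.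
  + have [//||? ? ?] := @qcrossesZ st_a ((1), (2))%Z ((0), (3))%Z; first by vm_compute.
    split=> //; first by apply: (@qseg_slitZ ((1), (-1), (0))%Z); vm_compute.
    by apply: (@qseg_slitZ ((0), (1), (0))%Z); vm_compute.
- exists (zvertex ((-1), (-2))%Z), (zvertex ((0), (-3))%Z); split; [split|].
  + by apply: (@seg_slitZ ((0), (1), (0))%Z); vm_compute.
  + by apply: (@seg_slitZ ((0), (4), (-4))%Z); vm_compute.
  + by apply: (@seg_slitZ ((0), (0), (-3))%Z); vm_compute.
  + have [//||? ? ?] := @qcrossesZ st_a ((-1), (-2))%Z ((0), (-3))%Z; first by vm_compute.
    split=> //; first by apply: (@qseg_slitZ ((1), (-1), (0))%Z); vm_compute.
    by apply: (@qseg_slitZ ((0), (1), (0))%Z); vm_compute.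
- exists (zvertex ((-1), (3))%Z), (zvertex ((-4), (-2))%Z); split; [split|].
  + by apply: (@seg_slitZ ((1), (-2), (0))%Z); vm_compute.
  + by apply: (@crossesZ st_a); [|vm_compute].
  + by apply: (@seg_slitZ ((0), (2), (0))%Z); vm_compute.
  + have [//||? ? ?] := @qcrossesZ st_b ((-1), (3))%Z ((-4), (-2))%Z; first by vm_compute.
    split=> //; first by apply: (@qseg_slitZ ((0), (0), (-1))%Z); vm_compute.
    by apply: (@qseg_slitZ ((-3), (0), (4))%Z); vm_compute.
- exists (zvertex ((1), (-3))%Z), (zvertex ((4), (2))%Z); split; [split|].
  + by apply: (@seg_slitZ ((0), (0), (-4))%Z); vm_compute.
  + by apply: (@crossesZ st_b); [|vm_compute].
  + by apply: (@seg_slitZ ((-2), (0), (1))%Z); vm_compute.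
  + have [//||? ? ?] := @qcrossesZ st_b ((1), (-3))%Z ((4), (2))%Z; first by vm_compute.
    split=> //; first by apply: (@qseg_slitZ ((0), (0), (-1))%Z); vm_compute.
    by apply: (@qseg_slitZ ((-3), (0), (4))%Z); vm_compute.
- exists (zvertex ((-2), (-1))%Z), (zvertex ((-3), (-3))%Z); split; [split|].
  + by apply: (@seg_slitZ ((0), (1), (0))%Z); vm_compute.
  + by apply: (@seg_slitZ ((0), (4), (-1))%Z); vm_compute.
  + by apply: (@seg_slitZ ((0), (2), (0))%Z); vm_compute.
  + have [//||? ? ?] := @qcrossesZ st_t ((-2), (-1))%Z ((-3), (-3))%Z; first by vm_compute.
    split=> //; first by apply: (@qseg_slitZ ((-3), (0), (0))%Z); vm_compute.
    by apply: (@qseg_slitZ ((3), (-2), (0))%Z); vm_compute.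
- exists (zvertex ((2), (1))%Z), (zvertex ((3), (3))%Z); split; [split|].
  + by apply: (@seg_slitZ ((-3), (0), (0))%Z); vm_compute.
  + by apply: (@seg_slitZ ((-4), (0), (4))%Z); vm_compute.
  + by apply: (@seg_slitZ ((-2), (0), (1))%Z); vm_compute.
  + have [//||? ? ?] := @qcrossesZ st_t ((2), (1))%Z ((3), (3))%Z; first by vm_compute.
    split=> //; first by apply: (@qseg_slitZ ((-3), (0), (0))%Z); vm_compute.
    by apply: (@qseg_slitZ ((3), (-2), (0))%Z); vm_compute.
Qed.
End slit_plane.

(** * Monodromy *)

Section frames.
Variable R : realType.
Local Notation C := (R[i]^o).
Variable a : C.
Hypothesis Ha : tribonacci_conjugate a.
Local Notation c := (tribonacci_quad a).
Local Notation P := (post_points a).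
Local Notation spoke := (spoke a).
Local Notation chart := (chart a).
Local Notation slit := (slit a).
Local Notation beyond := (beyond a).
Local Notation left_of := (left_of a).
Local Notation right_of := (right_of a).
Local Notation base := (base a).

Lemma quad_spoke (q : state) : q <> st_id ->
  quad c (a + spoke q) = a + spoke (match q with st_t => st_a | _ => st_b end).
Proof.
case: q => // _; rewrite /quad /tribonacci_quad /spoke; [ring|ring|].
by apply: (reduce_a3 Ha (k := a - 1)); ring.
Qed.

Lemma post_c : P c.
Proof. by exists st_t. Qed.

Lemma post_quad (z : C) : P z -> P (quad c z).
Proof.
move=> [q qN ->]; rewrite quad_spoke //.
by case: q qN => // _; [exists st_b|exists st_b|exists st_a].
Qed.

Lemma quad_base (x : bool) : quad c (base x) = a.
Proof. by case: x; rewrite /quad /tribonacci_quad /base; ring. Qed.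

Lemma a_neq0 : a != 0.
Proof.
apply/eqP => a0; have := a3 Ha; rewrite a0 !expr0n /= addr0 add0r => /eqP.
by rewrite eq_sym oner_eq0.
Qed.

Lemma base_inj : injective base.
Proof.
have h : a <> - a.
  move/eqP; rewrite -subr_eq0 opprK -mulr2n mulrn_eq0 /=.
  by rewrite (negbTE a_neq0).
by case=> [] [] // e; case: (h (esym e)).
Qed.

Lemma slit_not_post (z : C) : slit z -> ~ P z.
Proof.
move=> Sz [q qN zE]; have [k /off_cutE] := Sz q.
have -> : chart q z = 1 by rewrite zE -[spoke q]mul1r (chart_spoke Ha 1 qN).
by rewrite /= mulr0 addr0 ltxx.
Qed.

Lemma beyond_not_post (q : state) (z : C) : q <> st_id -> beyond q z -> ~ P z.
Proof.
move=> qN /beyondE bz [q' q'N zE]; have [qq'|qq'] := pselect (q = q').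
  have e1 : chart q z = 1 by rewrite zE -qq' -[spoke q]mul1r (chart_spoke Ha 1 qN).
  by move: bz; rewrite e1 ltxx.
have := spokes_obtuse Ha qN q'N qq'; rewrite -zE => /(lt_trans bz).
by rewrite ltNge ler01.
Qed.

Lemma chart_on_cut (q q' : state) (z : C) : q <> st_id -> q' <> st_id -> q <> q' ->
  complex.Im (chart q' z) = 0 -> 1 <= complex.Re (chart q' z) ->
  complex.Re (chart q z) < 0.
Proof.
move=> qN q'N qq' y0 x1; rewrite (chart_inj Ha z q'N).
have -> : chart q' z = (complex.Re (chart q' z))%:C.
  by case: (chart q' z) y0 => x y /= ->.
move: (complex.Re _) x1 => s s1.
have -> : chart q (a + s%:C * spoke q') = s%:C * chart q (a + spoke q').
  by rewrite /chart ![a + _ - a]addrAC !subrr !add0r mulrCA.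
rewrite Re_scale pmulr_rlt0 ?(lt_le_trans ltr01) //.
exact: spokes_obtuse.
Qed.

Lemma not_on_cut (q : state) (z : C) : (exists k, off_cut a q k z) \/
  [/\ q <> st_id, complex.Im (chart q z) = 0 & 1 <= complex.Re (chart q z)].
Proof.
have [|nk] := pselect (exists k, off_cut a q k z); [by left|right].
have [y0 x1] := on_cut nk; split=> // qE; apply: nk; exists 0.
by rewrite qE; exact: off_cut_id.
Qed.

Lemma slit_or_beyond (z : C) : ~ P z -> slit z \/ exists2 q, q <> st_id & beyond q z.
Proof.
move=> nP; have [Sz|nS] := pselect (slit z); [by left|right].
have [q nq] : exists q, ~ exists k, off_cut a q k z by apply/existsNP.
have [//|[qN y0 x1]] := not_on_cut q z; exists q => //; apply/beyondE.
rewrite lt_neqAle x1 andbT; apply/eqP => xE; apply: nP; exists q => //.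
rewrite (chart_inj Ha z qN) -[spoke q in RHS]mul1r; congr (_ + _ * _).
by case: (chart q z) y0 xE => x y /= -> <-.
Qed.

Lemma beyond_slit (q : state) (z : C) : q <> st_id -> beyond q z ->
  complex.Im (chart q z) != 0 -> slit z.
Proof.
move=> qN /beyondE bz y0 q'; have [//|[q'N y'0 x'1]] := not_on_cut q' z.
have [qq'|qq'] := pselect (q = q'); first by move: y0; rewrite qq' y'0 eqxx.
have := chart_on_cut qN q'N qq' y'0 x'1; move/(lt_trans bz).
by rewrite ltNge ler01.
Qed.

Lemma slit_beyond_Im (q : state) (z : C) : slit z -> beyond q z ->
  complex.Im (chart q z) != 0.
Proof.
move=> Sz /beyondE bz; apply/eqP => y0; have [k /off_cutE] := Sz q.
by rewrite y0 mulr0 addr0 => /(lt_trans bz); rewrite ltxx.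
Qed.

(** A half-plane beyond one post-critical point misses the other two cuts. Labellings on two such
    half-planes can therefore be compared through the slit plane. *)
Lemma beyond_beyond_slit (q q' : state) (z : C) : q <> st_id -> q' <> st_id ->
  q <> q' -> beyond q z -> beyond q' z -> slit z.
Proof.
move=> qN q'N qq' bz bz' p; have [//|[pN y0 x1]] := not_on_cut p z.
have far r : r <> st_id -> r <> p -> beyond r z -> False.
  move=> rN rp /beyondE br; have := chart_on_cut rN pN rp y0 x1.
  by move/(lt_trans br); rewrite ltNge ler01.
have [qp|qp] := pselect (q = p); last by have := far q qN qp bz.
by have := far q' q'N _ bz'; rewrite -qp => /(_ (nesym qq')).
Qed.

Lemma open_slit : open slit.
Proof.
pose V q : set C := \bigcup_k [set z | off_cut a q k z].
have oV q : open (V q) by apply: bigcup_open => k _; exact: open_halfspace.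
have -> : slit = (V st_a `&` V st_b) `&` (V st_t `&` V st_id).
  apply/seteqP; split=> [z Sz|z [[[k _ h] [k' _ h']] [[l _ g] [l' _ g']]]].
    by split; split; [have [k] := Sz st_a|have [k] := Sz st_b|have [k] := Sz st_t
      |have [k] := Sz st_id]; exists k.
  by case; [exists k|exists k'|exists l|exists l'].
exact: openI (openI (oV _) (oV _)) (openI (oV _) (oV _)).
Qed.

Lemma open_beyond (q : state) : open (beyond q).
Proof. exact: open_halfspace. Qed.

Lemma star_slit : star a slit.
Proof.
move=> z Sz s s01 q; have [k kz] := Sz q; exists k; apply: halfspace_seg => //.
by rewrite /halfspace subrr mulr0 add0r ltr01.
Qed.

Lemma star_beyond (q : state) (o : C) : beyond q o -> star o (beyond q).
Proof. by move=> bo z bz s s01; exact: halfspace_seg. Qed.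

Lemma star_beyond_right (q : state) (o : C) : beyond q o -> right_of q o ->
  star o (beyond q `&` right_of q).
Proof. by move=> bo ro z [bz rz] s s01; split; exact: halfspace_seg. Qed.

Lemma star_beyond_left (q : state) (o : C) : beyond q o -> left_of q o ->
  star o (beyond q `&` left_of q).
Proof. by move=> bo lo z [bz lz] s s01; split; exact: halfspace_seg. Qed.

Lemma right_slit (q : state) (z : C) : q <> st_id -> beyond q z -> right_of q z -> slit z.
Proof. by move=> qN bz /right_ofE rz; apply: (beyond_slit qN bz); rewrite lt_eqF. Qed.

Lemma left_slit (q : state) (z : C) : q <> st_id -> beyond q z -> left_of q z -> slit z.
Proof. by move=> qN bz /left_ofE rz; apply: (beyond_slit qN bz); rewrite gt_eqF. Qed.

Lemma slit_a : slit a.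
Proof. by move=> q; exists 0; rewrite /off_cut /halfspace subrr mulr0 add0r ltr01. Qed.

Lemma slit_base (x : bool) : slit (base x).
Proof.
have tN : st_t <> st_id by [].
have [z [z' [[h _ _] _]]] := polygon Ha x tN.
by have := h 0; rewrite seg0; apply; rewrite lexx ler01.
Qed.

Lemma right_point (q : state) : q <> st_id -> exists2 h, beyond q h & right_of q h.
Proof.
move=> qN; have [z [z' [_ [_ h r _ _]]]] := polygon Ha true qN.
by exists (quad c z) => //; have := h 0; rewrite seg0; apply; rewrite lexx ler01.
Qed.

Lemma left_point (q : state) : q <> st_id -> exists2 h, beyond q h & left_of q h.
Proof.
move=> qN; have [z [z' [_ [_ h _ l _]]]] := polygon Ha true qN.
by exists (quad c z') => //; have := h 1; rewrite seg1; apply; rewrite lexx ler01.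
Qed.

(** * Branches of the inverse iterates *)

Definition branch_on (U : set C) (n : nat) (g : C -> C) : Prop :=
  (forall z, U z -> {for z, continuous g}) /\ (forall z, U z -> iquad c n (g z) = z).

Lemma branch_unique (U : set C) (n : nat) (o : C) (f g : C -> C) :
  star o U -> (forall z, U z -> ~ P z) -> branch_on U n f -> branch_on U n g ->
  f o = g o -> forall z, U z -> f z = g z.
Proof.
move=> sU nP [cf fE] [cg gE] fgo.
apply: (@star_unique _ c P post_c post_quad n U o f g sU cf cg _ _ fgo) => z Uz.
  by rewrite fE ?gE.
by rewrite gE //; exact: nP.
Qed.

Lemma branch_exists (U : set C) (n : nat) (o y : C) :
  open U -> star o U -> U o -> (forall z, U z -> ~ P z) -> iquad c n y = o ->
  exists g, branch_on U n g /\ g o = y.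
Proof.
move=> oU sU Uo nP yE.
have cid z : U z -> {for z, continuous (fun z : C => z)} by move=> _; exact: cvg_id.
have [g [cg gE go]] := star_lift post_c post_quad oU sU Uo cid nP yE.
by exists g; split.
Qed.

Lemma branch_sub (U V : set C) (n : nat) (g : C -> C) : V `<=` U ->
  branch_on U n g -> branch_on V n g.
Proof. by move=> VU [cg gE]; split=> z /VU; [exact: cg|exact: gE]. Qed.

Lemma branch_quad (U : set C) (n : nat) (g : C -> C) :
  branch_on U n.+1 g -> branch_on U n (fun z => quad c (g z)).
Proof.
move=> [cg gE]; split=> z Uz; first by apply: continuous_quad; exact: cg.
by rewrite -iquadSr gE.
Qed.

Definition slit_branch (n : nat) (y : C) : C -> C :=
  xget (fun=> 0) [set g : C -> C | branch_on slit n g /\ g a = y].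

Lemma slit_branchP (n : nat) (y : C) : iquad c n y = a ->
  branch_on slit n (slit_branch n y) /\ slit_branch n y a = y.
Proof.
move=> yE; have [g gP] := branch_exists open_slit star_slit slit_a slit_not_post yE.
exact: (@xgetI _ (fun=> 0) [set g : C -> C | branch_on slit n g /\ g a = y] g gP).
Qed.

(* [phi w] is the branch over the slit plane of the vertex labelled [w]; the
   labelling is self-similar at the fixed point [a], whose preimages are
   [base true = a] and [base false = - a]. *)
Fixpoint phi (w : seq bool) : C -> C :=
  if w is x :: w' then slit_branch (size w) (phi w' (base x)) else id.

Lemma phiP (w : seq bool) : branch_on slit (size w) (phi w).
Proof.
elim: w => [|x w IHw]; first by split=> // z _; exact: cvg_id.
apply: (slit_branchP _).1; rewrite iquadS IHw.2 ?quad_base //; exact: slit_base.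
Qed.

Lemma phi_cons (x : bool) (w : seq bool) : phi (x :: w) a = phi w (base x).
Proof.
apply: (slit_branchP _).2; rewrite iquadS (phiP w).2 ?quad_base //; exact: slit_base.
Qed.

(** Uniqueness of branches spreads the equality from [a] to the slit plane. At [a], the
    self-similarity [phi_cons] removes the first letter and leads to a shorter word at [base y], a
    point of the slit plane. *)
Lemma phi_quad (w : seq bool) (x : bool) (z : C) : slit z ->
  quad c (phi (rcons w x) z) = phi w z.
Proof.
have at_a v : (forall y, quad c (phi (rcons v y) a) = phi v a) ->
    forall y z, slit z -> quad c (phi (rcons v y) z) = phi v z.
  move=> va y; apply: (branch_unique star_slit slit_not_post _ (phiP v) (va y)).
  by apply: branch_quad; rewrite -(size_rcons v y); exact: phiP.
suff H v : forall y, quad c (phi (rcons v y) a) = phi v a by apply: at_a.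
elim: v => [|y v IHv] y'.
  by rewrite [rcons _ _]/= phi_cons quad_base.
by rewrite rcons_cons !phi_cons; apply: at_a => //; exact: slit_base.
Qed.

Definition right_base (q : state) : C :=
  xget a [set h | beyond q h /\ right_of q h].

Lemma right_baseP (q : state) : q <> st_id ->
  beyond q (right_base q) /\ right_of q (right_base q).
Proof.
move=> /right_point[h bh rh].
exact: (@xgetI _ a [set h | beyond q h /\ right_of q h] h (conj bh rh)).
Qed.

(** The continuation of [phi w] across the cut [q], from its right side. *)
Definition psi (q : state) (w : seq bool) : C -> C :=
  xget (fun=> 0) [set g : C -> C | branch_on (beyond q) (size w) g /\
                    g (right_base q) = phi w (right_base q)].

Lemma psiP0 (q : state) (w : seq bool) : q <> st_id ->
  branch_on (beyond q) (size w) (psi q w) /\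
  psi q w (right_base q) = phi w (right_base q).
Proof.
move=> qN; have [bh rh] := right_baseP qN.
have hE : iquad c (size w) (phi w (right_base q)) = right_base q.
  by apply: (phiP w).2; exact: right_slit rh.
have nP z : beyond q z -> ~ P z by exact: beyond_not_post.
have [g gP] := branch_exists (open_beyond (q := q)) (star_beyond bh) bh nP hE.
exact: (@xgetI _ (fun=> 0) [set g : C -> C | branch_on (beyond q) (size w) g /\
                    g (right_base q) = phi w (right_base q)] g gP).
Qed.

Lemma psiP (q : state) (w : seq bool) : q <> st_id ->
  branch_on (beyond q) (size w) (psi q w).
Proof. by move=> /(psiP0 w)[]. Qed.

Lemma psi_right (q : state) (w : seq bool) (z : C) : q <> st_id ->
  beyond q z -> right_of q z -> psi q w z = phi w z.
Proof.
move=> qN bz rz; have [bh rh] := right_baseP qN.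
have := @branch_unique (beyond q `&` right_of q) (size w) (right_base q) (psi q w) (phi w).
apply=> //.
- exact: star_beyond_right.
- by move=> t [bt _]; exact: beyond_not_post bt.
- by apply: branch_sub (psiP w qN) => t [].
- by apply: branch_sub (phiP w) => t [bt rt]; exact: right_slit rt.
- by have [_ ->] := psiP0 w qN.
Qed.

Definition seg_path (z z' : C) (s : R) : C := seg z z' (clamp s).

Lemma continuous_seg_path (z z' : C) (s : R) : {for s, continuous (seg_path z z')}.
Proof.
apply: continuous_seg; first exact: cst_continuous.
by apply: continuous_clamp; exact: cvg_id.
Qed.

Lemma clamp0 : clamp (0 : R) = 0.
Proof. by apply: clamp_le0; rewrite lexx. Qed.

Lemma clamp1 : clamp (1 : R) = 1.
Proof. by apply: clamp_ge1; rewrite lexx. Qed.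

Lemma seg_path0 (z z' : C) : seg_path z z' 0 = z.
Proof. by rewrite /seg_path clamp0 seg0. Qed.

Lemma seg_path1 (z z' : C) : seg_path z z' 1 = z'.
Proof. by rewrite /seg_path clamp1 seg1. Qed.

Lemma seg_path_in (U : set C) (z z' : C) (s : R) : seg_in U z z' -> U (seg_path z z' s).
Proof. by apply; exact: clamp01. Qed.

Lemma transport_seg (U : set C) (n : nat) (g : C -> C) (z z' : C) :
  branch_on U n g -> seg_in U z z' -> transport c n (seg_path z z') (g z) (g z').
Proof.
move=> [cg gE] Uz; rewrite -{2}(seg_path0 z z') -{3}(seg_path1 z z').
apply: (transport_field cg gE) => s; first exact: continuous_seg_path.
exact: seg_path_in.
Qed.

Lemma transport_qseg (U : set C) (n : nat) (g : C -> C) (z z' : C) :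
  branch_on U n g -> qseg_in a U z z' ->
  transport c n (fun s => quad c (seg_path z z' s)) (g (quad c z)) (g (quad c z')).
Proof.
move=> [cg gE] Uz; rewrite -{2}(seg_path0 z z') -{3}(seg_path1 z z').
apply: (transport_field (gamma := fun s => quad c (seg_path z z' s)) cg gE) => s.
  by apply: continuous_quad; exact: continuous_seg_path.
by apply: Uz; exact: clamp01.
Qed.

Lemma avoiding_seg (U : set C) (z z' : C) : (forall t, U t -> ~ P t) -> seg_in U z z' ->
  avoiding_path P (seg_path z z').
Proof.
by move=> UP Uz; split=> s; [exact: continuous_seg_path|apply: UP; exact: seg_path_in].
Qed.

Lemma avoiding_qseg (U : set C) (z z' : C) : (forall t, U t -> ~ P t) -> qseg_in a U z z' ->
  avoiding_path P (fun s => quad c (seg_path z z' s)).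
Proof.
move=> UP Uz; split=> s; first by apply: continuous_quad; exact: continuous_seg_path.
by apply: UP; apply: Uz; exact: clamp01.
Qed.

Lemma transport_inj (n : nat) (gamma : R -> C) (y1 y2 y : C) :
  avoiding_path P gamma -> transport c n gamma y1 y -> transport c n gamma y2 y -> y1 = y2.
Proof.
move=> Hg /transport_rev h1 /transport_rev h2.
exact: (transport_unique post_c post_quad (avoiding_rev Hg) h1 h2).
Qed.

Lemma size_state_act (q : state) (w : seq bool) : size (state_act q w) = size w.
Proof. by elim: w q => //= x w IHw q; rewrite IHw. Qed.

Lemma psi_left (q : state) (w : seq bool) (z : C) : q <> st_id ->
  beyond q z -> left_of q z -> psi q w z = phi (state_act q w) z.
Proof.
elim: w q z => [|x w IHw] q z qN bz lz.
  by have [_ E] := psiP [::] qN; have := E z bz.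
have nPb t : beyond q t -> ~ P t by exact: beyond_not_post.
(* The polygon through [base x], [z1], [z2] and [base (output q x)] covers a loop
   around the cut [q] and crosses the cut [transition q x]; comparing transports
   along the loop at level [n.+1] and along the polygon at level [n] reduces the
   claim to the induction hypothesis. *)
have [z1 [z2 [[s1 s2 s3] [q1 q2 r1 l2 q3]]]] := polygon Ha x qN.
set n := size w; set q' := transition q x in s2.
have b1 : beyond q (quad c z1) by have := q2 0; rewrite seg0; apply; rewrite lexx ler01.
have b2 : beyond q (quad c z2) by have := q2 1; rewrite seg1; apply; rewrite lexx ler01.
have T1 : transport c n (seg_path (base x) z1) (phi w (base x)) (phi w z1).
  exact: transport_seg (phiP w) s1.
have T2 : transport c n (seg_path z1 z2) (phi w z1) (phi (state_act q' w) z2).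
  have [q'E|q'N] := pselect (q' = st_id).
    move: s2; rewrite q'E state_act_id /= => s2.
    exact: transport_seg (phiP w) s2.
  have [s2' r l] : [/\ seg_in (beyond q') z1 z2, right_of q' z1 & left_of q' z2].
    by move: s2 q'N; rewrite /crosses; case: q'.
  have b1' : beyond q' z1 by have := s2' 0; rewrite seg0; apply; rewrite lexx ler01.
  have b2' : beyond q' z2 by have := s2' 1; rewrite seg1; apply; rewrite lexx ler01.
  rewrite -(psi_right w q'N b1' r) -(IHw q' z2 q'N b2' l).
  exact: transport_seg (psiP w q'N) s2'.
have T3 : transport c n (seg_path z2 (base (output q x))) (phi (state_act q' w) z2)
    (phi (state_act q' w) (base (output q x))).
  rewrite /n -(size_state_act q' w); exact: transport_seg (phiP _) s3.
have A1 := avoiding_qseg slit_not_post q1.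
have A2 := avoiding_qseg nPb q2.
have A3 := avoiding_qseg slit_not_post q3.
have E1 : phi (x :: w) (quad c z1) = phi w z1.
  have D1 := transport_qseg (phiP (x :: w)) q1.
  rewrite quad_base phi_cons in D1.
  exact: (transport_unique post_c post_quad A1 D1 (transportS T1)).
have E2 : psi q (x :: w) (quad c z2) = phi (state_act q' w) z2.
  have D2 := transport_qseg (psiP (x :: w) qN) q2.
  rewrite (psi_right (x :: w) qN b1 r1) E1 in D2.
  exact: (transport_unique post_c post_quad A2 D2 (transportS T2)).
(* On the last side the known value is the one over the end point [a], so uniqueness is applied
   backwards. *)
have E3 : phi (state_act q (x :: w)) (quad c z2) = phi (state_act q' w) z2.
  have D3 := transport_qseg (phiP (output q x :: state_act q' w)) q3.
  rewrite quad_base phi_cons [size _]/= size_state_act in D3.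
  exact: (transport_inj A3 D3 (transportS T3)).
have := @branch_unique (beyond q `&` left_of q) (size w).+1 (quad c z2)
  (psi q (x :: w)) (phi (state_act q (x :: w))).
apply=> //.
- exact: star_beyond_left.
- by move=> t [bt _]; exact: nPb.
- by apply: branch_sub (psiP (x :: w) qN) => t [].
- have := phiP (state_act q (x :: w)); rewrite size_state_act; apply: branch_sub.
  by move=> t [bt lt]; exact: left_slit lt.
- by rewrite E2 E3.
Qed.
End frames.

Lemma size_treeAut (g : treeAut binary_tree) (w : seq bool) : size (g w) = size w.
Proof.
elim/last_ind: w => [|w x IHw]; first by have -> : g [::] = [::] := iso_root g.
have [y /= ->] : @child binary_tree (g w) (g (rcons w x)).
  by apply/(iso_child g w (rcons w x)); exists x.
by rewrite !size_rcons IHw.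
Qed.

Lemma GA_state (q : state) : GA (state_aut q).
Proof.
move=> S [[S1 SM SV] gS]; case: q; first by apply: gS; left; left.
- by apply: gS; left; right.
- by apply: gS; right.
- have -> : state_aut st_id = 1%g by apply: treeIso_eq => w /=; exact: state_act_id.
  exact: S1.
Qed.

Lemma GA_subgroup : is_subgroup GA.
Proof.
split=> [S [[S1 _ _] _]|x y gx gy S hS|x gx S hS]; first exact: S1.
  by have [[_ SM _] _] := hS; apply: SM; [exact: gx|exact: gy].
by have [[_ _ SV] _] := hS; apply: SV; exact: gx.
Qed.

Lemma locally_constant (R : realType) (S : set R) (s t : R) :
  (forall s0, nbhs s0 [set s | S s <-> S s0]) -> S s -> S t.
Proof.
move=> loc Ss; have cT : connected [set: R] by apply/connected_intervalP.
suff -> : S = [set: R] by [].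
apply: cT; first by exists s.
- exists S; last by rewrite setTI.
  rewrite openE => u Su; rewrite /interior; apply: filterS (loc u) => v vu.
  exact/vu.
- exists S; last by rewrite setTI.
  rewrite -openC openE => u Su; rewrite /interior; apply: filterS (loc u) => v vu.
  by move=> /vu.
Qed.

Lemma continuous_at_open (T U : topologicalType) (f : T -> U) (x : T) (A : set U) :
  {for x, continuous f} -> open A -> A (f x) -> nbhs x [set t | A (f t)].
Proof. by move=> cf oA Ax; apply: cf; exact: open_nbhs_nbhs. Qed.

(** * Transport of labellings *)

Section monodromy_frames.
Variable R : realType.
Local Notation C := (R[i]^o).
Variable a : C.
Hypothesis Ha : tribonacci_conjugate a.
Local Notation c := (tribonacci_quad a).
Local Notation P := (post_points a).
Local Notation slit := (slit a).
Local Notation beyond := (beyond a).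
Local Notation left_of := (left_of a).
Local Notation right_of := (right_of a).
Local Notation base := (base a).
Local Notation phi := (phi a).
Local Notation psi := (psi a).
Let Pc : P c := post_c a.
Let Pq := post_quad Ha.

(** These conditions make [theta] an isomorphism from the binary tree to the tree of preimages of
    [z]: by [frame_inj] and [frame_surj] it is bijective on each level. *)
Definition frame (z : C) (theta : seq bool -> C) : Prop :=
  [/\ forall w, iquad c (size w) (theta w) = z,
      forall w x, quad c (theta (rcons w x)) = theta w
    & forall w, theta (rcons w false) <> theta (rcons w true)].

Lemma frame_opp (z : C) (theta : seq bool -> C) (w : seq bool) : frame z theta ->
  theta (rcons w true) = - theta (rcons w false).
Proof.
move=> [_ tq tN]; have : quad c (theta (rcons w true)) = quad c (theta (rcons w false)).
  by rewrite !tq.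
move/quad_inj/eqP; rewrite eqf_sqr => /orP[/eqP e|/eqP //].
by case: (tN w).
Qed.

Lemma frame_inj (z : C) (theta : seq bool -> C) (v w : seq bool) : frame z theta ->
  size v = size w -> theta v = theta w -> v = w.
Proof.
move=> F; have [_ tq tN] := F.
elim/last_ind: v w => [|v x IHv] w; first by case: w.
case/lastP: w => [|w y]; first by rewrite size_rcons.
rewrite !size_rcons => -[vw] e; have E : v = w by apply: IHv => //; rewrite -(tq v x) e tq.
subst w; congr rcons; case: x y e => [] [] // e; last by case: (tN v).
by case: (tN v); rewrite e.
Qed.

Lemma frame_surj (z : C) (theta : seq bool -> C) (n : nat) (y : C) : frame z theta ->
  iquad c n y = z -> exists2 w, size w = n & theta w = y.
Proof.
move=> F; have [tz tq _] := F; elim: n y => [|n IHn] y yE.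
  exists [::] => //; exact: etrans (tz [::]) (esym yE).
rewrite iquadSr in yE; have [w wn wE] := IHn _ yE.
have : quad c y = quad c (theta (rcons w false)) by rewrite tq wE.
move/quad_inj/eqP; rewrite eqf_sqr => /orP[]/eqP ->.
  by exists (rcons w false) => //; rewrite size_rcons wn.
by exists (rcons w true); rewrite ?size_rcons ?wn // (frame_opp w F).
Qed.

Definition carries (gamma : R -> C) (theta theta' : seq bool -> C) : Prop :=
  forall w, transport c (size w) gamma (theta w) (theta' w).

Lemma transport_quad (n : nat) (gamma : R -> C) (y y' : C) :
  transport c n.+1 gamma y y' -> transport c n gamma (quad c y) (quad c y').
Proof.
move=> [f [cf fE f0 f1]]; exists (fun s => quad c (f s)); split.
- by move=> s; apply: continuous_quad; exact: cf.
- by move=> s; rewrite -iquadSr fE.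
- by rewrite f0.
- by rewrite f1.
Qed.

Lemma carries_frame (gamma : R -> C) (theta theta' : seq bool -> C) :
  avoiding_path P gamma -> carries gamma theta theta' -> frame (gamma 0) theta ->
  frame (gamma 1) theta'.
Proof.
move=> Hg tr [tz tq tN]; split=> [w|w x|w e].
- by have [f [_ fE _ <-]] := tr w; exact: fE.
- have := tr (rcons w x); rewrite size_rcons => /transport_quad; rewrite tq => h.
  exact: (transport_unique Pc Pq Hg h (tr w)).
- have h0 := tr (rcons w false); have h1 := tr (rcons w true).
  rewrite !size_rcons -e in h0 h1; exact: (tN w (transport_inj Ha Hg h0 h1)).
Qed.

(** Siblings that coincide somewhere in the slit plane coincide at [a], by transport back along a
    segment. Thus distinctness passes from [a] to [base x], and from there to words with one more
    letter in front. *)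
Lemma phi_frame_a : frame a (phi^~ a).
Proof.
suff H w : phi (rcons w false) a <> phi (rcons w true) a.
  split=> [w|w x|//]; first exact: ((phiP Ha w).2 _ (slit_a a)).
  by rewrite phi_quad //; exact: slit_a.
have away v : phi (rcons v false) a <> phi (rcons v true) a ->
    forall z, slit z -> phi (rcons v false) z <> phi (rcons v true) z.
  move=> vN z Sz e; apply: vN.
  have Sg : seg_in slit a z by move=> s; exact: star_slit.
  have h0 := transport_seg (phiP Ha (rcons v false)) Sg.
  have h1 := transport_seg (phiP Ha (rcons v true)) Sg.
  rewrite !size_rcons -e in h0 h1.
  exact: (transport_inj Ha (avoiding_seg (slit_not_post Ha) Sg) h0 h1).
elim: w => [|x w IHw].
  by rewrite [rcons _ _]/= [rcons _ true]/= !phi_cons // => /(base_inj Ha).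
by rewrite !rcons_cons !phi_cons //; apply: away => //; exact: slit_base.
Qed.

Definition region (q : state) : set C := if q is st_id then slit else beyond q.

Definition field (q : state) : seq bool -> C -> C := if q is st_id then phi else psi q.

Lemma region_cover (z : C) : ~ P z -> exists q, region q z.
Proof. by move=> /(slit_or_beyond Ha)[Sz|[q qN bz]]; [exists st_id|exists q; case: q qN bz]. Qed.

Lemma region_not_post (q : state) (z : C) : region q z -> ~ P z.
Proof. by case: q; [exact: beyond_not_post|exact: beyond_not_post|exact: beyond_not_post|exact: slit_not_post]. Qed.

Lemma open_region (q : state) : open (region q).
Proof. by case: q; [exact: open_beyond|exact: open_beyond|exact: open_beyond|exact: open_slit]. Qed.

Lemma fieldP (q : state) (w : seq bool) : branch_on a (region q) (size w) (field q w).
Proof. by case: q => /=; [exact: psiP|exact: psiP|exact: psiP|exact: phiP]. Qed.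

Lemma field_slit (q : state) (z : C) : region q z -> slit z ->
  exists2 h : treeAut binary_tree, GA h & forall w, field q w z = phi (h w) z.
Proof.
have [G1 _ _] := GA_subgroup.
have [->|qN] := pselect (q = st_id); first by exists 1%g.
have -> : region q = beyond q by case: q qN.
have -> : field q = psi q by case: q qN.
move=> bz Sz; have := slit_beyond_Im Sz bz; rewrite neq_lt => /orP[y0|y0].
  by exists 1%g => // w; apply: psi_right => //; apply/right_ofE.
exists (state_aut q) => [|w]; first exact: GA_state.
by apply: psi_left => //; apply/left_ofE.
Qed.

(** Distinct regions overlap only inside the slit plane, where both labellings are compared with
    [phi]. *)
Lemma field_change (q q' : state) (z : C) : region q z -> region q' z ->
  exists2 h : treeAut binary_tree, GA h & forall w, field q w z = field q' (h w) z.
Proof.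
have [G1 GM GV] := GA_subgroup.
have [<- _ _|qq'] := pselect (q = q'); first by exists 1%g.
move=> rz rz'; have Sz : slit z.
  case: q q' qq' rz rz' => [] [] //= qq' rz rz'; exact: (beyond_beyond_slit Ha _ _ qq' rz rz').
have [h gh hE] := field_slit rz Sz; have [h' gh' hE'] := field_slit rz' Sz.
exists (h'^-1 * h)%g => [|w]; first by apply: GM => //; exact: GV.
by rewrite hE hE' /= iso_invK.
Qed.

Definition in_orbit (q : state) (z : C) (theta : seq bool -> C) : Prop :=
  exists2 g : treeAut binary_tree, GA g & forall w, theta w = field q (g w) z.

Definition good (z : C) (theta : seq bool -> C) : Prop :=
  exists2 q, region q z & in_orbit q z theta.

Lemma good_in (q : state) (z : C) (theta : seq bool -> C) : region q z ->
  good z theta -> in_orbit q z theta.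
Proof.
have [_ GM _] := GA_subgroup.
move=> rz [q' rz' [g gg gE]]; have [h gh hE] := field_change rz' rz.
by exists (h * g)%g => [|w]; [exact: GM|rewrite gE hE].
Qed.

(** Near [s0] the path stays in one region. By uniqueness of lifts, the element of [GA] that matches
    the labelling with the field of this region does not change there. *)
Lemma good_locally (gamma : R -> C) (f : seq bool -> R -> C) (s0 : R) :
  avoiding_path P gamma -> (forall w s, {for s, continuous (f w)}) ->
  (forall w s, iquad c (size w) (f w s) = gamma s) ->
  nbhs s0 [set s | good (gamma s) (f^~ s) <-> good (gamma s0) (f^~ s0)].
Proof.
move=> [cg gP] cf fE; have [q rq] := region_cover (gP s0).
have := continuous_at_open (cg s0) (@open_region q) rq.
move=> /nbhs_ballP[e /= e0 eq]; apply/nbhs_ballP; exists e => //= s s0s.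
have rs t : Num.min s0 s <= t <= Num.max s0 s -> region q (gamma t).
  move=> ts; apply: eq; move: s0s ts; rewrite -ball_normE /=.
  by case: (leP s0 s) => ss; rewrite !ltr_norml => /andP[h1 h2] /andP[h3 h4]; apply/andP; split; lra.
have step g u u' : (u = s0 /\ u' = s) \/ (u = s /\ u' = s0) ->
    (forall w, f w u = field q (g w) (gamma u)) -> (forall w, size (g w : seq bool) = size w) ->
    forall w, f w u' = field q (g w) (gamma u').
  move=> uu' gE gs w; have [cF FE] := fieldP q (g w); rewrite gs in FE.
  have ru t : Num.min u u' <= t <= Num.max u u' -> region q (gamma t).
    by case: uu' => -[-> ->]; [exact: rs|rewrite minC maxC; exact: rs].
  apply: (@path_unique _ c P Pc Pq (size w) (f w) (fun t => field q (g w) (gamma t)) u u').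
  - by move=> t _; exact: cf.
  - by move=> t /ru rt; apply: (continuous_at_comp (cg t)); exact: cF.
  - by move=> t /ru rt; rewrite fE FE.
  - by move=> t /ru rt; rewrite FE //; exact: gP.
  - exact: gE.
have rqs : region q (gamma s) by apply: rs; rewrite ge_min lexx orbT le_max lexx orbT.
split=> [/(good_in rqs)|/(good_in rq)] [g gg gE]; exists q => //; exists g => //.
  by apply: (step g s s0) => //; [right|exact: size_treeAut].
by apply: (step g s0 s) => //; [left|exact: size_treeAut].
Qed.

(** The parameters with a good labelling form an open and closed subset of the line. This replaces a
    decomposition of the path into generators. *)
Lemma good_carries (gamma : R -> C) (theta theta' : seq bool -> C) :
  avoiding_path P gamma -> carries gamma theta theta' ->
  good (gamma 0) theta -> good (gamma 1) theta'.
Proof.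
move=> Hg /choice[f fP] gd.
have f0 : theta = f^~ 0 by apply/funext => w; have [_ _ <-] := fP w.
have f1 : theta' = f^~ 1 by apply/funext => w; have [_ _ _ <-] := fP w.
rewrite f0 f1 in gd *.
apply: (@locally_constant R [set s | good (gamma s) (f^~ s)] 0 1) gd => s0.
apply: good_locally => // w s; have [cf fE _ _] := fP w; [exact: cf|exact: fE].
Qed.

Definition reach (z : C) (theta : seq bool -> C) (z' : C) (theta' : seq bool -> C) : Prop :=
  exists gamma, [/\ avoiding_path P gamma, gamma 0 = z, gamma 1 = z' & carries gamma theta theta'].

Lemma reach_trans (z1 z2 z3 : C) (t1 t2 t3 : seq bool -> C) :
  reach z1 t1 z2 t2 -> reach z2 t2 z3 t3 -> reach z1 t1 z3 t3.
Proof.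
move=> [g [Hg g0 g1 gt]] [d [Hd d0 d1 dt]]; have gd : g 1 = d 0 by rewrite g1 d0.
exists (path_cat g d); split.
- exact: avoiding_cat.
- by rewrite path_cat0.
- by rewrite path_cat1.
- by move=> w; exact: (transport_cat gd (gt w) (dt w)).
Qed.

Lemma reach_sym (z1 z2 : C) (t1 t2 : seq bool -> C) : reach z1 t1 z2 t2 -> reach z2 t2 z1 t1.
Proof.
move=> [g [Hg g0 g1 gt]]; exists (path_rev g); split.
- exact: avoiding_rev.
- by rewrite /path_rev subr0.
- by rewrite /path_rev subrr.
- by move=> w; exact: transport_rev.
Qed.

Lemma reach_precomp (z1 z2 : C) (t1 t2 : seq bool -> C) (g : treeAut binary_tree) :
  reach z1 t1 z2 t2 -> reach z1 (fun w => t1 (g w)) z2 (fun w => t2 (g w)).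
Proof.
move=> [ga [Hg g0 g1 gt]]; exists ga; split=> // w.
by rewrite -(size_treeAut g w); exact: gt.
Qed.

Lemma reach_region (q : state) (z z' : C) : seg_in (region q) z z' ->
  reach z ((field q)^~ z) z' ((field q)^~ z').
Proof.
move=> rz; exists (seg_path z z'); split.
- by apply: avoiding_seg rz => t; exact: region_not_post.
- exact: seg_path0.
- exact: seg_path1.
- by move=> w; exact: transport_seg (fieldP q w) rz.
Qed.

Lemma reach_slit (z : C) : slit z -> reach a (phi^~ a) z (phi^~ z).
Proof. by move=> Sz; apply: (@reach_region st_id) => s; exact: star_slit. Qed.

Lemma reach_beyond (q : state) (z z' : C) : q <> st_id -> beyond q z -> beyond q z' ->
  reach z ((psi q)^~ z) z' ((psi q)^~ z').
Proof.
move=> qN bz bz'; have := @reach_region q z z'.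
have -> : region q = beyond q by case: q qN {bz bz'}.
have -> : field q = psi q by case: q qN {bz bz'}.
by apply=> s; exact: star_beyond.
Qed.

(** The loop leaves [a] for the right side of the cut, crosses the cut and returns from the left
    side; [psi q] is [phi] on the right and [phi] after [q] on the left. *)
Lemma reach_generator (q : state) :
  reach a (phi^~ a) a (fun w => phi (state_aut q w) a).
Proof.
have [->|qN] := pselect (q = st_id).
  have -> : (fun w => phi (state_aut st_id w) a) = phi^~ a.
    by apply/funext => w /=; rewrite state_act_id.
  exact: reach_slit (slit_a a).
have [r br rr] := right_point Ha qN; have [l bl ll] := left_point Ha qN.
have h1 := reach_slit (right_slit Ha qN br rr).
have h2 := reach_beyond qN br bl.
have h3 := reach_precomp (state_aut q) (reach_sym (reach_slit (left_slit Ha qN bl ll))).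
have e1 : (psi q)^~ r = phi^~ r by apply/funext => w; exact: psi_right.
have e2 : (psi q)^~ l = fun w => phi (state_aut q w) l.
  by apply/funext => w; exact: psi_left.
by rewrite e1 e2 in h2; exact: reach_trans h1 (reach_trans h2 h3).
Qed.

Lemma reach_GA (g : treeAut binary_tree) : GA g ->
  reach a (phi^~ a) a (fun w => phi (g w) a).
Proof.
move/(_ [set g : treeAut binary_tree | reach a (phi^~ a) a (fun w => phi (g w) a)]).
apply; split=> [|h [[->|->]|->]]; [|exact: reach_generator|exact: reach_generator|exact: reach_generator].
split.
- exact: reach_slit (slit_a a).
(* In [x * y] the factor [y] acts first: the loop of [y] comes first, then that of [x], relabelled
   by [y]. *)
- move=> x y rx ry; exact: reach_trans ry (reach_precomp y rx).
- move=> x /reach_sym/(reach_precomp x^-1%g).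
  have -> // : (fun w => phi (x ((x^-1)%g w)) a) = phi^~ a.
  by apply/funext => w; rewrite (iso_invK x).
Qed.

Lemma reach_base (q : state) (z : C) : region q z -> reach a (phi^~ a) z ((field q)^~ z).
Proof.
have [->|qN] := pselect (q = st_id); first exact: reach_slit.
have -> : region q = beyond q by case: q qN.
have -> : field q = psi q by case: q qN.
move=> bz; have [r br rr] := right_point Ha qN.
have h2 := reach_beyond qN br bz.
have e1 : (psi q)^~ r = phi^~ r by apply/funext => w; exact: psi_right.
rewrite e1 in h2; exact: reach_trans (reach_slit (right_slit Ha qN br rr)) h2.
Qed.

Lemma field_frame (q : state) (z : C) : region q z -> frame z ((field q)^~ z).
Proof.
move=> /reach_base[g [Hg g0 <- gt]]; apply: carries_frame gt _ => //.
by rewrite g0; exact: phi_frame_a.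
Qed.

Lemma reach_loop (q : state) (z : C) (g : treeAut binary_tree) : region q z -> GA g ->
  reach z ((field q)^~ z) z (fun w => field q (g w) z).
Proof.
move=> /reach_base h /reach_GA hg.
exact: reach_trans (reach_sym h) (reach_trans hg (reach_precomp g h)).
Qed.

Lemma carries_GA (q : state) (z : C) (gamma : R -> C) (theta : seq bool -> C) :
  region q z -> avoiding_path P gamma -> gamma 0 = z -> gamma 1 = z ->
  carries gamma ((field q)^~ z) theta -> in_orbit q z theta.
Proof.
have [G1 _ _] := GA_subgroup.
move=> rz Hg g0 g1 gt; apply: good_in => //; rewrite -g1.
by apply: good_carries gt _ => //; rewrite g0; exists q => //; exists 1%g.
Qed.
End monodromy_frames.

(** * Loops on the unit interval and their homotopies *)

Lemma within_continuous_comp (T U V : topologicalType) (A : set U) (r : T -> U) (f : U -> V)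
    (t : T) : {for t, continuous r} -> (forall t, A (r t)) -> {within A, continuous f} ->
  {for t, continuous (fun x => f (r x))}.
Proof.
move=> cr Ar /subspace_continuousP cf W nW.
have := cr _ (cf (r t) (Ar t) W nW); rewrite /= !nbhs_simpl /=.
by apply: filterS => x /= h; apply: h.
Qed.

Section clamped.
Variable R : realType.
Local Notation C := (R[i]^o).
Local Notation I := (`[0%R : R, 1%R]%classic).

Lemma unit_clamp (s : R) : I (clamp s).
Proof. by rewrite /= in_itv /= clamp01. Qed.

Lemma clamp_unit (s : R) : I s -> clamp s = s.
Proof. by rewrite /= in_itv /=; exact: clamp_id. Qed.

Lemma continuous_clamped (gamma : R -> C) (s : R) :
  {within I, continuous gamma} -> {for s, continuous (fun s => gamma (clamp s))}.
Proof.
move=> cg; apply: (@within_continuous_comp R R C I _ gamma s _ unit_clamp cg).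
by apply: continuous_clamp; exact: cvg_id.
Qed.

Lemma continuous_clamped2 (H : R * R -> C) (x : R * R) :
  {within I `*` I, continuous H} ->
  {for x, continuous (fun x : R * R => H (clamp x.1, clamp x.2))}.
Proof.
move=> cH; pose r (x : R * R) := (clamp x.1, clamp x.2).
have cr : {for x, continuous r}.
  by apply: continuous_at_pair; apply: continuous_clamp; [exact: cvg_fst|exact: cvg_snd].
have Ir y : (I `*` I) (r y) by split; exact: unit_clamp.
exact: (@within_continuous_comp _ _ C (I `*` I) r H x cr Ir cH).
Qed.

Lemma continuous_slice1 (H : R * R -> C) (r s : R) :
  (forall x, {for x, continuous H}) -> {for s, continuous (fun s => H (s, r))}.
Proof.
move=> cH; apply: (@continuous_at_comp _ _ _ (fun s => (s, r)) H); last exact: cH.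
by apply: continuous_at_pair; [exact: cvg_id|exact: cst_continuous].
Qed.

Lemma continuous_slice2 (H : R * R -> C) (r s : R) :
  (forall x, {for x, continuous H}) -> {for r, continuous (fun r => H (s, r))}.
Proof.
move=> cH; apply: (@continuous_at_comp _ _ _ (fun r => (s, r)) H); last exact: cH.
by apply: continuous_at_pair; [exact: cst_continuous|exact: cvg_id].
Qed.
End clamped.

Section homotopy.
Variable R : realType.
Local Notation C := (R[i]^o).
Local Notation I := (`[0%R : R, 1%R]%classic).
Variables (c : C) (P : set C).
Hypothesis Pc : P c.
Hypothesis Pquad : forall z, P z -> P (quad c z).

(** In the lifted square, the edge over [gamma] is the given lift, by uniqueness. The two sides lie
    over [z0] and are constant, so the edge over [delta] has the same end points. *)
Lemma transport_homotopic (n : nat) (z0 y y' : C) (gamma delta : R -> C) :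
  avoiding_path P gamma -> loop_homotopic (~` P) z0 gamma delta -> transport c n gamma y y' ->
  exists lift : R -> C, [/\ {within I, continuous lift},
    (forall s, I s -> iquad c n (lift s) = delta s), lift 0 = y & lift 1 = y'].
Proof.
move=> Hg [H [cH HP Hg0 Hd H01]] [f [cf fE f0 f1]].
have i0 : I 0 by rewrite /= in_itv /= lexx ler01.
have i1 : I 1 by rewrite /= in_itv /= lexx ler01.
pose K (x : R * R) := H (clamp x.1, clamp x.2).
have cK x : {for x, continuous K} by exact: continuous_clamped2.
have KP x : ~ P (K x).
  by apply: HP; exists (clamp x.1, clamp x.2) => //; split; exact: unit_clamp.
have yE : iquad c n y = K (0, 0).
  by rewrite /K /= (clamp_unit i0) Hg0 // -fE f0.
have [L [cL LE L0]] := square_lift Pc Pquad cK KP yE.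
have bottom : L (1, 0) = y'.
  rewrite -f1; apply: (@path_unique R c P Pc Pquad n (fun s => L (s, 0)) f 0 1).
  - by move=> s _; exact: continuous_slice1.
  - by move=> s _; exact: cf.
  - move=> s; rewrite min_l ?ler01 // max_r ?ler01 // => s01.
    have Is : I s by rewrite /= in_itv.
    by rewrite LE fE /K /= (clamp_unit i0) (clamp_unit Is) Hg0.
  - by move=> s _; rewrite fE; have [_] := Hg; apply.
  - by rewrite L0 f0.
have side (u : R) : I u -> u = 0 \/ u = 1 -> L (u, 1) = L (u, 0).
  move=> Iu u01; symmetry.
  have E t : K (u, t) = z0.
    have [h0 h1] := H01 _ (unit_clamp t).
    by rewrite /K [(u, t).1]/= (clamp_unit Iu); case: u01 => ->; [exact: h0|exact: h1].
  apply: (@path_unique R c P Pc Pquad n (fun=> L (u, 0)) (fun r => L (u, r)) 0 1).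
  - by move=> s _; exact: cst_continuous.
  - by move=> s _; exact: continuous_slice2.
  - by move=> s _; rewrite !LE !E.
  - by move=> s _; rewrite LE; exact: KP.
  - by [].
exists (fun s => L (s, 1)); split.
- by apply: continuous_subspaceT => s; exact: continuous_slice1.
- by move=> s Is; rewrite LE /K /= (clamp_unit i1) (clamp_unit Is) Hd.
- by rewrite side //; left.
- by rewrite side //; right.
Qed.

Lemma loop_avoiding (z0 : C) (gamma : R -> C) : is_loop (~` P) z0 gamma ->
  avoiding_path P (fun s => gamma (clamp s)).
Proof.
move=> [cg gP _ _]; split=> s; first exact: continuous_clamped.
by apply: gP; exists (clamp s) => //; exact: unit_clamp.
Qed.

Lemma avoiding_loop (z0 : C) (gamma : R -> C) : avoiding_path P gamma ->
  gamma 0 = z0 -> gamma 1 = z0 -> is_loop (~` P) z0 gamma.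
Proof.
move=> [cg gP] g0 g1; split=> //; first exact: continuous_subspaceT.
by move=> _ [s _ <-]; exact: gP.
Qed.

Lemma loop_homotopic_refl (z0 : C) (gamma : R -> C) : is_loop (~` P) z0 gamma ->
  loop_homotopic (~` P) z0 gamma gamma.
Proof.
move=> Lg; have [cg nP] := loop_avoiding Lg; have [_ _ g0 g1] := Lg.
have i0 : I 0 by rewrite /= in_itv /= lexx ler01.
have i1 : I 1 by rewrite /= in_itv /= lexx ler01.
exists (fun x => gamma (clamp x.1)); split.
- apply: continuous_subspaceT => x.
  apply: (@continuous_at_comp _ _ _ (fun x : R * R => x.1) (fun s => gamma (clamp s))).
    exact: cvg_fst.
  exact: cg.
- by move=> _ [x _ <-]; exact: nP.
- by move=> s Is; rewrite [(s, 0).1]/= clamp_unit.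
- by move=> s Is; rewrite [(s, 1).1]/= clamp_unit.
- by move=> r _; rewrite [(0, r).1]/= [(1, r).1]/= !clamp_unit.
Qed.
End homotopy.

(** * Identification with the iterated monodromy group *)

Section iterated_monodromy.
Variable R : realType.
Local Notation C := (R[i]^o).
Local Notation I := (`[0%R : R, 1%R]%classic).
Variable a : C.
Hypothesis Ha : tribonacci_conjugate a.
Local Notation c := (tribonacci_quad a).
Local Notation P := (post_points a).
Let Pc : P c := post_c a.
Let Pq := post_quad Ha.

Definition tribonacci_poly : {poly R[i]} := 'X^2 + (c : R[i])%:P.
Local Notation p := tribonacci_poly.

Lemma horner_tribonacci (z : C) : p.[z] = quad c z.
Proof. by rewrite /tribonacci_poly hornerD hornerXn hornerC. Qed.

Lemma iterate_tribonacci (n : nat) (z : C) : iterate p n z = iquad c n z.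
Proof. by apply: eq_iter => w; exact: horner_tribonacci. Qed.

Lemma size_tribonacci : size p = 3%N.
Proof. by rewrite /tribonacci_poly size_polyDl size_polyXn // (leq_ltn_trans (size_polyC_leq1 _)). Qed.

Lemma critical_tribonacci (z : C) : critical p z -> z = 0.
Proof.
rewrite /critical /= /tribonacci_poly derivD derivC addr0 derivXn /= rootE hornerMn hornerX.
by rewrite mulrn_eq0 => /eqP.
Qed.

Lemma critical0_tribonacci : critical p 0.
Proof. by rewrite /critical /= /tribonacci_poly derivD derivC addr0 derivXn /= rootE hornerMn hornerX mul0rn. Qed.

Lemma iquad0_post (n : nat) : P (iquad c n.+1 0).
Proof.
elim: n => [|n IHn]; last exact: Pq.
by rewrite iquadS /quad /= expr0n add0r; exact: Pc.
Qed.

Lemma forward_orbit_post : forward_orbit p 0 `<=` P.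
Proof. by move=> _ [[|n] // _ <-]; rewrite iterate_tribonacci; exact: iquad0_post. Qed.

Lemma post_critical_tribonacci : post_critical p = P.
Proof.
apply/seteqP; split=> [z [w /critical_tribonacci ->]|_ [q qN ->]].
  exact: forward_orbit_post.
exists 0; first exact: critical0_tribonacci.
have h0 : quad c 0 = a + spoke a st_t.
  by rewrite /quad /tribonacci_quad /spoke; ring.
case: q qN => // _.
- by exists 2%N => //; rewrite iterate_tribonacci /iquad /= h0 quad_spoke.
- by exists 3%N => //; rewrite iterate_tribonacci /iquad /= h0 !quad_spoke.
- by exists 1%N => //; rewrite iterate_tribonacci /iquad /= h0.
Qed.

Lemma post_critically_finite_tribonacci : post_critically_finite p.
Proof.
move=> z /critical_tribonacci ->; apply: sub_finite_set forward_orbit_post _.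
have : finite_set ([set a + spoke a st_a; a + spoke a st_b; a + spoke a st_t] : set C).
  by [].
apply: sub_finite_set => _ [[] // _ ->]; [by left; left|by left; right|by right].
Qed.

Variables (z0 : C) (q : state).
Hypothesis rq : region a q z0.
Local Notation theta := (fun w => field a q w z0).
Local Notation T := (preimage_tree p z0).

Let theta_frame : frame a z0 theta := field_frame Ha rq.

Lemma vertex_proof (w : seq bool) : iterate p (size w, theta w).1 (size w, theta w).2 = z0.
Proof. by rewrite iterate_tribonacci; have [+ _ _] := theta_frame; apply. Qed.

Definition word_vertex (w : binary_tree) : T := exist _ (size w, theta w) (vertex_proof w).

Lemma preimage_vertex_eq (u v : T) : sval u = sval v -> u = v.
Proof. by case: u v => [u up] [v vp] /= uv; subst v; congr exist; exact: Prop_irrelevance. Qed.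

Lemma word_vertex_inj (v w : binary_tree) : word_vertex v = word_vertex w -> v = w.
Proof. by move=> /(congr1 sval)[sz e]; exact: (frame_inj theta_frame sz e). Qed.

Lemma word_vertex_surj (v : T) : exists w, word_vertex w = v.
Proof.
have := svalP v; rewrite iterate_tribonacci => /(frame_surj theta_frame)[w wn wE].
exists w; apply: preimage_vertex_eq; rewrite /= wn wE.
by case: (sval v).
Qed.

Definition vertex_word (v : T) : binary_tree := sval (cid (word_vertex_surj v)).

Lemma vertex_wordK : cancel vertex_word word_vertex.
Proof. by move=> v; rewrite /vertex_word; case: cid. Qed.

Lemma word_vertexK : cancel word_vertex vertex_word.
Proof. by move=> w; apply: word_vertex_inj; rewrite vertex_wordK. Qed.

Lemma word_vertex_root : word_vertex (root_vertex binary_tree) = root_vertex T.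
Proof.
apply: preimage_vertex_eq => /=; congr (_, _).
by have [+ _ _] := theta_frame => /(_ [::]).
Qed.

Lemma word_vertex_child (u v : binary_tree) :
  child u v <-> child (word_vertex u) (word_vertex v).
Proof.
have [_ tq _] := theta_frame; split=> [[x /= ->]|[/= sz]].
  by split=> /=; rewrite ?size_rcons // horner_tribonacci tq.
rewrite horner_tribonacci; case/lastP: v sz => [//|v x].
rewrite size_rcons tq => -[sz] e; exists x.
by rewrite (frame_inj theta_frame sz e).
Qed.

Definition word_tree : treeIso binary_tree T :=
  TreeIso word_vertexK vertex_wordK word_vertex_root word_vertex_child.

Definition conjugate (g : treeAut binary_tree) : treeAut T :=
  treeIso_comp word_tree (treeIso_comp g (treeIso_inv word_tree)).

Lemma conjugate_vertex (g : treeAut binary_tree) (w : seq bool) :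
  conjugate g (word_vertex w) = word_vertex (g w).
Proof. by rewrite /conjugate /= word_vertexK. Qed.

(** [IMG] asks for the monodromy of every loop in the class, while [reach_loop] gives one loop;
    [transport_homotopic] covers the others. *)
Lemma conjugate_monodromy (g : treeAut binary_tree) : GA g -> @IMG R p z0 (conjugate g).
Proof.
move=> gg; have [gamma [Hg g0 g1 gt]] := reach_loop Ha rq gg.
have Lg := avoiding_loop Hg g0 g1.
exists [set delta | is_loop (~` P) z0 delta /\ loop_homotopic (~` P) z0 gamma delta].
  by rewrite post_critical_tribonacci; exists gamma.
move=> delta [_ hd] v; have [w <-] := word_vertex_surj v.
have [l [cl lE l0 l1]] := transport_homotopic Pc Pq Hg hd (gt w).
exists l; split=> //.
- by move=> s Is; rewrite iterate_tribonacci; exact: lE.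
- by rewrite conjugate_vertex /= size_treeAut l1.
Qed.

(** The representative [gamma] of the class suffices: it carries the labelling [theta] to its image
    under [tau], which [carries_GA] places in the [GA]-orbit of [theta]. *)
Lemma monodromy_conjugate (tau : treeAut T) : @IMG R p z0 tau ->
  exists2 g, GA g & conjugate g = tau.
Proof.
rewrite /IMG post_critical_tribonacci => -[_ [gamma Lg <-]] /(_ gamma) mg.
have {mg} mg : monodromy gamma tau by apply: mg; split=> //; exact: loop_homotopic_refl.
have [_ _ g0 g1] := Lg.
have i0 : I 0 by rewrite /= in_itv /= lexx ler01.
have i1 : I 1 by rewrite /= in_itv /= lexx ler01.
have tr : carries a (fun s => gamma (clamp s)) theta (fun w => (sval (tau (word_vertex w))).2).
  move=> w; have [l [cl lE l0 ->]] := mg (word_vertex w).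
  exists (fun s => l (clamp s)); split.
  - by move=> s; exact: continuous_clamped.
  - by move=> s; rewrite -iterate_tribonacci; apply: lE; exact: unit_clamp.
  - by rewrite clamp_unit.
  - by rewrite clamp_unit.
have [||g gg gE] := carries_GA Ha rq (loop_avoiding Lg) _ _ tr.
- by rewrite clamp_unit.
- by rewrite clamp_unit.
exists g => //; apply: treeIso_eq => v; have [w <-] := word_vertex_surj v.
rewrite conjugate_vertex; apply: preimage_vertex_eq => /=; rewrite -gE size_treeAut.
by have [l [_ _ _ ->]] := mg (word_vertex w).
Qed.
End iterated_monodromy.

Lemma GA_IMG (R : realType) (a : R[i]^o) : tribonacci_conjugate a ->
  is_IMG_of (tribonacci_poly a) GA.
Proof.
move=> Ha z0; rewrite (post_critical_tribonacci Ha) => /(region_cover Ha)[q rq].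
exists (word_tree Ha rq); apply/seteqP; split=> [_ [g gg <-]|tau].
  exact: (conjugate_monodromy Ha rq gg).
by move=> /(monodromy_conjugate Ha rq)[g gg <-]; exists g.
Qed.

Theorem theorem4p9 (R : realType) :
  subexponential_growth R GA /\
  exists p : {poly R[i]},
    [/\ size p = 3%N, post_critically_finite p & is_IMG_of p GA].
Proof.
split; first exact: growth_GA.
have [a Ha] := tribonacci_conjugate_exists R; exists (tribonacci_poly a); split.
- exact: size_tribonacci.
- exact: post_critically_finite_tribonacci.
- exact: GA_IMG.
Qed.
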